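(* For $\ast\in\{D,N,P\}$, the error in the covariance when using, respectively, homogeneous Dirichlet, homogeneous Neumann or periodic boundary conditions on $D_{ext}=(0,L)^d$ is bounded by $$\|\mathcal{C}_{\ast}^{L} - \mathcal{C}\|_{\infty} := \sup_{\boldsymbol{x},\boldsymbol{y}\in D}\left|\mathcal{C}_\ast^L(\boldsymbol{x},\boldsymbol{y})-\mathcal{C}(\boldsymbol{x},\boldsymbol{y})\right| \leq A\cdot \sigma^2\mathcal{M}_\nu(\kappa\delta).$$ The constant $A$ is given by $$A = (2^d-1)\cdot\left(1 + \frac{2^d\, d!\cdot f(\ell)}{(1-f(\ell))^d}\right),\qquad \ell=L-\delta,$$ where the function $f$ is defined for any $x>0$ as $$f(x) = \mathcal{M}_{\max(\nu,1/2)}(\kappa x),\qquad \kappa=\frac{\sqrt{2\nu}}{\rho}.$$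
   Context: Parameters: $d\in\{1,2,3\}$, $\sigma^2>0$ (marginal variance), $\nu>0$, $\rho>0$ (correlation length), $\kappa=\sqrt{2\nu}/\rho$ (also used, with the original $\nu$, in the definition of $f$), $\alpha=\nu+d/2$, and $\eta>0$ given by $\eta^2=\sigma^2\frac{(4\pi)^{d/2}\Gamma(\nu+d/2)}{\kappa^d\Gamma(\nu)}$. Matérn covariance on $\mathbb{R}^d$: $\mathcal{C}(\boldsymbol{x},\boldsymbol{y})=\sigma^2\mathcal{M}_\nu(\kappa\|\boldsymbol{x}-\boldsymbol{y}\|_2)$, where, for any $\nu>0$, $\mathcal{M}_\nu(x)=\frac{x^\nu\mathcal{K}_\nu(x)}{2^{\nu-1}\Gamma(\nu)}$ for $x>0$, $\mathcal{M}_\nu(0)=1$ (continuous extension), and $\mathcal{K}_\nu$ is the modified Bessel function of the second kind of order $\nu$. Domains: $D\subset\mathbb{R}^d$ is an open, simply connected, bounded domain, with coordinates chosen so that $\inf_{\boldsymbol{x}\in D}x_i=\delta/2$ for $i=1,\ldots,d$, where $\delta>0$; $\ell=\sup_{\boldsymbol{x},\boldsymbol{y}\in D}\|\boldsymbol{x}-\boldsymbol{y}\|_\infty$, $L=\delta+\ell$, $D_{ext}=(0,L)^d$. Bounded-domain problem: $u_L$ is the mean-zero Gaussian random field solving $(\mathcal{I}-\kappa^{-2}\Delta)^{\alpha/2}u_L=\eta\dot W$ on $D_{ext}$, where $\dot W$ is Gaussian white noise and the fractional power is defined spectrally, with one of the boundary conditions (holding almost surely, for $j=0,\ldots,\lfloor\frac{\alpha-1}{2}\rfloor$):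 (D) homogeneous Dirichlet, $(-\Delta)^ju_L=0$ on $\partial D_{ext}$; (N) homogeneous Neumann, $\partial_{\boldsymbol n}(-\Delta)^ju_L=0$ on $\partial D_{ext}$; (P) periodic boundary conditions with period $L$ in each coordinate, for $(-\Delta)^j u_L$ and its derivatives. The covariance function $\mathcal{C}^L_\ast$, $\ast\in\{D,N,P\}$, of $u_L$ is $$\mathcal{C}^L_\ast(\boldsymbol{x},\boldsymbol{y})=\eta^2\sum_{\boldsymbol{k}}\lambda_{\boldsymbol{k}}^{-\alpha}w_{\boldsymbol{k}}(\boldsymbol{x})\overline{w_{\boldsymbol{k}}(\boldsymbol{y})},$$ with $(\lambda_{\boldsymbol{k}},w_{\boldsymbol{k}})$ the eigenvalues and $L^2$-normalized eigenfunctions of $\mathcal{I}-\kappa^{-2}\Delta$ on $D_{ext}$: - Dirichlet: $\boldsymbol{k}\in\mathbb{N}^d$ with $\mathbb{N}=\{1,2,\ldots\}$, $w_{\boldsymbol{k}}(\boldsymbol{x})=\prod_{i=1}^d a_{k_i}\sin(\pi k_ix_i/L)$, $\lambda_{\boldsymbol{k}}=1+\left(\frac{\pi}{\kappa L}\right)^2\|\boldsymbol{k}\|_2^2$; - Neumann: $\boldsymbol{k}\in\mathbb{N}_0^d$ with $\mathbb{N}_0=\mathbb{N}\cup\{0\}$, $w_{\boldsymbol{k}}(\boldsymbol{x})=\prod_{i=1}^d a_{k_i}\cos(\pi k_ix_i/L)$, same $\lambda_{\boldsymbol{k}}$ as for Dirichlet; - periodic: $\boldsymbol{k}\in\mathbb{Z}^d$,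 $w_{\boldsymbol{k}}(\boldsymbol{x})=L^{-d/2}e^{\frac{2\pi \mathrm{i}}{L}\boldsymbol{k}\cdot\boldsymbol{x}}$, $\lambda_{\boldsymbol{k}}=1+\left(\frac{2\pi}{\kappa L}\right)^2\|\boldsymbol{k}\|_2^2$; where $a_{k_i}=\sqrt{1/L}$ if $k_i=0$ and $a_{k_i}=\sqrt{2/L}$ otherwise. *)

(* Defs.v *)
From mathcomp Require Import all_boot all_order all_algebra.
From mathcomp Require Import all_classical all_reals all_analysis.
From mathcomp Require Import complex.

Set Implicit Arguments.
Unset Strict Implicit.
Unset Printing Implicit Defensive.

Import Order.TTheory GRing.Theory Num.Theory.
Import numFieldNormedType.Exports.

Local Open Scope classical_set_scope.
Local Open Scope ring_scope.

Section special_functions.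
Variable R : realType.
Implicit Types a nu x t : R.

Definition Gamma a : R :=
  Rintegral lebesgue_measure `]0, +oo[%classic
    (fun t => t `^ (a - 1) * expR (- t)).

Definition cosh t : R := (expR t + expR (- t)) / 2.

(* K_nu(x) = \int_0^oo exp(-x cosh t) cosh(nu t) dt, for x > 0 *)
Definition besselK nu x : R :=
  Rintegral lebesgue_measure `[0, +oo[%classic
    (fun t => expR (- (x * cosh t)) * cosh (nu * t)).

(* only used for 0 <= x; the value at 0 is the continuous extension *)
Definition matern nu x : R :=
  if 0 < x then x `^ nu * besselK nu x / (2 `^ (nu - 1) * Gamma nu) else 1.

End special_functions.

Section geometry.
Variables (R : realType) (d : nat).
Implicit Types (D : set 'rV[R]_d) (x y : 'rV[R]_d).

(* the norm `|x| provided by the library on 'rV[R]_d is the sup norm *)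
Definition norm2 x : R := Num.sqrt (\sum_(i < d) x 0 i ^+ 2).

Definition path_in D (g : R -> 'rV[R]_d) : Prop :=
  {within `[0, 1]%classic, continuous g} /\ g @` `[0, 1]%classic `<=` D.

Definition path_connected D : Prop :=
  forall x y, D x -> D y -> exists g, [/\ path_in D g, g 0 = x & g 1 = y].

(* homotopy H (s, t) relative to the base point, s being the deformation
   parameter *)
Definition null_homotopic_in D (g : R -> 'rV[R]_d) : Prop :=
  exists H : R * R -> 'rV[R]_d,
    [/\ {within `[0, 1]%classic `*` `[0, 1]%classic, continuous H},
        H @` (`[0, 1]%classic `*` `[0, 1]%classic) `<=` D,
        forall t, t \in `[0, 1] -> H (0, t) = g t /\ H (1, t) = g 0 &
        forall s, s \in `[0, 1] -> H (s, 0) = g 0 /\ H (s, 1) = g 0].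

Definition simply_connected D : Prop :=
  path_connected D /\
  forall g, path_in D g -> g 0 = g 1 -> null_homotopic_in D g.

End geometry.

Section covariances.
Variables (R : realType) (d : nat).
Implicit Types (x y : 'rV[R]_d) (k : 'rV[int]_d).

Definition matern_cov (sigma nu kappa : R) x y : R :=
  sigma ^+ 2 * matern nu (kappa * norm2 (x - y)).

Inductive boundary_condition := Dirichlet | Neumann | Periodic.

Definition modes (bc : boundary_condition) : set 'rV[int]_d :=
  match bc with
  | Dirichlet => [set k : 'rV[int]_d | forall i, 1 <= k 0 i]
  | Neumann => [set k : 'rV[int]_d | forall i, 0 <= k 0 i]
  | Periodic => setT
  end.

Definition eigenvalue (bc : boundary_condition) (kappa L : R) k : R :=
  let sqk : R := \sum_(i < d) (k 0 i)%:~R ^+ 2 in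
  match bc with
  | Dirichlet | Neumann => 1 + (pi / (kappa * L)) ^+ 2 * sqk
  | Periodic => 1 + (2 * pi / (kappa * L)) ^+ 2 * sqk
  end.

Definition amplitude (L : R) (m : int) : R :=
  if m == 0 then Num.sqrt (1 / L) else Num.sqrt (2 / L).

Definition expi (t : R) : R[i] := Complex (cos t) (sin t).

Definition eigenfunction (bc : boundary_condition) (L : R) k x : R[i] :=
  match bc with
  | Dirichlet =>
      (\prod_(i < d)
         (amplitude L (k 0 i) * sin (pi * (k 0 i)%:~R * x 0 i / L)))%:C%C
  | Neumann =>
      (\prod_(i < d)
         (amplitude L (k 0 i) * cos (pi * (k 0 i)%:~R * x 0 i / L)))%:C%C
  | Periodic =>
      (L `^ (- (d%:R / 2)))%:C%C *
      expi (2 * pi / L * \sum_(i < d) (k 0 i)%:~R * x 0 i)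
  end.

(* sum of an absolutely summable family, as the difference of the sums of its
   positive and negative parts *)
Definition rsum (T : choiceType) (S : set T) (u : T -> R) : R :=
  let v := EFin \o u in
  fine (esum S (v^\+)%E - esum S (v^\-)%E)%E.

Definition csum (T : choiceType) (S : set T) (u : T -> R[i]) : R[i] :=
  Complex (rsum S (fun j => complex.Re (u j)))
          (rsum S (fun j => complex.Im (u j))).

Definition spectral_cov (bc : boundary_condition) (eta alpha kappa L : R) x y
    : R[i] :=
  (eta ^+ 2)%:C%C *
  csum (modes bc) (fun k =>
    (eigenvalue bc kappa L k `^ (- alpha))%:C%C *
    eigenfunction bc L k x * (eigenfunction bc L k y)^*%C).

(* extended real, so that an unbounded error gives +oo rather than the default
   value of the real sup *)
Definition cov_error (D : set 'rV[R]_d) (CL : 'rV[R]_d -> 'rV[R]_d -> R[i])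
    (C : 'rV[R]_d -> 'rV[R]_d -> R) : \bar R :=
  ereal_sup [set (Normc.normc (CL x y - (C x y)%:C%C))%:E | x in D & y in D].

End covariances.

Section constants.
Variable R : realType.

Definition decay (nu kappa x : R) : R := matern (Num.max nu (1 / 2)) (kappa * x).

Definition error_const (d : nat) (nu kappa ell : R) : R :=
  let fl := decay nu kappa ell in
  (2 ^+ d - 1) * (1 + 2 ^+ d * d`!%:R * fl / (1 - fl) ^+ d).

End constants.

(* Main.v *)
Require Import Defs.
From mathcomp Require Import all_boot all_order all_algebra.
From mathcomp Require Import all_classical all_reals all_analysis.
From mathcomp Require Import measurable_realfun.
From mathcomp Require Import complex.
From mathcomp Require Import ring lra zify.
Set Implicit Arguments.
Unset Strict Implicit.
Unset Printing Implicit Defensive.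
Import Order.TTheory GRing.Theory Num.Theory.
Import numFieldNormedType.Exports.
Local Open Scope classical_set_scope.
Local Open Scope ring_scope.

(** The covariance of u_L is eta^2 times the integral kernel of the operator
(I - kappa^-2 Delta)^-alpha on the box (0, L)^d, and the theorem follows from
the method of images.

Writing lambda^-alpha as Gamma(alpha)^-1 times the integral of
t^(alpha-1) e^(-lambda t) dt (gig_mass_powR), the spectral series becomes an
average over t > 0 of e^-t times the heat kernel of the box at time
t / kappa^2. This heat kernel is a product over the coordinates, and in each
coordinate it is a theta series. Jacobi's transformation (theta_cvg) rewrites it
as a sum of Gaussians centred at the images of y: its translates by multiples
of L in the periodic case, and, for Dirichlet and Neumann conditions, its
translates by multiples of 2L and those of its reflection, with signs. A product
of d Gaussians depends on the Euclidean distance to the image only, and its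
average over t is a Matern function of order alpha - d/2 = nu at that distance
(matern_gig_mass). Therefore C^L(x, y) is the sum over all images of y of
+-C(x, image), the image y itself contributing C(x, y): the error is the sum
over the proper images. The interchange of sums and integrals is done on finite
boxes of modes and images, whose difference tends to zero by dominated
convergence (spec_minus_image_cvg0), so that it is enough to bound the finite
image sums.

In each coordinate the images are numbered so that image p, for p > 0, is at
distance at least delta + ell * floor(p/2) from x. The Matern function
satisfies M_nu(a + b) <= M_nu(a) M_max(nu,1/2)(b) (matern_submul), so an image
with largest coordinate number k contributes at most
sigma^2 M_nu(kappa delta) f(ell)^floor(k/2). There are (k+1)^d - k^d of them,
and summing over k gives the constant A (shell_sum_le).

The submultiplicativity is a comparison of logarithmic derivatives, which
reduces to the monotonicity of the Bessel quotient K_(nu-1) / K_nu for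
nu >= 1/2; this in turn is a correlation inequality for the integral
representation of K_nu (bessel_ratio_le). Jacobi's transformation is obtained
by Polya's argument: the binomial expansion of (z + 1/z)^(2n), averaged over
the N-th roots of unity, is a finite transformation formula (discrete_theta),
and n about t N^2 with N tending to infinity gives the theta series. All
integrals over t are written in the variable u = log t. *)

(** * Dominated convergence for series *)
Lemma series_tail_le (R : realType) (u b : nat -> R) (N P : nat) :
  (forall k, `|u k| <= b k) -> cvgn (series b) -> (N <= P)%N ->
  `|series u P - series u N| <= limn (series b) - series b N.
Proof.
move=> ub cb NP.
have b0 k : 0 <= b k by apply: le_trans (ub k).
have -> : series u P - series u N = \sum_(N <= k < P) u k.
  by rewrite /series /= (big_cat_nat _ NP)//= addrAC subrr add0r.
apply: le_trans (ler_norm_sum _ _ _) _.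
apply: le_trans (_ : \sum_(N <= k < P) b k <= _); first exact: ler_sum.
have -> : \sum_(N <= k < P) b k = series b P - series b N.
  by rewrite /series /= [in RHS](big_cat_nat _ NP)//= addrAC subrr add0r.
rewrite lerD2r; apply: nondecreasing_cvgn_le => //.
by apply/nondecreasing_seqP => n; rewrite /series /= big_nat_recr//= lerDl.
Qed.

(** A dominated series differs from its partial sums by at most the tail of the
dominating series; this is the uniformity that drives Tannery's theorem. *)
Lemma series_lim_tail_le (R : realType) (u b : nat -> R) (N : nat) :
  (forall k, `|u k| <= b k) -> cvgn (series b) -> cvgn (series u) ->
  `|limn (series u) - series u N| <= limn (series b) - series b N.
Proof.
move=> ub cb cu.
have cd : (fun P => `|series u P - series u N|) @ \oo --> `|limn (series u) - series u N|.
  by apply: cvg_norm; apply: cvgB => //; exact: cvg_cst.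
rewrite -(cvg_lim _ cd)//; apply: limr_le; first exact: cvgP cd.
by near=> P; apply: series_tail_le => //; near: P; exact: nbhs_infty_ge.
Unshelve. all: end_near. Qed.

(** Tannery's theorem, dominated convergence for series, for sums whose number
of terms may grow with the parameter. Splitting at an index beyond which the
dominating series has a small tail leaves a finite sum, where termwise limits
suffice. *)
Lemma tannery (R : realType) (a : nat -> nat -> R) (l b : nat -> R)
  (m : nat -> nat) :
  (forall k, a ^~ k @ \oo --> l k) ->
  (\forall n \near \oo, forall k, `|a n k| <= b k) ->
  (forall n k, (m n <= k)%N -> a n k = 0) ->
  cvgn (series b) ->
  cvgn (series l) /\
  (fun n => \sum_(k < m n) a n k) @ \oo --> limn (series l).
Proof.
move=> al ab am cb.
have lb k : `|l k| <= b k.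
  have c : (fun n => `|a n k|) @ \oo --> `|l k| by apply: cvg_norm.
  rewrite -(cvg_lim _ c)//; apply: limr_le; first exact: cvgP c.
  by apply: filterS ab => n /(_ k).
have b0 k : 0 <= b k by apply: le_trans (lb k).
have cl : cvgn (series l).
  by apply: normed_cvg; apply: series_le_cvg lb cb.
split => //.
have bt : (fun N => limn (series b) - series b N) @ \oo --> 0.
  by rewrite -(subrr (limn (series b))); apply: cvgB => //; exact: cvg_cst.
apply/cvgrPdist_le => e e0.
have e4 : 0 < e / 3 by rewrite divr_gt0.
have /cvgrPdist_le/(_ _ e4)[N _ /(_ N (leqnn N)) /= bN] := bt.
have sN : (fun n => series (a n) N) @ \oo --> series l N.
  rewrite /series/=; elim: {bN}N => [|N IH].
    by rewrite big_geq//; under eq_cvg do rewrite big_geq//; exact: cvg_cst.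
  rewrite big_nat_recr//=; under eq_cvg do rewrite big_nat_recr//=.
  by apply: cvgD.
have /cvgrPdist_le/(_ _ e4) H := sN.
near=> n.
have abn : forall k, `|a n k| <= b k by near: n.
have : `|series l N - series (a n) N| <= e / 3 by near: n.
have -> : \sum_(k < m n) a n k = series (a n) (maxn (m n) N).
  rewrite /series/= (big_cat_nat _ (leq_maxl (m n) N))//=.
  rewrite [X in _ + X]big_nat_cond [X in _ + X]big1 ?addr0 ?big_mkord//.
  by move=> k /andP[/andP[mk _] _]; exact: am.
have := series_tail_le abn cb (leq_maxr (m n) N : (N <= _)%N).
have := series_lim_tail_le N lb cb cl.
have b0N : 0 <= limn (series b) - series b N.
  by apply: le_trans (series_lim_tail_le N lb cb cl).
move: bN; rewrite sub0r normrN (ger0_norm b0N) => bN H1 H2 H3.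
have : `|(limn (series l) - series l N) + (series l N - series (a n) N)
   - (series (a n) (maxn (m n) N) - series (a n) N)| <= e.
  apply: le_trans (ler_normB _ _) _; apply: le_trans (lerD (ler_normD _ _) (lexx _)) _.
  lra.
by apply: le_trans; rewrite le_eqVlt; apply/orP; left; apply/eqP; congr `|_|; ring.
Unshelve. all: end_near. Qed.

(** Comparison with the telescoping bound 2 - 1/(n+1). *)
Lemma cvg_series_invsqr (R : realType) :
  cvgn (series (fun k => (k.+1%:R ^- 2 : R))).
Proof.
apply: nondecreasing_is_cvgn.
  by apply/nondecreasing_seqP => n; rewrite /series/= big_nat_recr//= lerDl invr_ge0 exprn_ge0.
exists 2 => _ [n _ <-].
suff : series (fun k => (k.+1%:R ^- 2 : R)) n.+1 <= 2 - n.+1%:R^-1.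
  rewrite /series/= big_nat_recr//= => H.
  by apply: le_trans (le_trans _ H) _; rewrite ?lerDl ?gerBl invr_ge0// exprn_ge0.
elim: n => [|n IH].
  rewrite /series/= big_nat1. lra.
rewrite /series/= big_nat_recr//=; apply: le_trans (lerD IH (lexx _)) _.
have p : 0 < (n.+1%:R : R) by [].
rewrite -[n.+2%:R]natr1.
move: (n.+1%:R : R) p => x p.
rewrite -subr_ge0.
have -> : 2 - (x + 1)^-1 - (2 - x^-1 + (x + 1) ^- 2) = (x * (x+1)^+2)^-1.
  have x0 : x != 0 by rewrite gt_eqF.
  have x1 : x + 1 != 0 by rewrite gt_eqF// addr_gt0.
  by field; rewrite x0 x1.
by rewrite invr_ge0 mulr_ge0 ?exprn_ge0 ?addr_ge0 ?ltW.
Qed.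

(** Squeezed between exp(- m b / (1 - b)) and exp(- m b), both consequences of
1 + x <= exp x. *)
Lemma cvg_oneB_exp (R : realType) (b : nat -> R) (m : nat -> nat) (beta : R) :
  (\forall n \near \oo, 0 <= b n) -> b @ \oo --> 0 ->
  (fun n => (m n)%:R * b n) @ \oo --> beta ->
  (fun n => (1 - b n) ^+ (m n)) @ \oo --> expR (- beta).
Proof.
move=> b0 cb cmb.
have c1 : (fun n => expR (- ((m n)%:R * b n))) @ \oo --> expR (- beta).
  by apply: (cvg_comp _ expR); [exact: cvgN cmb|exact: continuous_expR].
have c2 : (fun n => expR (- ((m n)%:R * b n / (1 - b n)))) @ \oo --> expR (- beta).
  apply: (cvg_comp _ expR); last exact: continuous_expR.
  apply: cvgN; rewrite -[X in _ --> X]divr1.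
  apply: cvgM => //; apply: cvgV; first by rewrite oner_neq0.
  by rewrite -[X in _ --> X]subr0; apply: cvgB => //; exact: cvg_cst.
apply: squeeze_cvgr c2 c1.
have bh : \forall n \near \oo, b n < 1 by apply: (cvgr_lt 0).
near=> n.
have b0n : 0 <= b n by near: n.
have b1n : b n < 1 by near: n.
have p : 0 < 1 - b n by rewrite subr_gt0.
apply/andP; split.
  rewrite -mulrA -mulrN expRM_natl; apply: lerXn2r; rewrite ?nnegrE ?expR_ge0 ?(ltW p)//.
  rewrite expRN -[leRHS]invrK lef_pV2 ?posrE ?expR_gt0 ?invr_gt0//.
  apply: le_trans (expR_ge1Dx _); rewrite le_eqVlt; apply/orP; left; apply/eqP.
  by field; rewrite gt_eqF.
by rewrite -mulrN expRM_natl; apply: lerXn2r; rewrite ?nnegrE ?expR_ge0 ?(ltW p)// expR_ge1Dx.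
Unshelve. all: end_near. Qed.

(** * A finite form of Jacobi's transformation *)
(** Real part of the binomial expansion of (z + 1/z)^m at z = exp(i phi), turned
by a phase beta. It is proved by Pascal's rule, which avoids complex
exponentials. *)
Lemma sum_bin_cos (R : realType) (m : nat) (phi beta : R) :
  \sum_(r < m.+1) 'C(m, r)%:R * cos (beta + (m%:R - r%:R * 2) * phi)
  = (2 * cos phi) ^+ m * cos beta.
Proof.
elim: m beta => [|m IH] beta.
  by rewrite big_ord1 bin0 expr0 !mul1r !mul0r subr0 mul0r addr0.
rewrite big_ord_recl bin0 mul1r.
under eq_bigr => r _ do rewrite lift0 binS natrD mulrDl.
rewrite big_split/= addrA.
have -> : cos (beta + (m.+1%:R - 0 * 2) * phi) +
   \sum_(i < m.+1) 'C(m, i.+1)%:R * cos (beta + (m.+1%:R - i.+1%:R * 2) * phi) =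
   \sum_(r < m.+1) 'C(m, r)%:R * cos ((beta + phi) + (m%:R - r%:R * 2) * phi).
  rewrite [in LHS]big_ord_recr/= bin_small// [X in _ + (_ + X)]mul0r addr0 [RHS]big_ord_recl bin0 mul1r.
  congr (cos _ + _); first by rewrite /= -natr1; ring.
  apply: eq_bigr => i _; rewrite lift0; congr (_ * cos _).
  by rewrite -!natr1; ring.
have -> : \sum_(i < m.+1) 'C(m, i)%:R * cos (beta + (m.+1%:R - i.+1%:R * 2) * phi) =
   \sum_(r < m.+1) 'C(m, r)%:R * cos ((beta - phi) + (m%:R - r%:R * 2) * phi).
  apply: eq_bigr => i _; congr (_ * cos _).
  by rewrite -!natr1; ring.
by rewrite !IH exprS -mulrDr cosD cosB; ring.
Qed.

(** The Dirichlet kernel, multiplied by sin x to cover its singularities. *)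
Lemma dirichlet_kernel (R : realType) (M : nat) (x : R) :
  sin x * (1 + 2 * \sum_(k < M) cos (k.+1%:R * (2 * x))) = sin ((M.*2.+1)%:R * x).
Proof.
elim: M => [|M IH]; first by rewrite big_ord0 mulr0 addr0 mulr1 mul1r.
have -> : sin x * (1 + 2 * \sum_(k < M.+1) cos (k.+1%:R * (2 * x))) =
    sin ((M.*2.+1)%:R * x) + 2 * sin x * cos (M.+1%:R * (2 * x)).
  by rewrite -IH big_ord_recr/=; ring.
have -> : sin ((M.*2.+1)%:R * x) = sin (M.+1%:R * (2 * x) - x).
  by congr sin; rewrite -muln2 -!natr1 natrM; ring.
have -> : sin ((M.+1.*2.+1)%:R * x) = sin (M.+1%:R * (2 * x) + x).
  by congr sin; rewrite -muln2 -[in LHS]natr1 natrM; ring.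
by rewrite sinB sinD; ring.
Qed.

Lemma cosD2pin (R : realType) (x : R) (n : nat) : cos (x + n%:R * (2 * pi)) = cos x.
Proof.
elim: n => [|n IH]; first by rewrite mul0r addr0.
have -> : x + n.+1%:R * (2 * pi) = (x + n%:R * (2 * pi)) + pi *+ 2.
  by rewrite -natr1; ring.
by rewrite cosD cos2pi sin2pi IH mulr1 mulr0 subr0.
Qed.

Lemma sin_npi (R : realType) (n : nat) : sin (n%:R * pi : R) = 0.
Proof.
elim: n => [|n IH]; first by rewrite mul0r sin0.
by rewrite -natr1 mulrDl mul1r sinD IH sinpi mul0r mulr0 addr0.
Qed.

(** Orthogonality of the N-th roots of unity for odd N = 2M+1: the exponents
-M, ..., M run over all residues modulo N, and the Dirichlet kernel vanishes
at the nontrivial roots. *)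
Lemma sum_cos_roots (R : realType) (M h : nat) (N := M.*2.+1) :
  1 + 2 * \sum_(k < M) cos (k.+1%:R * (2 * (pi * h%:R / N%:R))) =
  (if (N %| h)%N then N%:R else 0 : R).
Proof.
have N0 : (N%:R : R) != 0 by rewrite pnatr_eq0.
have -> : \sum_(k < M) cos (k.+1%:R * (2 * (pi * h%:R / N%:R))) =
   \sum_(k < M) cos (k.+1%:R * (2 * (pi * (h %% N)%:R / N%:R)) : R).
  apply: eq_bigr => k _.
  rewrite -[in RHS](cosD2pin (k.+1%:R * (2 * (pi * (h %% N)%:R / N%:R))) (k.+1 * (h %/ N))%N).
  congr cos; rewrite {1}(divn_eq h N) natrD !natrM.
  by field.
have := ltn_pmod h (ltn0Sn M.*2 : (0 < N)%N).
rewrite /dvdn; case: (h %% N)%N => [|r] rN.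
  rewrite eqxx; under eq_bigr do rewrite mulr0 mul0r mulr0 mulr0 cos0.
  rewrite sumr_const card_ord.
  have -> : N%:R = 1 + 2 * M%:R :> R by rewrite /N -muln2 -[((M * 2).+1)%:R]natr1 natrM; ring.
  by [].
have s0 : 0 < sin (pi * r.+1%:R / N%:R : R).
  apply: sin_gt0_pi; rewrite divr_gt0 ?mulr_gt0 ?pi_gt0//=.
  by rewrite ltr_pdivrMr// ltr_pM2l ?pi_gt0// ltr_nat.
apply: (mulfI (lt0r_neq0 s0)); rewrite dirichlet_kernel mulr0 -/N.
by rewrite mulrCA mulfV// mulr1 mulrC sin_npi.
Qed.

(** Probability that a simple random walk is at 2m after 2n steps. These are the
Gaussian weights of the theta series before the passage to the limit. *)
Definition central_weight (R : realType) (n m : nat) : R := 'C(n.*2, n + m)%:R / 4 ^+ n.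

Lemma central_weight_small (R : realType) n m : (n < m)%N -> central_weight R n m = 0.
Proof. by move=> nm; rewrite /central_weight bin_small ?mul0r// -addnn ltn_add2l. Qed.

Lemma sum_nat_pick (R : realType) (n x : nat) (F : nat -> R) :
  \sum_(i < n) (if i == x :> nat then F i else 0) = if (x < n)%N then F x else 0.
Proof.
case: ltnP => xn.
  rewrite (bigD1 (Ordinal xn))//= eqxx big1 ?addr0// => i /negbTE ix.
  by rewrite -[X in X == x](_ : val i = _)// -[x]/(val (Ordinal xn)) (inj_eq val_inj) ix.
by rewrite big1// => i _; rewrite ltn_eqF// (leq_trans _ xn).
Qed.

Lemma dvdn_pick (R : realType) (N h J : nat) : (0 < N)%N -> (h < J.+1 * N)%N ->
  (if (N %| h)%N then 1 else 0 : R) =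
  (if h == 0%N then 1 else 0) + \sum_(j < J) (if h == (j.+1 * N)%N then 1 else 0).
Proof.
move=> N0 hJ; case: ifPn => [/dvdnP[q hq]|Nh].
  rewrite hq; have qJ : (q < J.+1)%N by move: hJ; rewrite hq ltn_pmul2r.
  rewrite muln_eq0 (gtn_eqF N0) orbF.
  under eq_bigr => j _ do rewrite eqn_pmul2r//.
  case: q {hq} qJ => [|q] qJ.
    by rewrite eqxx big1 ?addr0// => j _.
  under eq_bigr => j _ do rewrite eqSS eq_sym.
  by rewrite (sum_nat_pick _ _ (fun=> 1)) -ltnS qJ add0r.
rewrite big1 ?addr0; first by case: eqP => // h0; rewrite h0 dvdn0 in Nh.
by move=> j _; case: eqP => // hj; rewrite hj dvdn_mull in Nh.
Qed.

(** The class of n + a modulo N consists of n + a, of n + a + (j+1) N and of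
n - ((j+1) N - a); only these meet the binomial range 0 <= r <= 2n. The
argument of the divisibility test is the distance of r and n + a. *)
Lemma residue_class_pick (R : realType) (N n a r J : nat) :
  (0 < N)%N -> (a <= N)%N -> (r <= n.*2)%N -> (n < J)%N ->
  (if (N %| (n + a - r) + (r - (n + a)))%N then 1 else 0 : R) =
  (if r == (n + a)%N then 1 else 0) +
  \sum_(j < J) ((if r == (n + (a + j.+1 * N))%N then 1 else 0)
                + (if (r + (j.+1 * N - a))%N == n then 1 else 0)).
Proof.
move=> N0 aN r2 nJ.
have aj (j : nat) : (a <= j.+1 * N)%N by apply: leq_trans aN _; rewrite leq_pmull.
have JN : (J <= J * N)%N by rewrite leq_pmulr.
case: (leqP (n + a) r) => nar.
  have [h rh] : exists h, r = (n + a + h)%N by exists (r - (n + a))%N; lia.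
  have -> : (n + a - r + (r - (n + a)) = h)%N by lia.
  rewrite (@dvdn_pick R N h J)//; last by rewrite mulSn; lia.
  have -> : (r == n + a)%N = (h == 0)%N by apply/eqP/eqP; lia.
  congr +%R; apply: eq_bigr => j _.
  have := aj j; have : (0 < j.+1 * N)%N by rewrite muln_gt0.
  move: (j.+1 * N)%N => jN jN0 ajN.
  have -> : (r == n + (a + jN))%N = (h == jN) by apply/eqP/eqP; lia.
  have -> : (r + (jN - a) == n)%N = false by apply/eqP; lia.
  by rewrite addr0.
have [h rh] : exists h, (r + h = n + a)%N by exists ((n + a) - r)%N; lia.
have -> : (n + a - r + (r - (n + a)) = h)%N by lia.
rewrite (@dvdn_pick R N h J)//; last by rewrite mulSn; lia.
have -> : (h == 0)%N = false by apply/eqP; lia.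
have -> : (r == n + a)%N = false by apply/eqP; lia.
congr +%R; apply: eq_bigr => j _.
have := aj j; move: (j.+1 * N)%N => jN ajN.
have -> : (r == n + (a + jN))%N = false by apply/eqP; lia.
have -> : (r + (jN - a) == n)%N = (h == jN)%N by apply/eqP/eqP; lia.
by rewrite add0r.
Qed.

Lemma sum_bin_pickr (R : realType) (n m : nat) :
  \sum_(r < n.*2.+1) 'C(n.*2, r)%:R * (if (r == n + m :> nat)%N then 1 else 0 : R) =
  'C(n.*2, n + m)%:R.
Proof.
under eq_bigr => r _ do rewrite (fun_if (fun x => 'C(n.*2, r)%:R * x)) mulr0 mulr1.
rewrite (sum_nat_pick _ _ (fun r => 'C(n.*2, r)%:R)).
by case: ltnP => // nm; rewrite bin_small.
Qed.

Lemma sum_bin_pickl (R : realType) (n m : nat) :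
  \sum_(r < n.*2.+1) 'C(n.*2, r)%:R * (if (r + m == n)%N then 1 else 0 : R) =
  'C(n.*2, n + m)%:R.
Proof.
case: (leqP m n) => mn; last first.
  rewrite bin_small -?addnn ?ltn_add2l// big1// => r _.
  by rewrite (_ : (r + m == n)%N = false) ?mulr0//; apply/eqP; lia.
under eq_bigr => r _.
  rewrite (fun_if (fun x => 'C(n.*2, r)%:R * x)) mulr0 mulr1.
  rewrite (_ : (r + m == n)%N = (r == n - m :> nat)%N); last by apply/eqP/eqP; lia.
  over.
rewrite (sum_nat_pick _ _ (fun r => 'C(n.*2, r)%:R)) ifT; last by lia.
by rewrite -bin_sub; [congr (_%:R); congr 'C(_, _); lia | lia].
Qed.

(** Polya's finite form of the theta transformation. Expanding cos^(2n)
binomially and summing over the N-th roots of unity keeps the indices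
congruent to n + a modulo N, so a sum over frequencies becomes a sum over
translates of a by multiples of N. *)
Lemma discrete_theta (R : realType) (M n a J : nat) (N := M.*2.+1) :
  (a <= N)%N -> (n < J)%N ->
  1 + 2 * \sum_(k < M) cos (pi * k.+1%:R / N%:R) ^+ n.*2
                        * cos (2 * pi * k.+1%:R * a%:R / N%:R) =
  N%:R * (central_weight R n a + \sum_(j < J) (central_weight R n (a + j.+1 * N) + central_weight R n (j.+1 * N - a))).
Proof.
move=> aN nJ.
have N0 : (N%:R : R) != 0 by rewrite pnatr_eq0.
have h4 : (2 : R) ^+ n.*2 = 4 ^+ n by rewrite -mul2n exprM; congr (_ ^+ n); ring.
pose c (h : R) : R := 1 + 2 * \sum_(k < M) cos (k.+1%:R * (2 * (pi * h / N%:R))).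
transitivity (4 ^- n * \sum_(r < n.*2.+1) 'C(n.*2, r)%:R * c (a%:R + n%:R - r%:R)).
  rewrite /c; under [in RHS]eq_bigr => r _ do rewrite mulrDr mulr1 mulrCA mulr_sumr.
  rewrite big_split/=.
  rewrite [RHS]mulrDr; congr +%R.
    have -> : \sum_(i < n.*2.+1) 'C(n.*2, i)%:R = (2 * cos 0) ^+ n.*2 * cos 0 :> R.
      rewrite -sum_bin_cos; apply: eq_bigr => r _.
      by rewrite mulr0 add0r cos0 mulr1.
    by rewrite !cos0 !mulr1 h4 mulVf// expf_neq0.
  rewrite -mulr_sumr exchange_big/= [RHS]mulrCA; congr *%R.
  rewrite mulr_sumr; apply: eq_bigr => k _.
  have -> : \sum_(i < n.*2.+1) 'C(n.*2, i)%:R *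
      cos (k.+1%:R * (2 * (pi * (a%:R + n%:R - i%:R) / N%:R))) =
      (2 * cos (pi * k.+1%:R / N%:R)) ^+ n.*2 * cos (2 * pi * k.+1%:R * a%:R / N%:R) :> R.
    rewrite -sum_bin_cos; apply: eq_bigr => r _; congr (_ * cos _).
    have -> : (n.*2)%:R = n%:R * 2 :> R by rewrite -natrM muln2.
    by field.
  rewrite exprMn h4 mulrA mulrA.
  by rewrite mulVf ?mul1r// expf_neq0.
have cE (r : nat) : c (a%:R + n%:R - r%:R) =
    N%:R * (if (N %| (n + a - r) + (r - (n + a)))%N then 1 else 0).
  rewrite (fun_if (fun x => N%:R * x)) mulr1 mulr0 -sum_cos_roots /c.
  congr (1 + 2 * _); apply: eq_bigr => k _.
  case: (leqP (n + a) r) => nar.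
    rewrite -cosN; congr cos.
    rewrite (eqP (_ : (n + a - r == 0)%N)) ?subn_eq0// add0n natrB// natrD. ring.
  congr cos.
  rewrite (eqP (_ : (r - (n + a) == 0)%N)) ?subn_eq0 ?(ltnW nar)// addn0 natrB ?(ltnW nar)// natrD. ring.
under eq_bigr => r _.
  rewrite cE (@residue_class_pick R N n a r J)//; last by rewrite -ltnS.
  rewrite mulrCA mulrDr mulr_sumr.
  under eq_bigr => j _ do rewrite mulrDr.
  over.
rewrite -mulr_sumr mulrCA; congr *%R.
rewrite big_split/= sum_bin_pickr exchange_big/=.
rewrite /central_weight mulrDr [in RHS]mulrC mulr_sumr; congr +%R.
apply: eq_bigr => j _.
by rewrite big_split/= sum_bin_pickr sum_bin_pickl mulrC mulrDl.
Qed.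

(** * Asymptotics of the central binomial weights *)
(** The ratio of consecutive central binomial probabilities, as in Wallis' product. *)
Lemma central_weight0_rec (R : realType) n :
  central_weight R n.+1 0 = central_weight R n 0 * ((n.*2.+1)%:R / (n.*2.+2)%:R).
Proof.
have H : ('C(n.+1.*2, n.+1) * (n.+1 * n.+1) = n.*2.+2 * n.*2.+1 * 'C(n.*2, n))%N.
  have e1 := mul_bin_diag n.*2.+2 n.
  have e2 := mul_bin_diag n.*2.+1 n.
  have e3 : 'C(n.*2.+1, n) = 'C(n.*2.+1, n.+1).
    by rewrite -bin_sub; [congr 'C(_, _); lia | lia].
  rewrite doubleS mulnA [('C(_, _) * _)%N]mulnC -e1 /= e3 -mulnA [('C(_, _) * _)%N]mulnC -e2 /=.
  by rewrite mulnA.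
rewrite /central_weight !addn0 exprS.
have /(congr1 (fun x => x%:R : R)) := H; rewrite !natrM => H'.
have n1 : (n.+1%:R : R) != 0 by rewrite pnatr_eq0.
have -> : 'C(n.+1.*2, n.+1)%:R = (n.*2.+2)%:R * (n.*2.+1)%:R * 'C(n.*2, n)%:R / n.+1%:R ^+2 :> R.
  by rewrite -H' expr2 mulfK// mulf_neq0.
have -> : (n.*2.+2)%:R = 2 * n.+1%:R :> R by rewrite -natrM; congr (_%:R); lia.
by field; rewrite nat1r n1 expf_neq0.
Qed.

Lemma central_weight_ge0 (R : realType) n m : 0 <= central_weight R n m.
Proof. by rewrite /central_weight divr_ge0// exprn_ge0. Qed.

Lemma central_weight0_gt0 (R : realType) n : 0 < central_weight R n 0.
Proof. by rewrite /central_weight divr_gt0 ?exprn_gt0// ltr0n bin_gt0; lia. Qed.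

(** The sequence n w^2, with w the central weight, increases, while
(2n+1) w^2 <= 1. The value of the limit is not computed here: it is forced by
the theta transformation itself, in theta_normalized. *)
Lemma wallis_cvg (R : realType) :
  exists2 c : R, 0 < c & (fun n => n%:R * central_weight R n 0 ^+ 2) @ \oo --> c.
Proof.
pose v n : R := n%:R * central_weight R n 0 ^+ 2.
have vS : nondecreasing_seq v.
  apply/nondecreasing_seqP => n; rewrite /v central_weight0_rec.
  have q0 := sqr_ge0 (central_weight R n 0).
  rewrite (_ : n.+1%:R * _ = central_weight R n 0 ^+ 2 * (n.+1%:R * ((n.*2.+1)%:R / (n.*2.+2)%:R) ^+ 2)); last by ring.
  rewrite mulrC; apply: ler_wpM2l => // {q0}.
  have -> : (n.*2.+1)%:R = 2 * n%:R + 1 :> R by rewrite -muln2 -natr1 natrM mulrC.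
  have -> : (n.*2.+2)%:R = 2 * n%:R + 2 :> R by rewrite -muln2 -!natr1 natrM; ring.
  rewrite -natr1; have : 0 <= (n%:R : R) by [].
  move: (n%:R : R) => x x0.
  rewrite expr_div_n mulrA ler_pdivlMr; last by rewrite exprn_gt0//; lra.
  nra.
have vb n : (2 * n%:R + 1) * central_weight R n 0 ^+ 2 <= 1.
  elim: n => [|n IH]; first by rewrite /central_weight bin0 expr0 divr1; lra.
  rewrite central_weight0_rec.
  have := sqr_ge0 (central_weight R n 0).
  rewrite [(central_weight R n 0 * _) ^+ 2]exprMn; move: (central_weight R n 0 ^+ 2) IH => q IH q0.
  move: IH; have -> : (n.*2.+1)%:R = 2 * n%:R + 1 :> R by rewrite -muln2 -natr1 natrM mulrC.
  have -> : (n.*2.+2)%:R = 2 * n%:R + 2 :> R by rewrite -muln2 -!natr1 natrM; ring.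
  rewrite -[n.+1%:R]natr1; have : 0 <= (n%:R : R) by [].
  move: (n%:R : R) => x x0 IH.
  rewrite expr_div_n !mulrA ler_pdivrMr; last by rewrite exprn_gt0//; lra.
  apply: le_trans (_ : ((2 * x + 1) * q) * ((2 * x + 3) * (2 * x + 1)) <= _).
    by rewrite le_eqVlt; apply/orP; left; apply/eqP; ring.
  apply: le_trans (_ : 1 * ((2 * x + 3) * (2 * x + 1)) <= _); last by nra.
  by apply: ler_wpM2r => //; nra.
have cv : cvgn v.
  apply: nondecreasing_is_cvgn => //; exists 1 => _ [n _ <-].
  apply: le_trans (vb n); rewrite /v; apply: ler_wpM2r; first exact: sqr_ge0.
  by have : 0 <= (n%:R : R) by []; lra.
exists (limn v) => //.
apply: lt_le_trans (nondecreasing_cvgn_le vS cv 1%N).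
by rewrite /v mul1r exprn_gt0// central_weight0_gt0.
Qed.

Lemma bernoulli_le (R : realType) (x : R) m : 0 <= x -> 1 + m%:R * x <= (1 + x) ^+ m.
Proof.
move=> x0; elim: m => [|m IH]; first by rewrite mul0r addr0 expr0.
rewrite exprS -natr1.
apply: le_trans (_ : (1 + x) * (1 + m%:R * x) <= _).
  have : 0 <= x * (m%:R * x) by rewrite !mulr_ge0.
  nra.
by rewrite ler_wpM2l// addr_ge0.
Qed.

Lemma central_weight_prod (R : realType) n m : (m <= n)%N ->
  central_weight R n m = central_weight R n 0 * \prod_(i < m) ((n - i)%:R / (n + m - i)%:R).
Proof.
move=> mn.
have H : ('C(n.*2, n + m) * (n + m) ^_ m = 'C(n.*2, n) * n ^_ m)%N.
  have l1 : (n.*2 - (n + m) = n - m)%N by lia.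
  have l2 : (n.*2 - n = n)%N by lia.
  have l3 : (n + m <= n.*2)%N by lia.
  have l4 : (n <= n.*2)%N by lia.
  have f0 : (0 < n`! * (n - m)`!)%N by rewrite muln_gt0 !fact_gt0.
  apply/eqP; rewrite -(eqn_pmul2r f0); apply/eqP.
  transitivity (n.*2)`!.
    rewrite -(bin_fact l3) l1 -(@ffact_fact (n + m) m) ?addnK ?leq_addl//.
    by rewrite -!mulnA; congr muln; rewrite [LHS]mulnC -!mulnA; congr muln; rewrite mulnC.
  rewrite -(bin_fact l4) l2 -!mulnA; congr muln.
  by rewrite mulnCA ffact_fact.
have /(congr1 (fun x => x%:R : R)) := H; rewrite !natrM => H'.
have ff0 : ((n + m) ^_ m)%:R != 0 :> R by rewrite pnatr_eq0 -lt0n ffact_gt0 leq_addl.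
rewrite /central_weight addn0 prodf_div -!natr_prod -!ffact_prod.
have -> : 'C(n.*2, n + m)%:R = 'C(n.*2, n)%:R * (n ^_ m)%:R / ((n + m) ^_ m)%:R :> R.
  by rewrite -H' mulfK.
by field; rewrite ff0 expf_neq0.
Qed.

(** Each factor (n-i)/(n+m-i) of the ratio to the central weight is at most n/(n+m). *)
Lemma central_weight_le (R : realType) n m : (m <= n)%N -> (0 < n)%N ->
  central_weight R n m <= central_weight R n 0 * (1 - m%:R / (n + m)%:R) ^+ m.
Proof.
move=> mn n0; rewrite central_weight_prod// ler_pM2l ?central_weight0_gt0//.
rewrite -[X in _ ^+ X]card_ord -prodr_const; apply: ler_prod => i _.
have im := ltn_ord i.
have p1 : 0 < ((n + m - i)%:R : R) by rewrite ltr0n; lia.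
have p2 : 0 < ((n + m)%:R : R) by rewrite ltr0n; lia.
rewrite divr_ge0//=.
have -> : 1 - m%:R / (n + m)%:R = n%:R / (n + m)%:R :> R.
  by rewrite natrD; field; rewrite -natrD gt_eqF.
rewrite ler_pdivrMr// mulrAC ler_pdivlMr// -!natrM ler_nat; nia.
Qed.

(** Each factor (n-i)/(n+m-i) of the ratio to the central weight is at least (n-m)/n. *)
Lemma central_weight_ge (R : realType) n m : (m <= n)%N -> (0 < n)%N ->
  central_weight R n 0 * (1 - m%:R / n%:R) ^+ m <= central_weight R n m.
Proof.
move=> mn n0; rewrite [leRHS]central_weight_prod// ler_pM2l ?central_weight0_gt0//.
rewrite -[X in _ ^+ X]card_ord -prodr_const; apply: ler_prod => i _.
have im := ltn_ord i.
have p1 : 0 < ((n + m - i)%:R : R) by rewrite ltr0n; lia.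
have p2 : 0 < (n%:R : R) by rewrite ltr0n; lia.
have -> : 1 - m%:R / n%:R = (n - m)%:R / n%:R :> R.
  by rewrite natrB//; field; rewrite gt_eqF.
rewrite divr_ge0//= ler_pdivrMr// mulrAC ler_pdivlMr// -!natrM ler_nat; nia.
Qed.

(** Bernoulli's inequality turns the exponential bound into an inverse square,
which is all that the domination of the image series requires. *)
Lemma central_weight_le_inv (R : realType) n m : (0 < n)%N ->
  central_weight R n m <= central_weight R n 0 / (1 + m%:R ^+ 2 / n%:R).
Proof.
move=> n0; have nR : 0 < (n%:R : R) by rewrite ltr0n.
case: (leqP m n) => mn; last first.
  by rewrite central_weight_small// divr_ge0 ?central_weight_ge0// addr_ge0// divr_ge0// sqr_ge0.
apply: le_trans (central_weight_le _ mn n0) _; rewrite ler_pM2l ?central_weight0_gt0//.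
have nm : 0 < ((n + m)%:R : R) by rewrite ltr0n; lia.
have -> : 1 - m%:R / (n + m)%:R = (1 + m%:R / n%:R)^-1 :> R.
  rewrite natrD; field; rewrite !gt_eqF// -natrD//.
rewrite exprVn lef_pV2 ?posrE.
- apply: le_trans (bernoulli_le m _); last by rewrite divr_ge0.
  by rewrite expr2 mulrA.
- by rewrite exprn_gt0// ltr_pwDl// divr_ge0.
- by rewrite ltr_pwDl// divr_ge0// sqr_ge0.
Qed.

Lemma sin_bounds (R : realType) (x : R) : 0 < x -> x <= pi / 2 ->
  x * cos x <= sin x <= x.
Proof.
move=> x0 xp.
have dsin : forall y : R, y \in `]0, x[ -> is_derive y 1 sin (cos y).
  by move=> y _; exact: is_derive_sin.
have csin : {within `[0, x], continuous (@sin R)}.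
  by apply: continuous_subspaceT => y; exact: continuous_sin.
have [c] := MVT x0 dsin csin.
rewrite in_itv/= => /andP[c0 cx] H.
move: H; rewrite sin0 !subr0 => ->.
have pi0 := pi_gt0 R.
apply/andP; split; last by rewrite ler_piMl ?cos_le1// ltW.
rewrite mulrC ler_wpM2r ?(ltW x0)//.
rewrite leNgt ltr_cos ?in_itv/= -?leNgt; [exact: ltW| |]; lra.
Qed.

(** Equivalent to x <= tan x; it dominates the powers of cosines by inverse squares. *)
Lemma cos_sqr_le (R : realType) (x : R) : 0 < x -> x <= pi / 2 ->
  cos x ^+ 2 <= (1 + x ^+ 2)^-1.
Proof.
move=> x0 xp; have /andP[h _] := sin_bounds x0 xp.
have c0 : 0 <= cos x by rewrite cos_ge0_pihalf// xp andbT; have := pi_gt0 R; lra.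
rewrite -[leRHS]mul1r ler_pdivlMr; last by rewrite ltr_pwDl// sqr_ge0.
rewrite -[leRHS](cos2Dsin2 x) mulrDr mulr1 lerD2l -exprMn mulrC.
by rewrite lerXn2r// nnegrE ?mulr_ge0 ?(ltW x0)//; apply: le_trans h; rewrite mulr_ge0// ltW.
Qed.

Section scaling_limits.
Variables (R : realType) (N n : nat -> nat) (t : R).
Hypotheses (t0 : 0 < t) (N0 : forall M, (0 < N M)%N)
  (cN : (fun M => (N M)%:R^-1 : R) @ \oo --> 0)
  (cn : (fun M => (n M)%:R / (N M)%:R ^+ 2 : R) @ \oo --> t)
  (ny : n @ \oo --> \oo).

Lemma near_n_gt0 : \forall M \near \oo, (0 < n M)%N.
Proof. by move/cvgnyPgt/(_ 0%N): ny. Qed.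

Lemma cvg_sin_scaled (y : R) : 0 < y ->
  (fun M => (N M)%:R * sin (y / (N M)%:R)) @ \oo --> y.
Proof.
move=> y0.
have cy : (fun M => y / (N M)%:R) @ \oo --> 0.
  by rewrite -(mulr0 y); apply: cvgM => //; exact: cvg_cst.
have c1 : (fun M => y * cos (y / (N M)%:R)) @ \oo --> y.
  rewrite -[X in _ --> X]mulr1; apply: cvgM; first exact: cvg_cst.
  rewrite -[X in _ --> X](cos0 R).
  by apply: (cvg_comp (fun M => y / (N M)%:R) cos cy); exact: continuous_cos.
apply: squeeze_cvgr c1 (cvg_cst y).
have : \forall M \near \oo, y / (N M)%:R < pi / 2.
  by apply: (cvgr_lt 0) => //; rewrite divr_gt0// pi_gt0.
apply: filterS => M yM.
have NM : 0 < ((N M)%:R : R) by rewrite ltr0n.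
have /andP[h1 h2] := sin_bounds (divr_gt0 y0 NM) (ltW yM).
apply/andP; split; last by rewrite mulrC -ler_pdivlMr.
by rewrite -ler_pdivrMl// mulrA [_^-1 * y]mulrC.
Qed.

(** cos^(2n) = (1 - sin^2)^n with n sin^2(y/N) tending to t y^2. *)
Lemma cvg_cos_power (y : R) : 0 < y ->
  (fun M => cos (y / (N M)%:R) ^+ (n M).*2) @ \oo --> expR (- (t * y ^+ 2)).
Proof.
move=> y0.
have -> : (fun M => cos (y / (N M)%:R) ^+ (n M).*2) =
          (fun M => (1 - sin (y / (N M)%:R) ^+ 2) ^+ n M).
  by apply/funext => M; rewrite -cos2sin2 -exprM mul2n.
apply: cvg_oneB_exp.
- by near=> M; exact: sqr_ge0.
- have s2 : (fun M => sin (y / (N M)%:R)) @ \oo --> sin 0.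
    apply: (cvg_comp (fun M => y / (N M)%:R) sin); last exact: continuous_sin.
    by rewrite -(mulr0 y); apply: cvgM => //; exact: cvg_cst.
  have -> : (0 : R) = sin 0 ^+ 2 by rewrite sin0 expr0n.
  apply: (cvg_comp (fun M => sin (y / (N M)%:R)) (fun x => x ^+ 2) s2).
  exact: exprn_continuous.
- have -> : (fun M => (n M)%:R * sin (y / (N M)%:R) ^+ 2) =
   (fun M => ((n M)%:R / (N M)%:R ^+ 2) * ((N M)%:R * sin (y / (N M)%:R)) ^+ 2).
    apply/funext => M; field.
    by rewrite pnatr_eq0 -lt0n.
  apply: cvgM => //; apply: (cvg_comp _ (fun x => x ^+ 2)); last exact: exprn_continuous.
  exact: cvg_sin_scaled.
Unshelve. all: end_near. Qed.

Lemma cos_power_le (y : R) M : 0 < y -> y / (N M)%:R <= pi / 2 ->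
  t / 2 <= (n M)%:R / (N M)%:R ^+ 2 ->
  cos (y / (N M)%:R) ^+ (n M).*2 <= (t / 2 * y ^+ 2)^-1.
Proof.
move=> y0 yp tn.
have NM : 0 < ((N M)%:R : R) by rewrite ltr0n.
have xN := divr_gt0 y0 NM.
have h := cos_sqr_le xN yp.
rewrite -mul2n exprM.
apply: le_trans (lerXn2r (n M) _ _ h) _; rewrite ?nnegrE ?sqr_ge0 ?invr_ge0 ?addr_ge0 ?sqr_ge0//.
have p2 : 0 < t / 2 * y ^+ 2 by rewrite mulr_gt0 ?exprn_gt0// divr_gt0.
rewrite exprVn lef_pV2 ?posrE//; last by rewrite exprn_gt0// ltr_pwDl// sqr_ge0.
apply: le_trans (bernoulli_le _ (sqr_ge0 _)).
apply: le_trans (_ : (n M)%:R * (y / (N M)%:R) ^+ 2 <= _); last by rewrite lerDr.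
have -> : (n M)%:R * (y / (N M)%:R) ^+ 2 = (n M)%:R / (N M)%:R ^+ 2 * y ^+ 2.
  by field; rewrite gt_eqF.
by rewrite ler_wpM2r// sqr_ge0.
Qed.

Variable c : R.
Hypotheses (c0 : 0 < c) (qc : (fun n => n%:R * central_weight R n 0 ^+ 2) @ \oo --> c).

Lemma cvg_central_weight0_scaled : (fun M => (N M)%:R * central_weight R (n M) 0) @ \oo --> Num.sqrt (c / t).
Proof.
have cv : (fun M => ((n M)%:R * central_weight R (n M) 0 ^+ 2) / ((n M)%:R / (N M)%:R ^+ 2)) @ \oo --> c / t.
  apply: cvgM; first exact: (cvg_comp n (fun k => k%:R * central_weight R k 0 ^+ 2) ny qc).
  by apply: cvgV => //; rewrite gt_eqF.
have : (fun M => Num.sqrt (((n M)%:R * central_weight R (n M) 0 ^+ 2) / ((n M)%:R / (N M)%:R ^+ 2)))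
   @ \oo --> Num.sqrt (c / t).
  by apply: (cvg_comp _ Num.sqrt cv); exact: sqrt_continuous.
apply: cvg_trans; apply: near_eq_cvg.
near=> M.
have n0 : (0 < n M)%N by near: M; exact: near_n_gt0.
have -> : (n M)%:R * central_weight R (n M) 0 ^+ 2 / ((n M)%:R / (N M)%:R ^+ 2) = ((N M)%:R * central_weight R (n M) 0) ^+ 2.
  by field; rewrite !pnatr_eq0 -!lt0n n0 N0.
by rewrite sqrtr_sqr ger0_norm// mulr_ge0 ?central_weight_ge0.
Unshelve. all: end_near. Qed.

(** Local limit theorem: with m/N tending to z and n/N^2 tending to t, the bounds
central_weight_ge and central_weight_le squeeze the weight onto a Gaussian,
up to the Wallis constant c. *)
Lemma cvg_central_weight_scaled (m : nat -> nat) (z : R) :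
  (fun M => (m M)%:R / (N M)%:R : R) @ \oo --> z ->
  (fun M => (N M)%:R * central_weight R (n M) (m M)) @ \oo --> Num.sqrt (c / t) * expR (- (z ^+ 2 / t)).
Proof.
move=> cm.
have cmn : (fun M => (m M)%:R / (n M)%:R : R) @ \oo --> 0.
  have : (fun M => ((m M)%:R / (N M)%:R) / ((n M)%:R / (N M)%:R ^+ 2) * (N M)%:R^-1 : R) @ \oo --> z / t * 0.
    by apply: cvgM => //; apply: cvgM => //; apply: cvgV => //; rewrite gt_eqF.
  rewrite mulr0; apply: cvg_trans; apply: near_eq_cvg.
  near=> M; have n0 : (0 < n M)%N by near: M; exact: near_n_gt0.
  by field; rewrite !pnatr_eq0 -!lt0n n0 N0.
have cm2 : (fun M => (m M)%:R * ((m M)%:R / (n M)%:R) : R) @ \oo --> z ^+ 2 / t.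
  have : (fun M => ((m M)%:R / (N M)%:R) ^+ 2 / ((n M)%:R / (N M)%:R ^+ 2) : R) @ \oo --> z ^+ 2 / t.
    apply: cvgM; last by apply: cvgV => //; rewrite gt_eqF.
    by apply: (cvg_comp _ (fun x => x ^+ 2)) cm _; exact: exprn_continuous.
  apply: cvg_trans; apply: near_eq_cvg.
  near=> M; have n0 : (0 < n M)%N by near: M; exact: near_n_gt0.
  by field; rewrite !pnatr_eq0 -!lt0n n0 N0.
have nm : \forall M \near \oo, (m M <= n M)%N.
  have : \forall M \near \oo, (m M)%:R / (n M)%:R < 1 :> R by apply: (cvgr_lt 0).
  apply: filterS2 near_n_gt0 => M n0.
  by rewrite ltr_pdivrMr ?ltr0n// mul1r ltr_nat => /ltnW.
have lo : (fun M => (N M)%:R * central_weight R (n M) 0 * (1 - (m M)%:R / (n M)%:R) ^+ m M) @ \oo -->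
   Num.sqrt (c / t) * expR (- (z ^+ 2 / t)).
  apply: cvgM; first exact: cvg_central_weight0_scaled.
  by apply: cvg_oneB_exp => //; near=> M; rewrite divr_ge0.
have cmnm : (fun M => (m M)%:R / (n M + m M)%:R : R) @ \oo --> 0.
  apply: squeeze_cvgr (cvg_cst 0) cmn.
  apply: filterS near_n_gt0 => M n0; rewrite divr_ge0//=.
  by rewrite ler_wpM2l// lef_pV2 ?posrE ?ltr0n ?addn_gt0 ?n0// ler_nat leq_addr.
have hi : (fun M => (N M)%:R * central_weight R (n M) 0 * (1 - (m M)%:R / (n M + m M)%:R) ^+ m M) @ \oo -->
   Num.sqrt (c / t) * expR (- (z ^+ 2 / t)).
  apply: cvgM; first exact: cvg_central_weight0_scaled.
  apply: cvg_oneB_exp => //; first by near=> M; rewrite divr_ge0.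
  have : (fun M => (m M)%:R * ((m M)%:R / (n M)%:R) * (1 - (m M)%:R / (n M + m M)%:R) : R) @ \oo -->
      z ^+ 2 / t * (1 - 0).
    by apply: cvgM => //; apply: cvgB => //; exact: cvg_cst.
  rewrite subr0 mulr1; apply: cvg_trans; apply: near_eq_cvg.
  near=> M; have n0 : (0 < n M)%N by near: M; exact: near_n_gt0.
  have nm0 : ((n M)%:R + (m M)%:R : R) != 0 by rewrite -natrD pnatr_eq0 -lt0n addn_gt0 n0.
  rewrite natrD; field; rewrite nm0 pnatr_eq0 -lt0n n0//.
apply: squeeze_cvgr lo hi.
near=> M.
have n0 : (0 < n M)%N by near: M; exact: near_n_gt0.
have nmM : (m M <= n M)%N by near: M.
apply/andP; split.
  by rewrite -[leLHS]mulrA; apply: ler_wpM2l => //; exact: central_weight_ge.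
by rewrite -[leRHS]mulrA; apply: ler_wpM2l => //; exact: central_weight_le.
Unshelve. all: end_near. Qed.

End scaling_limits.

(** * Jacobi's theta transformation *)
Lemma sqr_add1_le (R : realFieldType) (x y t : R) : 0 <= t -> 0 <= y ->
  x ^+ 2 <= t * y -> (x + 1) ^+ 2 <= (2 * t + 2) * (1 + y).
Proof.
move=> t0 y0 xy; have h := sqr_ge0 (x - 1); have ty : 0 <= t * y by rewrite mulr_ge0.
nra.
Qed.

Section theta_normalized.
Variable R : realType.

Definition theta_spec (t z : R) (k : nat) : R :=
  expR (- (t * (pi * k.+1%:R) ^+ 2)) * cos (2 * (pi * k.+1%:R * z)).

Definition theta_img (t z : R) (j : nat) : R :=
  expR (- ((z + j.+1%:R) ^+ 2 / t)) + expR (- ((j.+1%:R - z) ^+ 2 / t)).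

Variables (t z : R).
Hypotheses (t0 : 0 < t) (z0 : 0 <= z) (z1 : z <= 1).

Let N (M : nat) := M.*2.+1.
Let n (M : nat) := Num.truncn (t * (N M)%:R ^+ 2).
Let a (M : nat) := Num.truncn (z * (N M)%:R).

Let N0 M : (0 < N M)%N. Proof. by []. Qed.

Let NR M : 0 < ((N M)%:R : R). Proof. by []. Qed.

Let NR0 M : ((N M)%:R : R) != 0. Proof. by rewrite pnatr_eq0. Qed.

Let cN : (fun M => (N M)%:R^-1 : R) @ \oo --> 0.
Proof.
apply: (squeeze_cvgr _ (cvg_cst 0) (@cvg_harmonic R)).
near=> M; rewrite invr_ge0 ler0n/= lef_pV2 ?posrE// ler_nat /N; lia.
Unshelve. all: end_near. Qed.

Let truncn_scaled (x : R) (e : nat) : 0 <= x -> (0 < e)%N ->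
  (fun M => (Num.truncn (x * (N M)%:R ^+ e))%:R / (N M)%:R ^+ e : R) @ \oo --> x.
Proof.
move=> x0 e0.
have c1 : (fun M => x - (N M)%:R^-1 : R) @ \oo --> x.
  by rewrite -[X in _ --> X]subr0; apply: cvgB => //; exact: cvg_cst.
apply: squeeze_cvgr c1 (cvg_cst x).
near=> M.
have NeR : 0 < ((N M)%:R ^+ e : R) by rewrite exprn_gt0.
have h0 : 0 <= x * (N M)%:R ^+ e by rewrite mulr_ge0// ltW.
have h1 : (Num.truncn (x * (N M)%:R ^+ e))%:R <= x * (N M)%:R ^+ e by rewrite truncn_le.
have h2 : x * (N M)%:R ^+ e < (Num.truncn (x * (N M)%:R ^+ e)).+1%:R by rewrite truncnS_gt.
rewrite ler_pdivrMr// h1 andbT ler_pdivlMr// mulrBl.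
have : 1 <= (N M)%:R^-1 * (N M)%:R ^+ e :> R.
  by case: e e0 {NeR h0 h1 h2} => // e _; rewrite exprS mulKf// -natrX ler1n expn_gt0.
move: h2; rewrite -natr1; lra.
Unshelve. all: end_near. Qed.

Let cn : (fun M => (n M)%:R / (N M)%:R ^+ 2 : R) @ \oo --> t.
Proof. exact: (@truncn_scaled t 2 (ltW t0)). Qed.

Let ca : (fun M => (a M)%:R / (N M)%:R : R) @ \oo --> z.
Proof. exact: (@truncn_scaled z 1 z0). Qed.

Let n_le M : (n M)%:R <= t * (N M)%:R ^+ 2.
Proof. by rewrite truncn_le mulr_ge0// ?sqr_ge0 ?ltW. Qed.

Let aN M : (a M <= N M)%N.
Proof.
rewrite -(ler_nat R); apply: le_trans (_ : z * (N M)%:R <= _).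
  by rewrite truncn_le mulr_ge0.
by rewrite ler_piMl.
Qed.

Let ny : n @ \oo --> \oo.
Proof.
apply/cvgnyPge => A.
have h : (fun M => A%:R * ((N M)%:R^-1 * (N M)%:R^-1) : R) @ \oo --> 0.
  rewrite -(mulr0 A%:R); apply: cvgM; first exact: cvg_cst.
  by rewrite -[X in _ --> X](mulr0 0); apply: cvgM.
have h2 : \forall M \near \oo, A%:R * ((N M)%:R^-1 * (N M)%:R^-1) < t / 2 :> R.
  by apply: (cvgr_lt 0) => //; rewrite divr_gt0.
have h3 : \forall M \near \oo, t / 2 < (n M)%:R / (N M)%:R ^+ 2 :> R.
  by apply: (cvgr_gt t) => //; rewrite ltr_pdivrMr// ltr_pMr// ltr1n.
apply: filterS2 h2 h3 => M h2 h3.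
have := lt_trans h2 h3.
by rewrite -invfM -expr2 ltr_pM2r ?invr_gt0 ?exprn_gt0// ltr_nat => /ltnW.
Qed.

(** Tannery's theorem on the frequency side of discrete_theta, with n about t N^2. *)
Lemma theta_spec_cvg :
  cvgn (series (theta_spec t z)) /\
  (fun M => \sum_(k < M) cos (pi * k.+1%:R / (N M)%:R) ^+ (n M).*2
           * cos (2 * pi * k.+1%:R * (a M)%:R / (N M)%:R)) @ \oo -->
  limn (series (theta_spec t z)).
Proof.
pose A M k : R := if (k < M)%N then cos (pi * k.+1%:R / (N M)%:R) ^+ (n M).*2
           * cos (2 * pi * k.+1%:R * (a M)%:R / (N M)%:R) else 0.
pose b k : R := (t / 2 * pi ^+ 2)^-1 * k.+1%:R ^- 2.
have -> : (fun M => \sum_(k < M) cos (pi * k.+1%:R / (N M)%:R) ^+ (n M).*2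
           * cos (2 * pi * k.+1%:R * (a M)%:R / (N M)%:R)) = (fun M => \sum_(k < M) A M k).
  by apply/funext => M; apply: eq_bigr => k _; rewrite /A ltn_ord.
have pik k : 0 < pi * k.+1%:R :> R by rewrite mulr_gt0 ?pi_gt0.
apply: (@tannery _ A (theta_spec t z) b id).
- move=> k.
  have : (fun M => cos (pi * k.+1%:R / (N M)%:R) ^+ (n M).*2
           * cos (2 * (pi * k.+1%:R * ((a M)%:R / (N M)%:R)))) @ \oo --> theta_spec t z k.
    apply: cvgM; first exact: (cvg_cos_power N0 cN cn).
    have cc : (fun M => 2 * (pi * k.+1%:R * ((a M)%:R / (N M)%:R))) @ \oo --> 2 * (pi * k.+1%:R * z).
      by apply: cvgM; [exact: cvg_cst|apply: cvgM => //; exact: cvg_cst].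
    by apply: (cvg_comp _ cos cc); exact: continuous_cos.
  apply: cvg_trans; apply: near_eq_cvg; near=> M.
  rewrite /A ifT; last by near: M; exact: nbhs_infty_gt.
  by congr (_ * cos _); ring.
- have h3 : \forall M \near \oo, t / 2 < (n M)%:R / (N M)%:R ^+ 2 :> R.
    by apply: (cvgr_gt t) => //; rewrite ltr_pdivrMr// ltr_pMr// ltr1n.
  apply: filterS h3 => M h3 k; rewrite /A; case: ifPn => kM; last first.
    rewrite normr0 /b; apply: divr_ge0; last exact: sqr_ge0.
    by rewrite invr_ge0 mulr_ge0 ?sqr_ge0// divr_ge0// ltW.
  have yp : pi * k.+1%:R / (N M)%:R <= pi / 2 :> R.
    rewrite -mulrA ler_pM2l ?pi_gt0// ler_pdivrMr// -ler_pdivrMl ?invr_gt0// invrK.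
    rewrite -natrM ler_nat /N; lia.
  have := cos_power_le t0 N0 (pik k) yp (ltW h3).
  rewrite normrM; have -> : (t / 2 * (pi * k.+1%:R) ^+ 2)^-1 = b k :> R.
    by rewrite /b exprMn mulrA invfM.
  move=> h; rewrite -[leRHS]mulr1; apply: ler_pM; rewrite ?normr_ge0//.
  + rewrite -mul2n exprM normrX ger0_norm ?sqr_ge0// -exprM mul2n; exact: h.
  + by rewrite ler_norml cos_le1 cos_geN1.
- by move=> M k Mk; rewrite /A ltnNge Mk.
- rewrite /b; apply: is_cvg_seriesZ; exact: cvg_series_invsqr.
Unshelve. all: end_near. Qed.

Variable c : R.
Hypotheses (c0 : 0 < c) (qc : (fun n => n%:R * central_weight R n 0 ^+ 2) @ \oo --> c).

(** Tannery's theorem on the image side of discrete_theta. The translate with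
index j lies at distance at least j N, hence the domination by (j+1)^-2. *)
Lemma theta_img_cvg :
  cvgn (series (theta_img t z)) /\
  (fun M => (N M)%:R * (central_weight R (n M) (a M) + \sum_(j < (n M).+1)
      (central_weight R (n M) (a M + j.+1 * N M) + central_weight R (n M) (j.+1 * N M - a M)))) @ \oo -->
  Num.sqrt (c / t) * (expR (- (z ^+ 2 / t)) + limn (series (theta_img t z))).
Proof.
pose A M j : R := if (j < (n M).+1)%N then (N M)%:R *
      (central_weight R (n M) (a M + j.+1 * N M) + central_weight R (n M) (j.+1 * N M - a M)) else 0.
pose K : R := Num.sqrt (c / t) + 1.
pose b k : R := 2 * K * (2 * t + 2) * k.+1%:R ^- 2.
have caj (j : nat) : (fun M => (a M + j.+1 * N M)%:R / (N M)%:R : R) @ \oo --> z + j.+1%:R.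
  have -> : (fun M => (a M + j.+1 * N M)%:R / (N M)%:R : R) = (fun M => (a M)%:R / (N M)%:R + j.+1%:R).
    by apply/funext => M; rewrite natrD natrM mulrDl mulfK.
  by apply: cvgD => //; exact: cvg_cst.
have ajN (j M : nat) : (a M <= j.+1 * N M)%N by rewrite (leq_trans (aN M))// leq_pmull.
have cja (j : nat) : (fun M => (j.+1 * N M - a M)%:R / (N M)%:R : R) @ \oo --> j.+1%:R - z.
  have -> : (fun M => (j.+1 * N M - a M)%:R / (N M)%:R : R) = (fun M => j.+1%:R - (a M)%:R / (N M)%:R).
    by apply/funext => M; rewrite natrB// natrM mulrBl mulfK.
  by apply: cvgB => //; exact: cvg_cst.
have cqw := cvg_central_weight_scaled t0 N0 cN cn ny qc.
have [||||cl ct] := @tannery _ A (fun j => Num.sqrt (c / t) * theta_img t z j) b (fun M => (n M).+1).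
- move=> j.
  have : (fun M => (N M)%:R * central_weight R (n M) (a M + j.+1 * N M) + (N M)%:R * central_weight R (n M) (j.+1 * N M - a M))
      @ \oo --> Num.sqrt (c / t) * theta_img t z j.
    by rewrite mulrDr; apply: cvgD; exact: cqw.
  apply: cvg_trans; apply: near_eq_cvg.
  have /cvgnyPgt/(_ j) := ny.
  by apply: filterS => M h; rewrite /A ifT ?mulrDr// ltnS ltnW.
- have h1 : \forall M \near \oo, (N M)%:R * central_weight R (n M) 0 < K.
    by apply: (cvgr_lt _ (cvg_central_weight0_scaled t0 N0 cn ny qc)); rewrite ltrDl.
  have h2 := near_n_gt0 ny.
  apply: filterS2 h1 h2 => M h1 h2 j.
  have K0 : 0 <= K by rewrite /K addr_ge0// sqrtr_ge0.
  rewrite /A; case: ifPn => _; last first.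
    by rewrite normr0 /b !mulr_ge0 ?invr_ge0 ?sqr_ge0// addr_ge0// mulr_ge0// ltW.
  have H m : (j * N M <= m)%N -> (N M)%:R * central_weight R (n M) m <= K * (2 * t + 2) * j.+1%:R ^- 2.
    move=> jm; have nR : 0 < ((n M)%:R : R) by rewrite ltr0n.
    have p1 : 0 < 1 + m%:R ^+ 2 / (n M)%:R :> R by rewrite ltr_pwDl// divr_ge0// sqr_ge0.
    apply: le_trans (_ : (N M)%:R * (central_weight R (n M) 0 / (1 + m%:R ^+ 2 / (n M)%:R)) <= _).
      by rewrite ler_wpM2l// central_weight_le_inv.
    rewrite mulrA -[K * _ * _]mulrA; apply: ler_pM; rewrite ?mulr_ge0 ?central_weight_ge0 ?invr_ge0 ?(ltW p1) ?(ltW h1)//.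
    rewrite ler_pdivlMr ?exprn_gt0// mulrC ler_pdivrMr//.
    have mn : j%:R ^+ 2 <= t * (m%:R ^+ 2 / (n M)%:R).
      rewrite mulrA ler_pdivlMr//.
      apply: le_trans (_ : j%:R ^+ 2 * (t * (N M)%:R ^+ 2) <= _); first by rewrite ler_wpM2l ?sqr_ge0.
      rewrite mulrCA ler_pM2l// -exprMn lerXn2r ?nnegrE ?mulr_ge0// -natrM ler_nat//.
    have : 0 <= m%:R ^+ 2 / (n M)%:R :> R by rewrite divr_ge0// sqr_ge0.
    have : 0 <= (j%:R : R) by []. move: mn.
    rewrite -[j.+1%:R]natr1; move: (j%:R : R) (m%:R ^+ 2 / _) => x y mn x0 y0.
    exact: sqr_add1_le (ltW t0) _ _.
  rewrite ger0_norm; last by rewrite mulr_ge0// addr_ge0 ?central_weight_ge0.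
  rewrite mulrDr; apply: le_trans (lerD (H _ _) (H _ _)) _.
  + by rewrite mulSn; lia.
  + by rewrite mulSn; have := aN M; lia.
  + by rewrite /b le_eqVlt; apply/orP; left; apply/eqP; ring.
- by move=> M k Mk; rewrite /A ltnNge Mk.
- by apply: is_cvg_seriesZ; exact: cvg_series_invsqr.
have s0 : 0 < Num.sqrt (c / t) by rewrite sqrtr_gt0 divr_gt0.
have cB : cvgn (series (theta_img t z)).
  have : cvgn (series ((Num.sqrt (c / t))^-1 \*: (fun j => Num.sqrt (c / t) * theta_img t z j))).
    exact: is_cvg_seriesZ.
  by congr (cvgn (series _)); apply/funext => j /=; rewrite /= /GRing.scale/= mulrA mulVf ?mul1r ?gt_eqF.
split => //.
rewrite mulrDr.
have -> : Num.sqrt (c / t) * limn (series (theta_img t z)) =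
   limn (series (fun j => Num.sqrt (c / t) * theta_img t z j)).
  by rewrite (lim_seriesZ _ cB).
have -> : (fun M => (N M)%:R * (central_weight R (n M) (a M) + \sum_(j < (n M).+1)
      (central_weight R (n M) (a M + j.+1 * N M) + central_weight R (n M) (j.+1 * N M - a M)))) =
  (fun M => (N M)%:R * central_weight R (n M) (a M) + \sum_(j < (n M).+1) A M j).
  apply/funext => M; rewrite mulrDr mulr_sumr; congr +%R.
  by apply: eq_bigr => j _; rewrite /A ltn_ord.
by apply: cvgD => //; exact: cqw.
Qed.

Lemma theta_normalized_c :
  1 + 2 * limn (series (theta_spec t z)) =
  Num.sqrt (c / t) * (expR (- (z ^+ 2 / t)) + limn (series (theta_img t z))).
Proof.
have [_ h1] := theta_spec_cvg; have [_ h2] := theta_img_cvg.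
have h3 : (fun M => 1 + 2 * \sum_(k < M) cos (pi * k.+1%:R / (N M)%:R) ^+ (n M).*2
           * cos (2 * pi * k.+1%:R * (a M)%:R / (N M)%:R)) @ \oo -->
    1 + 2 * limn (series (theta_spec t z)).
  by apply: cvgD; [exact: cvg_cst|apply: cvgM => //; exact: cvg_cst].
apply: (cvg_unique _ h3); first exact: norm_hausdorff.
apply: cvg_trans h2; apply: near_eq_cvg; near=> M.
by rewrite -(discrete_theta _ (aN M) (ltnSn _)).
Unshelve. all: end_near.
Qed.

End theta_normalized.

(** Jacobi's transformation on the unit circle. At t = 1/pi and z = 0 the two
series coincide term by term up to a factor 2, so the equation obtained with
the unknown Wallis constant c reads S = sqrt (c pi) S, where S > 0 is the value
of the theta series, and yields c = 1/pi. *)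
Lemma theta_normalized (R : realType) (t z : R) : 0 < t -> 0 <= z <= 1 ->
  [/\ cvgn (series (theta_spec t z)), cvgn (series (theta_img t z)) &
  1 + 2 * limn (series (theta_spec t z)) =
  (Num.sqrt (pi * t))^-1 * (expR (- (z ^+ 2 / t)) + limn (series (theta_img t z)))].
Proof.
move=> t0 /andP[z0 z1].
have [c c0 qc] := wallis_cvg R.
have [h1 _] := theta_spec_cvg t0 z0 z1.
have [h2 _] := theta_img_cvg t0 z0 z1 c0 qc.
split => //.
rewrite (theta_normalized_c t0 z0 z1 c0 qc); congr *%R.
have p0 : 0 < pi^-1 :> R by rewrite invr_gt0 pi_gt0.
(* the self-dual point, where the transformation fixes its own constant *)
have := theta_normalized_c p0 (lexx 0) ler01 c0 qc.
have -> : theta_img (pi^-1 : R) 0 = (fun k => 2 * theta_spec (pi^-1 : R) 0 k).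
  apply/funext => k; rewrite /theta_img /theta_spec.
  rewrite add0r subr0 mulr0 mulr0 cos0 mulr1 invrK.
  have -> : pi^-1 * (pi * k.+1%:R) ^+ 2 = k.+1%:R ^+ 2 * pi :> R.
    by rewrite exprMn mulrA [pi ^+ 2]expr2 mulKf ?gt_eqF ?pi_gt0// mulrC.
  by ring.
have [cs _] := theta_spec_cvg p0 (lexx 0) ler01.
rewrite (lim_seriesZ _ cs) expr0n/= mul0r oppr0 expR0.
set S := limn _ => E.
have S0 : 0 <= S.
  apply: limr_ge => //; near=> M; apply: sumr_ge0 => k _.
  by rewrite /theta_spec mulr0 mulr0 cos0 mulr1 expR_ge0.
have : Num.sqrt (c / pi^-1) = 1.
  apply: (mulIf (_ : 1 + 2 * S != 0)); first by rewrite gt_eqF// ltr_pwDl// mulr_ge0.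
  by rewrite mul1r -E.
rewrite invrK => /(congr1 (fun x => x ^+ 2)).
rewrite sqr_sqrtr ?mulr_ge0 ?pi_ge0 ?(ltW c0)// expr1n => cpi.
have p1 : (pi : R) != 0 := lt0r_neq0 (pi_gt0 R).
have -> : c = pi^-1 by rewrite -[LHS](mulfK p1) cpi mul1r.
by rewrite -invfM sqrtrV// mulr_ge0 ?pi_ge0// ltW.
Unshelve. all: end_near. Qed.

(** * Integrals of generalized inverse Gaussian densities *)
Local Notation mu := lebesgue_measure.

Lemma continuous_expRN (R : realType) : continuous (fun u : R => expR (- u)).
Proof.
move=> u; apply: (@continuous_comp _ _ _ (fun u : R => - u) expR).
  by apply: cvgN; exact: cvg_id.
exact: continuous_expR.
Qed.

(** Substitution t = e^u on the half line: applied on [e^-n, e^n] and extended by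
monotone convergence on both sides. *)
Lemma ge0_integral_exp_subst (R : realType) (G : R -> R) :
  {in `]0, +oo[, continuous G} -> (forall x, 0 < x -> 0 <= G x) ->
  (\int[mu]_(x in `]0%R, +oo[) (G x)%:E =
   \int[mu]_u (G (expR u) * expR u)%:E)%E.
Proof.
move=> cG G0.
have dexp : (@expR R)^`()%classic = expR.
  by apply/funext => x; rewrite derive1E derive_val.
pose H (u : R) := G (expR u) * expR u.
have cGe : continuous (G \o expR).
  move=> u; apply: continuous_comp; first exact: continuous_expR.
  by apply: cG; rewrite in_itv/= andbT expR_gt0.
have cH : continuous H.
  by move=> u; apply: cvgM; [exact: cGe|exact: continuous_expR].
have eqn (n : nat) : (\int[mu]_(x in `[expR (- n%:R)%R, expR n%:R%R]) (G x)%:E =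
                      \int[mu]_(u in `[(- n%:R)%R, n%:R%R]) (H u)%:E)%E.
  rewrite (@integration_by_substitution_increasing R expR G).
  - by rewrite dexp.
  - by rewrite ge0_cp.
  - by move=> x y _ _; rewrite ltr_expR.
  - by rewrite dexp => x _; exact: continuous_expR.
  - rewrite dexp; apply/cvg_ex; exists (expR (- n%:R)).
    by apply: cvg_at_right_filter; exact: continuous_expR.
  - rewrite dexp; apply/cvg_ex; exists (expR n%:R).
    by apply: cvg_at_left_filter; exact: continuous_expR.
  - split.
    + by move=> x _; exact: derivable_expR.
    + by apply: cvg_at_right_filter; exact: continuous_expR.
    + by apply: cvg_at_left_filter; exact: continuous_expR.
  - apply: continuous_in_subspaceT => x; rewrite inE/= in_itv/= => /andP[x0 _].
    by apply: cG; rewrite in_itv/= andbT (lt_le_trans _ x0)// expR_gt0.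
have U1 : \bigcup_n `[(- n%:R : R), n%:R]%classic = setT.
  apply/seteqP; split => // x _; exists (Num.truncn `|x|).+1 => //=.
  by rewrite in_itv/= -ler_norml ltW// truncnS_gt.
have U2 : \bigcup_n `[expR (- n%:R : R), expR n%:R]%classic = `]0, +oo[%classic.
  apply/seteqP; split => x /=.
    by move=> [n _ /=]; rewrite !in_itv/= andbT => /andP[h _]; rewrite (lt_le_trans _ h)// expR_gt0.
  rewrite in_itv/= andbT => x0.
  have : (\bigcup_n `[(- n%:R : R), n%:R]%classic) (ln x) by rewrite U1.
  move=> [n _ /=]; rewrite in_itv/= => /andP[h1 h2]; exists n => //=.
  by rewrite in_itv/= -[x]lnK ?posrE// !ler_expR h1.
have h1 : (\int[mu]_(u in `[(- n%:R)%R : R, n%:R%R]) (H u)%:E)%E @[n --> \oo] -->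
   (\int[mu]_(u in \bigcup_n `[(- n%:R)%R : R, n%:R%R]%classic) (H u)%:E)%E.
  apply: ge0_nondecreasing_set_cvg_integral.
  - move=> n m nm; apply/subsetPset => x /=; rewrite !in_itv/= => /andP[a b].
    by rewrite (le_trans _ a) ?lerN2 ?ler_nat// (le_trans b)// ler_nat.
  - by move=> i; exact: measurable_itv.
  - by move=> i; apply/measurable_EFinP; apply: measurable_funTS; exact: continuous_measurable_fun.
  - by move=> i x _; rewrite lee_fin mulr_ge0 ?G0 ?expR_gt0 ?expR_ge0.
have h2 : (\int[mu]_(x in `[expR (- n%:R : R)%R, expR n%:R%R]) (G x)%:E)%E @[n --> \oo] -->
   (\int[mu]_(x in \bigcup_n `[expR (- n%:R : R)%R, expR n%:R%R]%classic) (G x)%:E)%E.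
  have sub (i : nat) : `[expR (- i%:R : R), expR i%:R] `<=` `]0, +oo[.
    move=> x /=; rewrite !in_itv/= andbT => /andP[a _].
    by rewrite (lt_le_trans _ a)// expR_gt0.
  apply: ge0_nondecreasing_set_cvg_integral.
  - move=> n m nm; apply/subsetPset => x /=; rewrite !in_itv/= => /andP[a b].
    by rewrite (le_trans _ a) ?ler_expR ?lerN2 ?ler_nat// (le_trans b)// ler_expR ler_nat.
  - by move=> i; exact: measurable_itv.
  - move=> i; apply/measurable_EFinP.
    apply: measurable_funS (sub i) _; first exact: measurable_itv.
    apply: open_continuous_measurable_fun; first exact: interval_open.
    by move=> x; rewrite inE/=; exact: cG.
  - by move=> i x /sub/=; rewrite in_itv/= andbT lee_fin; exact: G0.
rewrite U1 in h1; rewrite U2 in h2.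
apply: (cvg_unique _ h2); first exact: ereal_hausdorff.
apply: cvg_trans h1; apply: near_eq_cvg; near=> n; exact/esym/eqn.
Unshelve. all: end_near.
Qed.

Section gig_densities.
Variable R : realType.
Implicit Types nu A B u : R.

(** In the variable t = e^u this is t^(nu-1) exp(- A t - B/t) dt, the density of
a generalized inverse Gaussian law up to its mass. It contains the densities
of the Gamma function (B = 0) and of the Bessel function K_nu (A = B), and
products of it with heat kernels are again of this form. *)
Definition gig nu A B u : R := expR (nu * u - A * expR u - B * expR (- u)).

Lemma gig_ge0 nu A B u : 0 <= gig nu A B u. Proof. exact: expR_ge0. Qed.

Lemma gig_continuous nu A B : continuous (gig nu A B).
Proof.
move=> u; rewrite /gig; apply: continuous_comp; last exact: continuous_expR.
apply: cvgB.
  apply: cvgB.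
    by apply: cvgM; [exact: cvg_cst|exact: cvg_id].
  by apply: cvgM; [exact: cvg_cst|exact: continuous_expR].
by apply: cvgM; [exact: cvg_cst|exact: continuous_expRN].
Qed.

Lemma gig_measurable nu A B (D : set R) : measurable_fun D (EFin \o gig nu A B).
Proof.
apply/measurable_EFinP; apply: measurable_funTS.
exact: (continuous_measurable_fun (@gig_continuous nu A B)).
Qed.

(** The common dominating function of the densities gig. *)
Lemma integrable_expRNabs (c : R) : 0 < c ->
  mu.-integrable setT (EFin \o (fun u : R => expR (- (c * `|u|)))).
Proof.
move=> c0; have cf : continuous (fun u : R => expR (- (c * `|u|))).
  move=> u; apply: (@continuous_comp _ _ _ (fun u : R => c * `|u|) (fun u => expR (- u))).
    by apply: cvgM; [exact: cvg_cst|exact: norm_continuous].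
  exact: continuous_expRN.
apply/integrableP; split.
  by apply/measurable_EFinP; exact: continuous_measurable_fun.
under eq_integral do rewrite /= ger0_norm ?expR_ge0//.
rewrite ge0_symfun_integralT//; last by move=> u /=; rewrite normrN.
rewrite -set_itvcy.
have -> : (\int[mu]_(x in `[0%R, +oo[) (expR (- (c * `|x : R|)))%:E =
   \int[mu]_(x in `[0%R, +oo[) (expR (- (c * x)))%:E)%E.
  by apply: eq_integral => u; rewrite inE/= in_itv/= andbT => u0; rewrite ger0_norm.
have dF (x : R) : is_derive x 1 (fun u => - c^-1 * expR (- (c * u))) (expR (- (c * x))).
  apply: is_derive_eq. rewrite /GRing.scale/=. by field; rewrite gt_eqF.
have cf1 : continuous (fun u : R => expR (- (c * u))).
  move=> u; apply: (@continuous_comp _ _ _ (fun u : R => c * u) (fun u => expR (- u))).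
    by apply: cvgM; [exact: cvg_cst|exact: cvg_id].
  exact: continuous_expRN.
rewrite (@ge0_continuous_FTC2y R _ (fun u => - c^-1 * expR (- (c * u))) 0 0).
- by rewrite -EFinB -EFinM ltry.
- by move=> x _; exact: expR_ge0.
- by apply: continuous_subspaceT.
- rewrite -[X in _ --> X](mulr0 (- c^-1)); apply: cvgM; first exact: cvg_cst.
  apply: (cvg_comp (fun u : R => c * u) (fun u => expR (- u))); last exact: cvgr_expR.
  by apply: gt0_cvgMry => //; exact: cvg_id.
- by move=> x _; apply: ex_derive; exact: dF.
- apply: cvg_at_right_filter; apply: cvgM; first exact: cvg_cst.
  exact: cf1.
- by move=> x _; rewrite derive1E; exact: derive_val.
Qed.

Lemma expR_ge_sqr u : 0 <= u -> u ^+ 2 / 4 <= expR u.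
Proof.
move=> u0; have -> : u = u / 2 *+ 2 by rewrite -mulr_natr mulfVK.
rewrite mulr2n expRD -expr2.
have h : 1 + u / 2 <= expR (u / 2) := expR_ge1Dx _.
apply: le_trans (_ : (1 + u / 2) ^+ 2 <= _).
  have : u / 2 + u / 2 = u by rewrite -splitr.
  nra.
by rewrite lerXn2r ?nnegrE ?expR_ge0// addr_ge0// divr_ge0.
Qed.

(** A range of parameters where gig is integrable at both ends of the line. *)
Definition gig_ok nu A B := [/\ 0 < A, 0 <= B & 0 < nu \/ 0 < B].

(** A quadratic lower bound for exp absorbs the linear term nu u on the side where
an exponential is present; otherwise nu u itself decays. *)
Lemma gig_bound nu A B : gig_ok nu A B ->
  exists2 c, 0 < c & exists2 C, 0 <= C & forall u, gig nu A B u <= C * expR (- (c * `|u|)).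
Proof.
move=> [A0 B0 [nu0|Bp]].
  exists nu => //; exists (expR (4 * nu ^+ 2 / A)); first exact: expR_ge0.
  move=> u; rewrite -expRD ler_expR.
  have Be : 0 <= B * expR (- u) by rewrite mulr_ge0 ?expR_ge0.
  have K0 : 0 <= 4 * nu ^+ 2 / A by rewrite divr_ge0 ?mulr_ge0 ?sqr_ge0// ltW.
  case: (leP 0 u) => u0.
    have := expR_ge_sqr u0 => h.
    have h2 : A * (u ^+ 2 / 4) <= A * expR u by rewrite ler_pM2l.
    have h3 : 2 * nu * u <= A * (u ^+ 2 / 4) + 4 * nu ^+ 2 / A.
      rewrite -subr_ge0.
      have -> : A * (u ^+ 2 / 4) + 4 * nu ^+ 2 / A - 2 * nu * u = (A * u / 2 - 2 * nu) ^+ 2 / A.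
        by field; rewrite gt_eqF.
      by rewrite divr_ge0 ?sqr_ge0// ltW.
    rewrite ger0_norm//; lra.
  have : 0 <= A * expR u by rewrite mulr_ge0 ?expR_ge0// ltW.
  rewrite ltr0_norm//; lra.
exists 1 => //.
pose m := Num.min A B; have m0 : 0 < m by rewrite /m lt_min A0 Bp.
have mA : m <= A by rewrite /m ge_min lexx.
have mB : m <= B by rewrite /m ge_min lexx orbT.
exists (expR ((`|nu| + 1) ^+ 2 / m)); first exact: expR_ge0.
move=> u; rewrite -expRD ler_expR mul1r.
have h : m * (`|u| ^+ 2 / 4) <= A * expR u + B * expR (- u).
  have Au : 0 <= A * expR u by rewrite mulr_ge0 ?expR_ge0// ltW.
  have Bu : 0 <= B * expR (- u) by rewrite mulr_ge0 ?expR_ge0// ltW.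
  case: (leP 0 u) => u0.
    apply: le_trans (_ : A * expR u <= _); last by rewrite lerDl.
    apply: (ler_pM (ltW m0) _ mA); first by rewrite divr_ge0// sqr_ge0.
    by rewrite ger0_norm//; exact: expR_ge_sqr.
  apply: le_trans (_ : B * expR (- u) <= _); last by rewrite lerDr.
  apply: (ler_pM (ltW m0) _ mB); first by rewrite divr_ge0// sqr_ge0.
  by rewrite ltr0_norm//; apply: expR_ge_sqr; rewrite oppr_ge0 ltW.
have h2 : nu * u <= `|nu| * `|u| by rewrite -normrM ler_norm.
have h3 : (`|nu| + 1) * `|u| <= m * (`|u| ^+ 2 / 4) + (`|nu| + 1) ^+ 2 / m.
  rewrite -subr_ge0.
  have -> : m * (`|u| ^+ 2 / 4) + (`|nu| + 1) ^+ 2 / m - (`|nu| + 1) * `|u|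
      = (m * `|u| / 2 - (`|nu| + 1)) ^+ 2 / m.
    by field; rewrite gt_eqF.
  by rewrite divr_ge0 ?sqr_ge0// ltW.
lra.
Qed.

Lemma integrable_gig nu A B : gig_ok nu A B -> mu.-integrable setT (EFin \o gig nu A B).
Proof.
move=> /gig_bound[c c0 [C C0 H]].
apply: (@le_integrable _ _ _ mu setT measurableT _ (EFin \o (fun u => C * expR (- (c * `|u|))))).
- exact: gig_measurable.
- move=> u _; rewrite /= lee_fin ger0_norm ?gig_ge0// ger0_norm ?H//.
  by rewrite mulr_ge0 ?expR_ge0.
- have := @integrableZl _ _ _ mu setT measurableT C _ (integrable_expRNabs c0).
  by apply: eq_integrable.
Qed.

Definition gig_mass nu A B : R := \int[mu]_(u in setT) gig nu A B u.

Lemma gig_mass_E nu A B : gig_ok nu A B -> (\int[mu]_u (gig nu A B u)%:E)%E = (gig_mass nu A B)%:E.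
Proof. by move=> h; rewrite /gig_mass /Rintegral fineK// integrable_fin_num//; exact: integrable_gig. Qed.

Lemma gig_ok_shift nu A B c : gig_ok nu A B -> gig_ok nu (A * expR c) (B * expR (- c)).
Proof.
move=> [a b o]; split; [by rewrite mulr_gt0 ?expR_gt0|by rewrite mulr_ge0 ?expR_ge0|].
by case: o => h; [left|right; rewrite mulr_gt0 ?expR_gt0].
Qed.

(** Translation u = v + c, that is, scaling of t by e^c. *)
Lemma gig_mass_shift nu A B c : gig_ok nu A B ->
  gig_mass nu A B = expR (nu * c) * gig_mass nu (A * expR c) (B * expR (- c)).
Proof.
move=> ok.
have H : (\int[mu]_u (gig nu A B u)%:E =
   (expR (nu * c))%:E * \int[mu]_u (gig nu (A * expR c) (B * expR (- c)) u)%:E)%E.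
  have dF : (fun u : R => u + c)^`()%classic = cst 1.
    by apply/funext => x; rewrite derive1E derive_val addr0.
  rewrite (@increasing_ge0_integration_by_substitutionT R (fun u => u + c)).
  - rewrite -ge0_integralZl_EFin ?expR_ge0//; [|by move=> u _; rewrite lee_fin gig_ge0|exact: gig_measurable].
    apply: eq_integral => u _; rewrite dF -EFinM; congr EFin => /=.
    rewrite mulr1 /gig -expRD; congr expR.
    by rewrite opprD !expRD; ring.
  - by move=> x y; rewrite ltrD2r.
  - by rewrite dF => x; exact: cvg_cst.
  - by rewrite dF; exact: is_cvg_cst.
  - by rewrite dF; exact: is_cvg_cst.
  - by move=> x; exact: ex_derive.
  - by apply: cvg_addrr_Ny.
  - by apply: cvg_addrr.
  - exact: gig_continuous.
  - by move=> x; exact: gig_ge0.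
by move: H; rewrite !gig_mass_E//; [move=> [] | exact: gig_ok_shift].
Qed.

Lemma gig_mass_gt0 nu A B : gig_ok nu A B -> 0 < gig_mass nu A B.
Proof.
move=> h; rewrite -lte_fin -gig_mass_E//.
have mI : measurable (`[0, 1]%classic : set R) by exact: measurable_itv.
pose m := expR (- `|nu| - A * expR 1 - B).
have Wm u : u \in `[0, 1] -> m <= gig nu A B u.
  rewrite in_itv/= => /andP[u0 u1]; rewrite ler_expR; case: h => A0 B0 _.
  have h1 : - `|nu| <= nu * u.
    have : `|nu * u| <= `|nu| by rewrite normrM (ger0_norm u0) ler_piMr.
    by rewrite ler_norml => /andP[].
  have h2 : A * expR u <= A * expR 1 by rewrite ler_pM2l// ler_expR.
  have h3 : B * expR (- u) <= B by rewrite ler_piMr// -expR0 ler_expR oppr_le0.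
  lra.
apply: lt_le_trans (_ : \int[mu]_(u in `[0%R, 1%R]) (gig nu A B u)%:E <= _)%E.
  apply: lt_le_trans (_ : \int[mu]_(u in `[0%R, 1%R]) m%:E <= _)%E.
    rewrite integral_cst//= lebesgue_measure_itv/= lte_fin ltr01 oppr0 adde0 mule1.
    by rewrite lte_fin expR_gt0.
  apply: ge0_le_integral => //; last exact: gig_measurable.
  by move=> u _; rewrite lee_fin expR_ge0.
apply: ge0_subset_integral => //; first exact: gig_measurable.
by move=> u _; rewrite lee_fin gig_ge0.
Qed.

Lemma powR_expR (u a : R) : expR u `^ a = expR (a * u).
Proof. by rewrite /powR gt_eqF ?expR_gt0// expRK. Qed.

Lemma Gamma_gig_mass (a : R) : Gamma a = gig_mass a 1 0.
Proof.
rewrite /Gamma /gig_mass /Rintegral; congr fine.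
rewrite ge0_integral_exp_subst.
- apply: eq_integral => u _; congr EFin.
  rewrite /gig powR_expR -!expRD; congr expR; ring.
- move=> x x0; apply: cvgM; last exact: continuous_expRN.
  have := @derivable_powR R 1 (a - 1) x x0.
  by move=> /derivable1_diffP/differentiable_continuous.
- by move=> x x0; rewrite mulr_ge0 ?powR_ge0 ?expR_ge0.
Qed.

(** The Gamma integral for lam^-a: it is this formula that converts the power of an
eigenvalue into an average of exponentials. *)
Lemma gig_mass_powR (a lam : R) : 0 < a -> 0 < lam -> gig_mass a lam 0 = lam `^ (- a) * Gamma a.
Proof.
move=> a0 l0; rewrite (gig_mass_shift (- ln lam)); last by split => //; left.
have l1 : lam != 0 by rewrite gt_eqF.
have lE : expR (ln lam) = lam by rewrite lnK ?posrE.
rewrite Gamma_gig_mass mul0r expRN lE (mulfV l1).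
by rewrite -{2}lE powR_expR mulrN mulNr.
Qed.

Lemma Gamma_gt0 (a : R) : 0 < a -> 0 < Gamma a.
Proof. by move=> a0; rewrite Gamma_gig_mass gig_mass_gt0//; split => //; left. Qed.

(** Folding the line onto the half line combines e^(nu u) and e^(-nu u) into
2 cosh (nu u). *)
Lemma gig_mass_besselK nu (x : R) : 0 < x -> gig_mass nu (x / 2) (x / 2) = 2 * besselK nu x.
Proof.
move=> x0; have ok : gig_ok nu (x / 2) (x / 2).
  by split; [rewrite divr_gt0|rewrite divr_ge0// ltW|right; rewrite divr_gt0].
pose w := gig nu (x / 2) (x / 2).
have mw (D : set R) : measurable_fun D (EFin \o w) by exact: gig_measurable.
have cw : continuous w by exact: gig_continuous.
have cwN : continuous (w \o -%R).
  by move=> u; apply: continuous_comp; [apply: cvgN; exact: cvg_id|exact: cw].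
have mwN (D : set R) : measurable_fun D (EFin \o (w \o -%R)).
  by apply/measurable_EFinP; apply: measurable_funTS; exact: continuous_measurable_fun.
have w0 u : 0 <= w u by exact: gig_ge0.
have E : (\int[mu]_u (w u)%:E = \int[mu]_(u in `[0%R, +oo[) (2 * (expR (- (x * cosh u)) * cosh (nu * u)))%:E)%E.
  transitivity (\int[mu]_(u in `]-oo, (0 : R)%R] `|` `]0%R, +oo[) (w u)%:E)%E.
    congr (integral _ _ _); apply/seteqP; split => // u _ /=.
    by rewrite !in_itv/= andbT; case: (leP u 0); [left|right].
  rewrite ge0_integral_setU//; [|exact: mw|by move=> u _; rewrite lee_fin|]; last first.
    apply/disj_setPS => u /= []; rewrite !in_itv/= andbT => u0 u1.
    by rewrite ltNge u0 in u1.
  rewrite -{1}(@oppr0 R) ge0_integration_by_substitutionNy; [|exact: continuous_subspaceT|by move=> u _; exact: w0].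
  rewrite integral_itv_obnd_cbnd; last exact: mw.
  rewrite -ge0_integralD//; [|by move=> u _; rewrite lee_fin w0|exact: mwN|by move=> u _; rewrite lee_fin w0|exact: mw].
  apply: eq_integral => u _; rewrite -EFinD; congr EFin.
  rewrite /w /gig /cosh /= opprK.
  have -> : expR (nu * - u - x / 2 * expR (- u) - x / 2 * expR u) =
     expR (- (x * ((expR u + expR (- u)) / 2))) * expR (- (nu * u)).
    by rewrite -expRD; congr expR; field.
  have -> : expR (nu * u - x / 2 * expR u - x / 2 * expR (- u)) =
     expR (- (x * ((expR u + expR (- u)) / 2))) * expR (nu * u).
    by rewrite -expRD; congr expR; field.
  by field.
rewrite /besselK /gig_mass /Rintegral E.
have c0 u : 0 <= expR (- (x * cosh u)) * cosh (nu * u).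
  by rewrite mulr_ge0 ?expR_ge0// /cosh divr_ge0// addr_ge0// expR_ge0.
have cc (a : R) : continuous (fun u : R => cosh (a * u)).
  move=> u; rewrite /cosh; apply: cvgM; last exact: cvg_cst.
  have ca : (fun u : R => a * u) @ u --> a * u by apply: cvgM; [exact: cvg_cst|exact: cvg_id].
  by apply: cvgD; [apply: (cvg_comp _ expR ca); exact: continuous_expR
                  |apply: (cvg_comp _ (fun v => expR (- v)) ca); exact: continuous_expRN].
have cf : continuous (fun u => expR (- (x * cosh u)) * cosh (nu * u)).
  move=> u; apply: cvgM; last exact: cc.
  have cx : (fun u : R => x * cosh u) @ u --> x * cosh u.
    apply: cvgM; first exact: cvg_cst.
    have -> : @cosh R = (fun v => cosh (1 * v)) by apply/funext => v; rewrite mul1r.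
    exact: cc.
  by apply: (cvg_comp _ (fun v => expR (- v)) cx); exact: continuous_expRN.
set I := (\int[mu]_(u in `[0%R, +oo[) (expR (- (x * cosh u)) * cosh (nu * u))%:E)%E.
have -> : (\int[mu]_(u in `[0%R, +oo[) (2 * (expR (- (x * cosh u)) * cosh (nu * u)))%:E = 2%:E * I)%E.
  rewrite -ge0_integralZl_EFin//; first by move=> u _; rewrite lee_fin.
  apply/measurable_EFinP; apply: measurable_funTS.
  exact: continuous_measurable_fun.
have p2 : (0%:E < 2%:E :> \bar R)%E by rewrite lte_fin.
case: I => [r| |]; first by [].
- by rewrite gt0_muley// [fine _]/= mulr0.
- by rewrite gt0_muleNy// [fine _]/= mulr0.
Qed.

(** The Matern function as a mixture of Gaussians: by the shift t -> (x/2) t,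
K_nu(x) becomes the mass of t^(nu-1) exp(- t - x^2/(4t)). The formula also
holds at x = 0, where it reduces to the Gamma integral. *)
Lemma matern_gig_mass nu (x : R) : 0 < nu -> 0 <= x ->
  matern nu x = gig_mass nu 1 (x ^+ 2 / 4) / Gamma nu.
Proof.
move=> nu0; rewrite le_eqVlt => /predU1P[<-|x0].
  by rewrite /matern ltxx expr0n/= mul0r -Gamma_gig_mass mulfV// gt_eqF// Gamma_gt0.
rewrite /matern x0.
have x2 : 0 < x / 2 by rewrite divr_gt0.
rewrite (gig_mass_shift (ln (x / 2))); last by split => //; [rewrite divr_ge0// sqr_ge0|left].
rewrite mul1r expRN lnK ?posrE//.
have -> : x ^+ 2 / 4 / (x / 2) = x / 2 by field; rewrite gt_eqF.
rewrite gig_mass_besselK// -powR_expR lnK ?posrE//.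
have G0 := Gamma_gt0 nu0.
have p2 : 0 < 2 `^ (nu - 1) :> R by rewrite powR_gt0.
have e1 : x `^ nu = (x / 2) `^ nu * 2 `^ nu.
  by rewrite -powRM ?divfK ?(ltW x2).
have e2 : 2 `^ nu = 2 `^ (nu - 1) * 2 :> R.
  have n2 : (nu - 1 + 1 == 0) ==> ((2 : R) != 0) by rewrite pnatr_eq0 implybT.
  by rewrite -{1}[nu](subrK 1) (powRD n2) powRr1.
rewrite e1 e2.
by field; rewrite !gt_eqF.
Qed.

End gig_densities.

(** * Decay of the Matern function *)
Section matern_theory.
Variable R : realType.
Implicit Types nu y q u x a b : R.

Lemma gig_expRN nu A B u : expR (- u) * gig nu A B u = gig (nu - 1) A B u.
Proof. by rewrite /gig -expRD; congr expR; ring. Qed.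

(** Differentiation in B brings down the factor - e^(-u), which lowers nu by one. *)
Lemma is_derive_gig_mass nu q : 0 < q -> is_derive q 1 (gig_mass nu 1) (- gig_mass (nu - 1) 1 q).
Proof.
move=> q0.
have okq (m p : R) : 0 < p -> gig_ok m 1 p by move=> p0; split => //; [exact: ltW|right].
pose f (p u : R) := gig nu 1 p u.
have dW (p u : R) : is_derive p 1 (f ^~ u) (- gig (nu - 1) 1 p u).
  rewrite -gig_expRN.
  have : is_derive p 1 (fun p => expR ((nu * u - 1 * expR u) - p * expR (- u)))
     (- (expR (- u) * expR ((nu * u - 1 * expR u) - p * expR (- u)))).
    apply: is_derive_eq; rewrite /GRing.scale/=; ring.
  by [].
have Iq : q \in `](q / 2), (q * 2)[%R by rewrite in_itv/=; apply/andP; split; lra.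
have intf p : p \in `](q / 2), (q * 2)[%R -> mu.-integrable setT (EFin \o f p).
  rewrite in_itv/= => /andP[h _]; apply: integrable_gig; apply: okq; lra.
have q2 : 0 < q / 2 by rewrite divr_gt0.
have G0 u : 0 <= gig (nu - 1) 1 (q / 2) u by exact: gig_ge0.
have iG : mu.-integrable setT (EFin \o gig (nu - 1) 1 (q / 2)) by exact/integrable_gig/okq.
have d1 p u : partial1of2 f p u = - gig (nu - 1) 1 p u.
  by rewrite partial1of2E; have := dW p u => h; exact: derive_val.
have dG p u : p \in `](q / 2), (q * 2)[%R -> setT u -> `|partial1of2 f p u| <= gig (nu - 1) 1 (q / 2) u.
  rewrite in_itv/= => /andP[h _] _; rewrite d1 normrN ger0_norm ?gig_ge0//.
  by rewrite ler_expR lerD2l lerN2 ler_pM2r ?expR_gt0// ltW.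
have dd p u : p \in `](q / 2), (q * 2)[%R -> setT u -> derivable (f ^~ u) p 1.
  by move=> _ _; have := dW p u => h; exact: ex_derive.
have D := derivable_under_integral measurableT Iq intf dd G0 iG dG.
have E := differentiation_under_integral measurableT Iq intf dd G0 iG dG.
apply: DeriveDef; first exact: D.
rewrite -derive1E E.
transitivity (\int[mu]_(u in setT) (-1 * gig (nu - 1) 1 q u)).
  by apply: eq_Rintegral => u _; rewrite d1 mulN1r.
by rewrite RintegralZl ?mulN1r//; exact/integrable_gig/okq.
Qed.

Lemma cosh_ge0 u : 0 <= cosh u.
Proof. by rewrite /cosh divr_ge0// addr_ge0// expR_ge0. Qed.

Lemma cosh_gt0 u : 0 < cosh u.
Proof. by rewrite /cosh divr_gt0// addr_gt0// expR_gt0. Qed.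

Lemma coshN u : cosh (- u) = cosh u.
Proof. by rewrite /cosh opprK addrC. Qed.

Lemma cosh_norm u : cosh `|u| = cosh u.
Proof. by case: (ger0P u) => // _; rewrite coshN. Qed.

Lemma cosh_le u v : `|u| <= `|v| -> cosh u <= cosh v.
Proof.
rewrite -(cosh_norm u) -(cosh_norm v); have := normr_ge0 u.
move: (`|u|) (`|v|) => a b a0 ab; rewrite /cosh ler_pM2r ?invr_gt0//.
rewrite -subr_ge0.
have -> : expR b + expR (- b) - (expR a + expR (- a)) =
   (expR b - expR a) * (1 - expR (- a) * expR (- b)).
  rewrite mulrBl !mulrBr !mulr1.
  have -> : expR b * (expR (- a) * expR (- b)) = expR (- a).
    by rewrite -!expRD; congr expR; ring.
  have -> : expR a * (expR (- a) * expR (- b)) = expR (- b).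
    by rewrite -!expRD; congr expR; ring.
  by ring.
rewrite mulr_ge0// subr_ge0 ?ler_expR//.
by rewrite -expRD -expR0 ler_expR; lra.
Qed.

Lemma cosh_le_sqr u v : u ^+ 2 <= v ^+ 2 -> cosh u <= cosh v.
Proof. by move=> h; apply: cosh_le; rewrite -ler_sqr ?nnegrE// !real_normK ?num_real. Qed.

Lemma coshM u v : cosh u * cosh v = (cosh (u + v) + cosh (u - v)) / 2.
Proof.
by rewrite /cosh !opprD !expRD opprK; field.
Qed.

(** The quotient cosh ((nu-1) u) / cosh (nu u) is nonincreasing in |u| when
nu >= 1/2: the product formula for cosh reduces this to u^2 <= v^2. *)
Lemma cosh_ratio_le nu u v : 1 / 2 <= nu -> `|u| <= `|v| ->
  cosh ((nu - 1) * v) * cosh (nu * u) <= cosh ((nu - 1) * u) * cosh (nu * v).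
Proof.
move=> nu2 uv.
have uv2 : u ^+ 2 <= v ^+ 2 by rewrite -(real_normK (num_real u)) -(real_normK (num_real v)) ler_sqr ?nnegrE.
have h : 0 <= (2 * nu - 1) * (v ^+ 2 - u ^+ 2) by rewrite mulr_ge0//; lra.
rewrite !coshM ler_pM2r ?invr_gt0//; apply: lerD; apply: cosh_le_sqr; nra.
Qed.

(** The even part of gig with A = B = y, in closed form. *)
Definition bessel_kern nu y u : R := expR (- (2 * y * cosh u)) * cosh (nu * u).

Lemma bessel_kernE nu y u : bessel_kern nu y u = (gig nu y y u + gig (- nu) y y u) / 2.
Proof.
rewrite /bessel_kern /gig /cosh mulNr.
have -> : expR (nu * u - y * expR u - y * expR (- u)) =
   expR (- (2 * y * ((expR u + expR (- u)) / 2))) * expR (nu * u).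
  by rewrite -expRD; congr expR; field.
have -> : expR (- (nu * u) - y * expR u - y * expR (- u)) =
   expR (- (2 * y * ((expR u + expR (- u)) / 2))) * expR (- (nu * u)).
  by rewrite -expRD; congr expR; field.
by field.
Qed.

Lemma bessel_kern_ge0 nu y u : 0 <= bessel_kern nu y u.
Proof. by rewrite mulr_ge0 ?expR_ge0 ?cosh_ge0. Qed.

Let okN nu y : 0 < y -> gig_ok nu y y.
Proof. by move=> y0; split => //; [exact: ltW|right]. Qed.

Lemma integrable_bessel_kern nu y : 0 < y -> mu.-integrable setT (EFin \o bessel_kern nu y).
Proof.
move=> y0.
have i1 := integrable_gig (okN nu y0); have i2 := integrable_gig (okN (- nu) y0).
have := integrableZl measurableT 2^-1 (integrableD measurableT i1 i2).
by apply: eq_integrable => // u _; rewrite /= bessel_kernE mulrC.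
Qed.

Lemma gig_massN nu y : 0 < y -> gig_mass (- nu) y y = gig_mass nu y y.
Proof.
move=> y0; have y2 : 0 < y * 2 by rewrite mulr_gt0.
have h m := gig_mass_besselK m y2; rewrite (mulfK _) in h; last by [].
rewrite !h /besselK.
under eq_Rintegral do rewrite mulNr coshN.
by [].
Qed.

Lemma int_bessel_kern nu y : 0 < y -> \int[mu]_(u in setT) bessel_kern nu y u = gig_mass nu y y.
Proof.
move=> y0.
have i1 := integrable_gig (okN nu y0); have i2 := integrable_gig (okN (- nu) y0).
have i12 : mu.-integrable setT (EFin \o (fun u => gig nu y y u + gig (- nu) y y u)).
  by have := integrableD measurableT i1 i2; apply: eq_integrable.
under eq_Rintegral do rewrite bessel_kernE mulrC.
rewrite RintegralZl// RintegralD// -!/(gig_mass _ _ _) gig_massN//.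
by field.
Qed.

(** The quotient K_(nu-1) / K_nu is nondecreasing for nu >= 1/2. Under the density
P, both rho and the factor w which changes y into y' are nonincreasing in |u|,
hence positively correlated (Chebyshev's association inequality). *)
Lemma bessel_ratio_le nu y y' : 1 / 2 <= nu -> 0 < y -> y <= y' ->
  gig_mass (nu - 1) y y * gig_mass nu y' y' <= gig_mass (nu - 1) y' y' * gig_mass nu y y.
Proof.
move=> nu2 y0 yy'; have y'0 : 0 < y' by exact: lt_le_trans yy'.
pose P := bessel_kern nu y.
pose rho u := cosh ((nu - 1) * u) / cosh (nu * u).
pose w u := expR (- (2 * (y' - y) * cosh u)).
have e1 u : bessel_kern nu y' u = P u * w u.
  by rewrite /P /bessel_kern /w [RHS]mulrAC -expRD; congr (expR _ * _); ring.
have e2 u : bessel_kern (nu - 1) y u = P u * rho u.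
  have c0 : cosh (nu * u) != 0 by rewrite gt_eqF ?cosh_gt0.
  by rewrite /P /bessel_kern /rho; field.
have e3 u : bessel_kern (nu - 1) y' u = P u * rho u * w u.
  by rewrite -e2 /bessel_kern /w [RHS]mulrAC -expRD; congr (expR _ * _); ring.
have N0 : 0 < gig_mass nu y y by apply: gig_mass_gt0; exact: okN.
pose c := gig_mass (nu - 1) y y / gig_mass nu y y.
pose S := [set s | s = 0 \/ exists2 v, rho v <= c & s = w v].
(* w0 separates the values of w where rho <= c from those where rho > c, so that
   (rho - c) (w - w0) >= 0 everywhere; 0 belongs to S to make S nonempty *)
pose w0 := sup S.
have w1 u : 0 <= w u <= 1.
  rewrite expR_ge0/= -expR0 ler_expR oppr_le0 !mulr_ge0 ?cosh_ge0// subr_ge0//.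
have Sub : has_ubound S.
  by exists 1 => s [->|[v _ ->]] //; have /andP[] := w1 v.
have cross u : 0 <= (rho u - c) * (w u - w0).
  case: (leP (rho u) c) => ru.
    rewrite mulr_le0 ?subr_le0//; apply: ub_le_sup => //; right; exists u => //.
  rewrite mulr_ge0 ?subr_ge0 ?(ltW ru)//; apply: ge_sup; first by exists 0; left.
  move=> s [->|[v rv ->]]; first by have /andP[] := w1 u.
  have uv : `|u| <= `|v|.
    rewrite leNgt; apply/negP => /ltW vu.
    have := cosh_ratio_le nu2 vu.
    rewrite -ler_pdivrMr ?cosh_gt0// mulrAC -ler_pdivlMr ?cosh_gt0// -!/(rho _) => h.
    by have := lt_le_trans ru (le_trans h rv); rewrite ltxx.
  rewrite ler_expR lerN2 ler_wpM2l ?cosh_le// mulr_ge0// subr_ge0//.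
have i1 := integrable_bessel_kern nu y0; have i2 := integrable_bessel_kern nu y'0.
have i3 := integrable_bessel_kern (nu - 1) y0; have i4 := integrable_bessel_kern (nu - 1) y'0.
have J (k1 k2 k3 k4 : R) : \int[mu]_(u in setT) (k4 * bessel_kern (nu - 1) y' u + k2 * bessel_kern nu y' u
    + (k3 * bessel_kern (nu - 1) y u + k1 * bessel_kern nu y u)) =
    k4 * gig_mass (nu - 1) y' y' + k2 * gig_mass nu y' y' + (k3 * gig_mass (nu - 1) y y + k1 * gig_mass nu y y).
  have z k m p : 0 < p -> mu.-integrable setT (EFin \o (fun u => k * bessel_kern m p u)).
    move=> p0; have := integrableZl measurableT k (integrable_bessel_kern m p0).
    exact: eq_integrable.
  have zz k m p k' m' p' : 0 < p -> 0 < p' -> mu.-integrable setT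
      (EFin \o (fun u => k * bessel_kern m p u + k' * bessel_kern m' p' u)).
    move=> p0 p'0; have := integrableD measurableT (z k m p p0) (z k' m' p' p'0).
    exact: eq_integrable.
  rewrite RintegralD//; [|exact: zz|exact: zz].
  by rewrite !RintegralD//; rewrite ?RintegralZl ?int_bessel_kern//; exact: z.
have : 0 <= \int[mu]_(u in setT) (P u * ((rho u - c) * (w u - w0))).
  by apply: Rintegral_ge0 => u _; rewrite mulr_ge0// bessel_kern_ge0.
have -> : (fun u => P u * ((rho u - c) * (w u - w0))) =
  (fun u => 1 * bessel_kern (nu - 1) y' u + (- c) * bessel_kern nu y' u
    + ((- w0) * bessel_kern (nu - 1) y u + (c * w0) * bessel_kern nu y u)).
  by apply/funext => u; rewrite e1 e2 e3 -/(P u); ring.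
rewrite J !mul1r.
have -> : - w0 * gig_mass (nu - 1) y y + c * w0 * gig_mass nu y y = 0.
  rewrite /c; move: (gig_mass nu y y) (gig_mass (nu - 1) y y) N0 => p q p0.
  by field; rewrite gt_eqF.
rewrite addr0 mulNr subr_ge0 /c => h.
move: h; rewrite mulrAC ler_pdivrMr//.
Qed.

(** K_nu is increasing in |nu|, and |nu| <= |nu - 1| for nu <= 1/2. *)
Lemma bessel_le nu y : 0 < nu -> nu <= 1 / 2 -> 0 < y -> gig_mass nu y y <= gig_mass (nu - 1) y y.
Proof.
move=> nu0 nu2 y0; rewrite -!int_bessel_kern//.
apply: le_Rintegral => //; [exact: integrable_bessel_kern|exact: integrable_bessel_kern|].
move=> u _; rewrite /bessel_kern ler_wpM2l ?expR_ge0//; apply: cosh_le; rewrite !normrM.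
rewrite ler_wpM2r// ger0_norm ?(ltW nu0)// ler0_norm; lra.
Qed.

Lemma cvg_gig_mass0 nu : 0 < nu ->
  (fun n : nat => gig_mass nu 1 (n.+1%:R^-1)) @ \oo --> gig_mass nu 1 0.
Proof.
move=> nu0.
have ok0 : gig_ok nu 1 0 by split => //; left.
have okn (n : nat) : gig_ok nu 1 (n.+1%:R^-1 : R) by split => //; left.
have cvgW u : (gig nu 1 (n.+1%:R^-1) u)%:E @[n --> \oo] --> (gig nu 1 0 u)%:E.
  apply: cvg_EFin; first exact: nearW.
  have c1 : (fun n : nat => nu * u - 1 * expR u - n.+1%:R^-1 * expR (- u)) @ \oo -->
      nu * u - 1 * expR u - 0 * expR (- u).
    apply: cvgB; first exact: cvg_cst.
    by apply: cvgM; [exact: cvg_harmonic|exact: cvg_cst].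
  by apply: (cvg_comp _ expR c1); exact: continuous_expR.
suff D : (\int[mu]_u (gig nu 1 (n.+1%:R^-1) u)%:E)%E @[n --> \oo] -->
    (\int[mu]_u (gig nu 1 0 u)%:E)%E.
  by have := D; rewrite gig_mass_E// => /fine_cvg.
apply: (@dominated_cvg _ _ R mu setT measurableT
  (fun n u => (gig nu 1 (n.+1%:R^-1) u)%:E) (EFin \o gig nu 1 0) (EFin \o gig nu 1 0)).
- by move=> n; exact: gig_measurable.
- by move=> u _; exact: cvgW.
- by move=> u _.
- exact: integrable_gig.
- move=> n u _; rewrite /= lee_fin ger0_norm ?gig_ge0// ler_expR.
  by rewrite lerD2l lerN2 ler_wpM2r ?expR_ge0.
Qed.

Lemma gig_mass_le nu q q' : 0 < nu -> 0 <= q -> q <= q' -> gig_mass nu 1 q' <= gig_mass nu 1 q.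
Proof.
move=> nu0 q0 qq'; apply: le_Rintegral => //.
- by apply: integrable_gig; split => //; [exact: le_trans qq'|left].
- by apply: integrable_gig; split => //; left.
- by move=> u _; rewrite ler_expR lerD2l lerN2 ler_wpM2r// expR_ge0.
Qed.

Lemma gig_mass_lt nu q : 0 < nu -> 0 < q -> gig_mass nu 1 q < gig_mass nu 1 0.
Proof.
move=> nu0 q0; have q2 : 0 < q / 2 by rewrite divr_gt0.
apply: lt_le_trans (gig_mass_le nu0 (lexx 0) (ltW q2)).
have dI p : p \in `](q / 2), q[%R -> is_derive p 1 (gig_mass nu 1) (- gig_mass (nu - 1) 1 p).
  by rewrite in_itv/= => /andP[h _]; apply: is_derive_gig_mass; exact: lt_trans h.
have cI : {within `[q / 2, q], continuous (gig_mass nu 1)}.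
  apply: derivable_within_continuous => p; rewrite in_itv/= => /andP[h _].
  by have := is_derive_gig_mass nu (lt_le_trans q2 h) => D; exact: ex_derive.
have qq : q / 2 < q by lra.
have [c] := MVT qq dI cI; rewrite in_itv/= => /andP[qc _] E.
rewrite -subr_lt0 E mulNr oppr_lt0; apply: mulr_gt0; last by rewrite subr_gt0.
have c0 := lt_trans q2 qc.
by apply: gig_mass_gt0; split; [exact: ltr01|exact: ltW|right].
Qed.

(** Symmetric form (A = B) of the integral that represents the Matern function. *)
Lemma gig_mass_sqr nu x : 0 < x ->
  gig_mass nu 1 (x ^+ 2 / 4) = expR (nu * ln (x / 2)) * gig_mass nu (x / 2) (x / 2).
Proof.
move=> x0; have x2 : 0 < x / 2 by rewrite divr_gt0.
have xx : 0 < x ^+ 2 / 4 by rewrite divr_gt0// exprn_gt0.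
rewrite (gig_mass_shift (ln (x / 2))); last by split => //; [exact: ltW|right].
have xE : expR (ln (x / 2)) = x / 2 by rewrite lnK ?posrE.
rewrite mul1r expRN xE.
by have -> : x ^+ 2 / 4 / (x / 2) = x / 2 by field; rewrite gt_eqF.
Qed.

Lemma gig_mass_sqr_pred nu x : 0 < x ->
  x / 2 * gig_mass (nu - 1) 1 (x ^+ 2 / 4) = expR (nu * ln (x / 2)) * gig_mass (nu - 1) (x / 2) (x / 2).
Proof.
move=> x0; have x2 : 0 < x / 2 by rewrite divr_gt0.
rewrite gig_mass_sqr// mulrA; congr *%R.
by rewrite -{1}[x / 2]lnK ?posrE// -expRD; congr expR; ring.
Qed.

Definition nu_max nu := Num.max nu (1 / 2).

(** The negative logarithmic derivative of x^m K_m(x) is K_(m-1)(x) / K_m(x); it is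
compared for the order m = nu_max nu at x and the order nu at y >= x. For
nu >= 1/2 this is the monotonicity of the Bessel quotient; for nu < 1/2 the
quotient of order m = 1/2 is constant, equal to 1, and the one of order nu is
at least 1. *)
Lemma log_deriv_le nu x y : 0 < nu -> 0 < x -> x <= y ->
  (x / 2 * gig_mass (nu_max nu - 1) 1 (x ^+ 2 / 4)) * gig_mass nu 1 (y ^+ 2 / 4) <=
  (y / 2 * gig_mass (nu - 1) 1 (y ^+ 2 / 4)) * gig_mass (nu_max nu) 1 (x ^+ 2 / 4).
Proof.
move=> nu0 x0 xy; have y0 := lt_le_trans x0 xy.
set m := nu_max nu.
have x2 : 0 < x / 2 by rewrite divr_gt0.
have y2 : 0 < y / 2 by rewrite divr_gt0.
have xy2 : x / 2 <= y / 2 by rewrite ler_pM2r ?invr_gt0.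
have key : gig_mass (m - 1) (x / 2) (x / 2) * gig_mass nu (y / 2) (y / 2) <=
    gig_mass (nu - 1) (y / 2) (y / 2) * gig_mass m (x / 2) (x / 2).
  rewrite /m /nu_max; case: (leP (1 / 2) nu) => h; first exact: bessel_ratio_le.
  have -> : 1 / 2 - 1 = - (1 / 2) :> R by field.
  rewrite (gig_massN _ x2) mulrC; apply: ler_wpM2r; first exact/ltW/gig_mass_gt0/okN.
  exact: bessel_le nu0 (ltW h) y2.
rewrite (gig_mass_sqr_pred m x0) (gig_mass_sqr_pred nu y0) (gig_mass_sqr m x0) (gig_mass_sqr nu y0).
move: key (expR_gt0 (m * ln (x / 2))) (expR_gt0 (nu * ln (y / 2))).
move: (gig_mass (m - 1) _ _) (gig_mass nu _ _) (gig_mass (nu - 1) _ _) (gig_mass m _ _) (expR _) (expR _).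
move=> p q r v e1 e2 key e10 e20.
by rewrite mulrACA [leRHS]mulrACA [e2 * e1]mulrC ler_pM2l// mulr_gt0.
Qed.

Lemma is_derive_gig_mass_sqr nu a b : 0 < a + b ->
  is_derive b 1 (fun b => gig_mass nu 1 ((a + b) ^+ 2 / 4))
    (- ((a + b) / 2 * gig_mass (nu - 1) 1 ((a + b) ^+ 2 / 4))).
Proof.
move=> ab0.
have q0 : 0 < (a + b) ^+ 2 / 4 by rewrite divr_gt0// exprn_gt0.
have d1 : is_derive b 1 (fun b => (a + b) ^+ 2 / 4) ((a + b) / 2).
  have : is_derive b 1 (fun b => (a + b) * (a + b) * 4^-1) ((a + b) / 2).
    by apply: is_derive_eq; rewrite /GRing.scale/=; field.
  by [].
have := @is_derive1_comp R (gig_mass nu 1) (fun b => (a + b) ^+ 2 / 4) b _ _ (is_derive_gig_mass nu q0) d1.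
by rewrite mulNr mulrC.
Qed.

Lemma quotient_deriv_le0 (f g df dg : R) : 0 < g -> dg * f <= df * g ->
  f * (- g ^- 2 * (- dg)) + g^-1 * (- df) <= 0.
Proof.
move=> g0 h.
have -> : f * (- g ^- 2 * (- dg)) + g^-1 * (- df) = (dg * f - df * g) / g ^+ 2.
  by field; rewrite gt_eqF.
by rewrite pmulr_lle0 ?invr_gt0 ?exprn_gt0// subr_le0.
Qed.

(** Submultiplicativity before normalization. By log_deriv_le, the quotient of
M_nu(a + y) by M_m(y), m = nu_max nu, is nonincreasing in y > 0; it is
compared at y = b and as y tends to 0. *)
Lemma gig_mass_submul nu a b : 0 < nu -> 0 < a -> 0 < b ->
  gig_mass nu 1 ((a + b) ^+ 2 / 4) * gig_mass (nu_max nu) 1 0 <=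
  gig_mass nu 1 (a ^+ 2 / 4) * gig_mass (nu_max nu) 1 (b ^+ 2 / 4).
Proof.
move=> nu0 a0 b0; set m := nu_max nu.
have m0 : 0 < m by rewrite /m /nu_max lt_max nu0.
pose F y := gig_mass nu 1 ((a + y) ^+ 2 / 4); pose G y := gig_mass m 1 ((0 + y) ^+ 2 / 4).
have G0 y : 0 < y -> 0 < G y.
  move=> y0; apply: gig_mass_gt0; split => //; last by left.
  by rewrite divr_ge0// sqr_ge0.
have dF y : 0 < y -> is_derive y 1 F (- ((a + y) / 2 * gig_mass (nu - 1) 1 ((a + y) ^+ 2 / 4))).
  by move=> y0; apply: is_derive_gig_mass_sqr; rewrite addr_gt0.
have dG y : 0 < y -> is_derive y 1 G (- ((0 + y) / 2 * gig_mass (m - 1) 1 ((0 + y) ^+ 2 / 4))).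
  by move=> y0; apply: is_derive_gig_mass_sqr; rewrite add0r.
pose h y := F y * (G y)^-1.
have dh y : 0 < y -> is_derive y 1 h
   (F y *: (- (G y) ^- 2 *: (- ((0 + y) / 2 * gig_mass (m - 1) 1 ((0 + y) ^+ 2 / 4))))
     + (G y)^-1 *: (- ((a + y) / 2 * gig_mass (nu - 1) 1 ((a + y) ^+ 2 / 4)))).
  move=> y0; apply: is_deriveM; first exact: dF.
  by apply: is_deriveV; [rewrite gt_eqF ?G0|exact: dG].
have hmono y : 0 < y -> y <= b -> h b <= h y.
  move=> y0 yb.
  apply: (@ler0_derive1_nincr _ h y b) => //.
  - move=> z; rewrite in_itv/= => /andP[yz _].
    by have := dh z (lt_trans y0 yz) => D; exact: ex_derive.
  - move=> z; rewrite in_itv/= => /andP[yz _]; have z0 := lt_trans y0 yz.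
    rewrite derive1E; have := dh z z0 => D; rewrite derive_val /GRing.scale/=.
    have az : 0 < a + z by rewrite addr_gt0.
    have zaz : z <= a + z by rewrite lerDr ltW.
    have := log_deriv_le nu0 z0 zaz; rewrite -/m.
    move=> H; apply: quotient_deriv_le0; first exact: G0.
    by rewrite /G add0r.
  - apply: derivable_within_continuous => z; rewrite in_itv/= => /andP[yz _].
    by have := dh z (lt_le_trans y0 yz) => D; exact: ex_derive.
have key y : 0 < y -> y <= b -> F b * G y <= gig_mass nu 1 (a ^+ 2 / 4) * G b.
  move=> y0 yb; have := hmono y y0 yb; have := G0 y y0; have := G0 b b0.
  have : F y <= gig_mass nu 1 (a ^+ 2 / 4).
    apply: gig_mass_le; rewrite ?divr_ge0 ?sqr_ge0//.
    rewrite ler_pM2r ?invr_gt0// lerXn2r ?nnegrE ?addr_ge0 ?(ltW a0) ?(ltW y0)//.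
    by rewrite lerDl ltW.
  rewrite /h; move: (F b) (F y) (G b) (G y) (gig_mass nu 1 _) => p q r v w central_weight r0 v0.
  rewrite ler_pdivrMr// mulrAC ler_pdivlMr// => H.
  by apply: le_trans H _; rewrite ler_wpM2r// ltW.
have c1 : (fun n : nat => F b * gig_mass m 1 (n.+1%:R^-1)) @ \oo --> F b * gig_mass m 1 0.
  by apply: cvgM; [exact: cvg_cst|exact: cvg_gig_mass0].
rewrite -(cvg_lim _ c1)//; apply: limr_le; first exact: cvgP c1.
have cb : (fun n : nat => (n.+1%:R^-1 : R)) @ \oo --> 0 by exact: cvg_harmonic.
have bs : 0 < b ^+ 2 / 4 by rewrite divr_gt0// exprn_gt0.
have : \forall n \near \oo, (n.+1%:R^-1 : R) < b ^+ 2 / 4 by apply: (cvgr_lt 0).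
apply: filterS => n hn.
(* the point y with y^2/4 = 1/(n+1) *)
pose y := 2 * Num.sqrt (n.+1%:R^-1 : R).
have y0 : 0 < y by rewrite mulr_gt0// sqrtr_gt0 invr_gt0.
have yE : n.+1%:R^-1 = (0 + y) ^+ 2 / 4.
  by rewrite add0r /y exprMn sqr_sqrtr ?invr_ge0//; field; rewrite nat1r pnatr_eq0.
have yb : y <= b.
  have : y ^+ 2 <= b ^+ 2.
    have := ltW hn; rewrite yE add0r ler_pM2r ?invr_gt0//.
  by rewrite ler_sqr ?nnegrE ?(ltW y0) ?(ltW b0).
by have := key y y0 yb; rewrite /G -yE add0r.
Qed.

Lemma matern_ge0 nu x : 0 < nu -> 0 <= x -> 0 <= matern nu x.
Proof.
move=> nu0 x0; rewrite matern_gig_mass// divr_ge0 ?(ltW (Gamma_gt0 nu0))//.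
by apply/ltW/gig_mass_gt0; split => //; [rewrite divr_ge0// sqr_ge0|left].
Qed.

Lemma matern_le nu x y : 0 < nu -> 0 <= x -> x <= y -> matern nu y <= matern nu x.
Proof.
move=> nu0 x0 xy; have y0 := le_trans x0 xy.
rewrite (matern_gig_mass nu0 y0) (matern_gig_mass nu0 x0) ler_pM2r; last by rewrite invr_gt0 Gamma_gt0.
apply: gig_mass_le; rewrite ?divr_ge0 ?sqr_ge0//.
by rewrite ler_pM2r ?invr_gt0// ler_sqr.
Qed.

Lemma matern_lt1 nu x : 0 < nu -> 0 < x -> matern nu x < 1.
Proof.
move=> nu0 x0; rewrite matern_gig_mass ?ltW// ltr_pdivrMr ?Gamma_gt0// mul1r Gamma_gig_mass gig_mass_lt//.
by rewrite divr_gt0// exprn_gt0.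
Qed.

(** The multiplicative decay of the Matern function. For nu < 1/2 the function M_nu
itself is not submultiplicative, whence the order nu_max nu. *)
Lemma matern_submul nu a b : 0 < nu -> 0 < a -> 0 < b ->
  matern nu (a + b) <= matern nu a * matern (nu_max nu) b.
Proof.
move=> nu0 a0 b0; have m0 : 0 < nu_max nu by rewrite /nu_max lt_max nu0.
rewrite !matern_gig_mass ?addr_ge0 ?(ltW a0) ?(ltW b0)//.
have := gig_mass_submul nu0 a0 b0; rewrite -Gamma_gig_mass => h.
have G1 := Gamma_gt0 nu0; have G2 := Gamma_gt0 m0.
move: h G1 G2; move: (gig_mass nu 1 ((a + b) ^+ 2 / 4)) (gig_mass nu 1 (a ^+ 2 / 4)).
move: (gig_mass _ 1 (b ^+ 2 / 4)) (Gamma nu) (Gamma _) => r g1 g2 p q h g10 g20.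
rewrite mulf_div ler_pdivlMr ?mulr_gt0//.
by rewrite mulrA divfK ?gt_eqF.
Qed.

End matern_theory.

(** * Counting lattice points by height *)
Section counting.
Local Close Scope classical_set_scope.

Definition height d n (p : {ffun 'I_d -> 'I_n}) : nat := \max_(i < d) p i.

Lemma height_leP d n (p : {ffun 'I_d -> 'I_n}) k :
  reflect (forall i, (p i <= k)%N) (height p <= k)%N.
Proof. by apply: (iffP (bigmax_leqP _ _ _)) => h i; [exact: h|move=> _; exact: h]. Qed.

Lemma card_height_le d n k : (k < n)%N ->
  #|[set p : {ffun 'I_d -> 'I_n} | (height p <= k)%N]| = (k.+1 ^ d)%N.
Proof.
move=> kn; pose A := [set i : 'I_n | (i <= k)%N].
have cA : #|A| = k.+1.
  have -> : A = [set widen_ord kn i | i : 'I_k.+1].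
    apply/setP => i; rewrite inE; apply/idP/imsetP => [ik|[j _ ->]].
      by exists (Ordinal (ik : (i < k.+1)%N)) => //; exact: val_inj.
    by rewrite /= -ltnS.
  by rewrite card_imset ?card_ord// => i j [] h; exact: val_inj.
rewrite -[d in RHS]card_ord -cA -card_ffun_on.
apply: eq_card => p; rewrite inE; apply/height_leP/ffun_onP => h i.
  by rewrite inE.
by have := h i; rewrite inE.
Qed.

Lemma card_height d n k : (0 < k < n)%N ->
  #|[pred p : {ffun 'I_d -> 'I_n} | height p == k]| = (k.+1 ^ d - k ^ d)%N.
Proof.
case: k => // k /andP[_ kn].
rewrite -(@card_height_le d n k.+1)// -(@card_height_le d n k) ?(ltnW kn)//.
have sub : [set p : {ffun 'I_d -> 'I_n} | (height p <= k)%N] \subset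
    [set p : {ffun 'I_d -> 'I_n} | (height p <= k.+1)%N].
  by apply/fintype.subsetP => p; rewrite !inE => /leqW.
rewrite -[X in (_ - X)%N](eq_card (A := mem ([set p : {ffun 'I_d -> 'I_n} | (height p <= k.+1)%N] :&:
  [set p : {ffun 'I_d -> 'I_n} | (height p <= k)%N]))); last first.
  by move=> p; rewrite !inE; case: (leqP (height p) k) => h; rewrite ?andbF// andbT leqW.
rewrite -cardsD; apply: eq_card => p; rewrite !inE eqn_leq ltnNge.
by rewrite andbC.
Qed.

Section shell_sums.
Variables (R : realFieldType) (f : R).
Hypotheses (f0 : 0 <= f) (f1 : f < 1).

(** Pascal's rule; it yields the binomial series by induction on d. *)
Lemma bin_geometric_rec d n :
  (1 - f) * (\sum_(q < n) 'C(q + d.+1, d.+1)%:R * f ^+ q) + 'C(n + d, d.+1)%:R * f ^+ n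
  = \sum_(q < n) 'C(q + d, d)%:R * f ^+ q.
Proof.
elim: n => [|n IH]; first by rewrite !big_ord0 mulr0 add0r bin_small ?mul0r.
rewrite big_ord_recr [in RHS]big_ord_recr/= -IH addnS addSn binS natrD exprS.
ring.
Qed.

(** Partial sums of the series of (1 - f)^-(d+1). *)
Lemma bin_geometric_le d n :
  \sum_(q < n) 'C(q + d, d)%:R * f ^+ q <= (1 - f) ^- d.+1.
Proof.
have p : 0 < 1 - f by rewrite subr_gt0.
elim: d => [|d IH].
  rewrite expr1 -[leRHS]mul1r ler_pdivlMr//.
  under eq_bigr do rewrite addn0 bin0 mul1r.
  rewrite mulrC -opprB mulNr -subrX1 opprB gerBl exprn_ge0//.
have := bin_geometric_rec d n => E.
rewrite exprS invfM ler_pdivlMl//.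
by apply: le_trans IH; rewrite -E lerDl mulr_ge0// exprn_ge0.
Qed.

(** Equality holds at a = 1; the induction on d multiplies by a + 1. *)
Lemma succ_expn_sub_le d a : (0 < a)%N -> (a.+1 ^ d.+1 - a ^ d.+1 <= (2 ^ d.+1 - 1) * a ^ d)%N.
Proof.
move=> a0; rewrite leq_subLR; elim: d => [|d IH].
  by rewrite !expn1 expn0 muln1; lia.
have h : (a.+1 ^ d.+2 <= a.+1 * (a ^ d.+1 + (2 ^ d.+1 - 1) * a ^ d))%N.
  by rewrite expnS leq_mul2l IH orbT.
apply: leq_trans h _.
have e1 : (a ^ d.+2 = a * a ^ d.+1)%N by rewrite expnS.
have e2 : (a ^ d.+1 = a * a ^ d)%N by rewrite expnS.
have e3 : (2 ^ d.+2 = 2 * 2 ^ d.+1)%N by rewrite expnS.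
have t0 : (0 < 2 ^ d.+1)%N by rewrite expn_gt0.
rewrite e1 e3; move: (2 ^ d.+1)%N (a ^ d)%N (a ^ d.+1)%N e2 t0 => t y x -> t0.
have [t' ->] : exists t', t = t'.+1 by exists t.-1; rewrite prednK.
have -> : (t'.+1 - 1 = t')%N by lia.
have -> : (2 * t'.+1 - 1 = 2 * t' + 1)%N by lia.
have : (t' * y <= a * (t' * y))%N by rewrite leq_pmull.
nia.
Qed.

(** The d factors of d! C(q+d, d) = (q+1) ... (q+d) are all at least q + 1. *)
Lemma expn_le_bin d q : (q.+1 ^ d <= d`! * 'C(q + d, d))%N.
Proof.
rewrite mulnC bin_ffact ffact_prod -[d in (_ ^ d)%N]card_ord -prod_nat_const.
by apply: leq_prod => i _; have := ltn_ord i; lia.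
Qed.

Lemma shell_coef_le d q :
  (q.+2 ^ d.+1 - q.+1 ^ d.+1 <= (2 ^ d.+1 - 1) * (d.+1)`! * 'C(q + d, d))%N.
Proof.
apply: leq_trans (succ_expn_sub_le d (ltn0Sn q)) _.
rewrite -mulnA leq_mul2l; apply/orP; right.
apply: leq_trans (expn_le_bin d q) _; rewrite leq_mul2r; apply/orP; right.
by rewrite factS leq_pmull.
Qed.

(** The heights 2q+2 and 2q+3 carry the same power of f, and their shells add up
to (2q+4)^d - (2q+2)^d, a shell of step one scaled by 2^d. *)
Lemma paired_shells d m :
  \sum_(k < m.*2.+1) (k.+2 ^ d - k.+1 ^ d)%:R * f ^+ (k.+1)./2 =
  (2 ^ d - 1)%:R + \sum_(q < m) (2 ^ d * (q.+2 ^ d - q.+1 ^ d))%:R * f ^+ q.+1 :> R.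
Proof.
elim: m => [|m IH]; first by rewrite big_ord_recl !big_ord0/= exp1n mulr1.
rewrite doubleS big_ord_recr big_ord_recr/= IH [in RHS]big_ord_recr/= -!addrA.
congr (_ + (_ + _)); rewrite uphalf_double doubleK -mulrDl -natrD; congr (_%:R * _).
have mono a b : (a <= b)%N -> (a ^ d <= b ^ d)%N.
  by move=> ab; case: d {IH} => // d; rewrite leq_exp2r.
rewrite addnC addnBA ?mono// mulnBr -!expnMn.
have -> : (2 * m.+2 = m.*2.+4)%N by rewrite -muln2; lia.
have -> : (2 * m.+1 = m.*2.+2)%N by rewrite -muln2; lia.
by rewrite subnK ?mono.
Qed.

(** Summation over the shells of height k. The shells of height at least 2 are
grouped in pairs and compared with the binomial series of (1 - f)^-d, which
produces the constant of the theorem. *)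
Lemma shell_sum_le d n : (0 < d)%N ->
  \sum_(p : {ffun 'I_d -> 'I_n} | height p != 0%N) f ^+ (height p)./2 <=
  (2 ^+ d - 1) * (1 + 2 ^+ d * d`!%:R * f / (1 - f) ^+ d).
Proof.
case: d => // d _; set d1 := d.+1.
have E : \sum_(p : {ffun 'I_d1 -> 'I_n} | height p != 0%N) f ^+ (height p)./2 =
   \sum_(k < n | (0 < k)%N) (k.+1 ^ d1 - k ^ d1)%:R * f ^+ k./2.
  case: n => [|n].
    rewrite big_ord0 big1// => p.
    by case: (p ord0).
  have hb (p : {ffun 'I_d1 -> 'I_n.+1}) : (height p < n.+1)%N.
    by rewrite ltnS; apply/height_leP => i; rewrite -ltnS.
  rewrite (partition_big (fun p => Ordinal (hb p)) (fun k : 'I_n.+1 => (0 < k)%N)); last first.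
    by move=> p; rewrite lt0n.
  apply: eq_bigr => k k0.
  rewrite -(@card_height d1 n.+1 k) ?k0 ?ltn_ord//.
  rewrite mulr_natl -sumr_const; apply: eq_big => [p|p].
    rewrite inE; apply/andP/eqP => [[_ /eqP <-]//|e].
    by split; [rewrite e -lt0n|apply/eqP/val_inj].
  by move=> /andP[_ /eqP <-].
rewrite {}E.
apply: le_trans (_ : \sum_(k < n.*2.+1) (k.+2 ^ d1 - k.+1 ^ d1)%:R * f ^+ (k.+1)./2 <= _).
  apply: le_trans (_ : \sum_(k < n) (k.+2 ^ d1 - k.+1 ^ d1)%:R * f ^+ (k.+1)./2 <= _).
    case: n => [|n]; first by rewrite !big_ord0.
    rewrite big_mkcond big_ord_recl/= add0r big_ord_recr/=.
    by rewrite lerDl mulr_ge0// exprn_ge0.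
  rewrite -2!(big_mkord xpredT (fun k => (k.+2 ^ d1 - k.+1 ^ d1)%:R * f ^+ (k.+1)./2)).
  have nn : (n <= n.*2.+1)%N by lia.
  rewrite [leRHS](big_cat_nat _ nn)//=.
  by rewrite lerDl sumr_ge0// => k _; rewrite mulr_ge0// exprn_ge0.
rewrite paired_shells.
have e2 : (2 ^ d1 - 1)%:R = 2 ^+ d1 - 1 :> R.
  by rewrite natrB ?expn_gt0// natrX.
rewrite e2 mulrDr mulr1 lerD2l.
apply: le_trans (_ : \sum_(q < n) ((2 ^ d1 - 1) * (2 ^ d1 * d1`!))%:R * f * ('C(q + d, d)%:R * f ^+ q) <= _).
  apply: ler_sum => q _; rewrite exprS.
  rewrite (_ : _ * f * _ = (2 ^ d1 * ((2 ^ d1 - 1) * d1`! * 'C(q + d, d)))%:R * (f * f ^+ q)); last first.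
    by rewrite !natrM; ring.
  rewrite ler_wpM2r ?mulr_ge0 ?exprn_ge0// ler_nat leq_mul2l.
  by rewrite shell_coef_le orbT.
rewrite -mulr_sumr natrM e2 natrM natrX -!mulrA ler_wpM2l//.
  by rewrite -e2.
rewrite ler_wpM2l ?exprn_ge0// ler_wpM2l// ler_wpM2l//.
exact: bin_geometric_le.
Qed.

End shell_sums.
End counting.

(** * Heat kernels on a circle *)
Section theta_functions.
Variable R : realType.
Implicit Types (Lam s z r x h : R).

Definition heat_kernel s r : R := (Num.sqrt (4 * pi * s))^-1 * expR (- (r ^+ 2 / (4 * s))).

(** Partial sum of the heat kernel of a circle of length Lam, over frequencies. *)
Definition spectral_sum Lam s z K : R :=
  Lam^-1 * (1 + 2 * \sum_(k < K) expR (- (s * (2 * pi * k.+1%:R / Lam) ^+ 2))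
                              * cos (2 * pi * k.+1%:R / Lam * z)).

(** Partial sum of the same heat kernel, over windings around the circle. *)
Definition periodized_heat Lam s z K : R :=
  heat_kernel s z + \sum_(m < K) (heat_kernel s (z + m.+1%:R * Lam) + heat_kernel s (z - m.+1%:R * Lam)).

Definition theta Lam s z : R := limn (spectral_sum Lam s z).

Lemma heat_kernel_ge0 s r : 0 <= heat_kernel s r.
Proof. by rewrite mulr_ge0 ?expR_ge0// invr_ge0 sqrtr_ge0. Qed.

Lemma heat_kernelN s r : heat_kernel s (- r) = heat_kernel s r.
Proof. by rewrite /heat_kernel sqrrN. Qed.

(** Jacobi's transformation, rescaled to a circle of length Lam. The range of z is
reduced to [0, Lam] by parity. *)
Lemma theta_cvg Lam s z : 0 < Lam -> 0 < s -> `|z| <= Lam ->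
  spectral_sum Lam s z @ \oo --> theta Lam s z /\
  periodized_heat Lam s z @ \oo --> theta Lam s z.
Proof.
move=> L0 s0 zL.
pose t := 4 * s / Lam ^+ 2; pose w := `|z| / Lam.
have t0 : 0 < t by rewrite divr_gt0 ?mulr_gt0 ?exprn_gt0.
have L1 : Lam != 0 by rewrite gt_eqF.
have w01 : 0 <= w <= 1 by rewrite divr_ge0 ?(ltW L0)//= ler_pdivrMr// mul1r.
have [cs ci E] := theta_normalized t0 w01.
have e1 : spectral_sum Lam s z = (fun K => Lam^-1 * (1 + 2 * series (theta_spec t w) K)).
  apply/funext => K; rewrite /spectral_sum /series/= big_mkord; congr (_ * (1 + 2 * _)).
  apply: eq_bigr => k _; rewrite /theta_spec; congr (expR (- _) * _).
    by rewrite /t; field.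
  have -> : 2 * (pi * k.+1%:R * w) = 2 * pi * k.+1%:R / Lam * `|z| by rewrite /w; field.
  by case: (ger0P z) => // _; rewrite mulrN cosN.
have c1 : spectral_sum Lam s z @ \oo --> Lam^-1 * (1 + 2 * limn (series (theta_spec t w))).
  rewrite e1; apply: cvgM; first exact: cvg_cst.
  by apply: cvgD; [exact: cvg_cst|apply: cvgM => //; exact: cvg_cst].
have -> : theta Lam s z = Lam^-1 * (1 + 2 * limn (series (theta_spec t w))).
  exact: cvg_lim c1.
split => //; rewrite E mulrA.
have e0 : Lam^-1 * (Num.sqrt (pi * t))^-1 = (Num.sqrt (4 * pi * s))^-1.
  have -> : pi * t = 4 * pi * s * (Lam^-1) ^+ 2 by rewrite /t; field.
  rewrite sqrtrM; last by rewrite !mulr_ge0 ?pi_ge0// ltW.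
  rewrite sqrtr_sqr ger0_norm ?invr_ge0 ?(ltW L0)// invfM invrK.
  by rewrite mulrCA mulVf// mulr1.
rewrite e0.
have gE r c : c ^+ 2 = (r / Lam) ^+ 2 -> (Num.sqrt (4 * pi * s))^-1 * expR (- (c ^+ 2 / t)) = heat_kernel s r.
  by move=> ->; rewrite /heat_kernel; congr (_ * expR (- _)); rewrite /t; field; rewrite L1 gt_eqF.
have e2 : periodized_heat Lam s z = (fun K => (Num.sqrt (4 * pi * s))^-1 *
    (expR (- (w ^+ 2 / t)) + series (theta_img t w) K)).
  apply/funext => K; rewrite mulrDr /periodized_heat; congr +%R.
    by rewrite (gE z)// /w !expr_div_n real_normK ?num_real.
  rewrite /series/= big_mkord mulr_sumr; apply: eq_bigr => m _.
  rewrite /theta_img mulrDr /w; case: (ger0P z) => z0.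
    rewrite (gE (z + m.+1%:R * Lam)); last by congr (_ ^+ 2); field.
    rewrite (gE (- (z - m.+1%:R * Lam))); last by congr (_ ^+ 2); field.
    by rewrite heat_kernelN.
  rewrite (gE (- (z - m.+1%:R * Lam))); last by congr (_ ^+ 2); field.
  rewrite (gE (z + m.+1%:R * Lam)); last by congr (_ ^+ 2); field.
  by rewrite heat_kernelN addrC.
rewrite e2; apply: cvgM; first exact: cvg_cst.
by apply: cvgD; [exact: cvg_cst|].
Qed.

(** The Gaussian terms are bounded by the increments of -2/(h (1 + h k)), so the
sum telescopes; the bound has the order of the corresponding integral. *)
Lemma sum_gauss_le h K : 0 < h ->
  \sum_(k < K) expR (- (h * k.+1%:R) ^+ 2) <= 2 / h.
Proof.
move=> h0.
suff : \sum_(k < K) expR (- (h * k.+1%:R) ^+ 2) <= 2 / h * (1 - (1 + h * K%:R)^-1).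
  move=> /le_trans; apply; rewrite ler_piMr ?divr_ge0 ?(ltW h0)// gerBl invr_ge0.
  by rewrite addr_ge0// mulr_ge0// ltW.
elim: K => [|K IH]; first by rewrite big_ord0 mulr0 addr0 invr1 subrr mulr0.
rewrite big_ord_recr/=; apply: le_trans (lerD IH (lexx _)) _.
have k0 : 0 <= h * K%:R by rewrite mulr_ge0// ltW.
have -> : h * K.+1%:R = h * K%:R + h by rewrite -natr1 mulrDr mulr1.
move: (h * K%:R) k0 => k k0.
have p1 : 0 < 1 + k by rewrite ltr_pwDl.
have p2 : 0 < 1 + (k + h) by rewrite ltr_pwDl// addr_ge0// ltW.
have -> : 2 / h * (1 - (1 + (k + h))^-1) = 2 / h * (1 - (1 + k)^-1) + 2 / ((1 + k) * (1 + (k + h))).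
  by field; rewrite !gt_eqF.
rewrite lerD2l expRN -[leRHS]invrK lef_pV2 ?posrE ?expR_gt0 ?invr_gt0 ?divr_gt0 ?mulr_gt0//.
apply: le_trans (expR_ge1Dx _); rewrite invfM invrK mulrC ler_pdivrMr//.
have := mulr_ge0 (ltW h0) (ltW p2); have := sqr_ge0 (k + h - 1); nra.
Qed.

Lemma gauss_freq_sum_le Lam s K : 0 < Lam -> 0 < s ->
  \sum_(k < K) expR (- (s * (2 * pi * k.+1%:R / Lam) ^+ 2)) <= Lam / Num.sqrt s.
Proof.
move=> L0 s0; have q0 : 0 < Num.sqrt s by rewrite sqrtr_gt0.
pose h := Num.sqrt s * (2 * pi / Lam).
have h0 : 0 < h by rewrite mulr_gt0// divr_gt0// mulr_gt0// pi_gt0.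
rewrite (eq_bigr (fun k : 'I_K => expR (- (h * k.+1%:R) ^+ 2))); last first.
  move=> k _; congr (expR (- _)); rewrite /h -{1}(sqr_sqrtr (ltW s0)); field.
  by rewrite gt_eqF.
apply: le_trans (sum_gauss_le K h0) _.
have -> : 2 / h = (Lam / Num.sqrt s) / pi.
  rewrite /h; move: (Num.sqrt s) (pi : R) q0 (pi_gt0 R) => q p q0 p0.
  by field; rewrite !gt_eqF.
rewrite ler_pdivrMr ?pi_gt0// ler_peMr ?divr_ge0 ?(ltW q0) ?(ltW L0)//.
by apply: le_trans (pi_ge2 R); rewrite ler1n.
Qed.

Lemma spectral_sum_le Lam s z K : 0 < Lam -> 0 < s ->
  `|spectral_sum Lam s z K| <= Lam^-1 * (1 + 2 * (Lam / Num.sqrt s)).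
Proof.
move=> L0 s0; rewrite /spectral_sum normrM ger0_norm ?invr_ge0 ?(ltW L0)//.
rewrite ler_wpM2l ?invr_ge0 ?(ltW L0)//.
apply: le_trans (ler_normD _ _) _; rewrite normr1 lerD2l normrM ger0_norm// ler_wpM2l//.
apply: le_trans (ler_norm_sum _ _ _) _; apply: le_trans (gauss_freq_sum_le K L0 s0).
apply: ler_sum => k _; rewrite normrM (ger0_norm (expR_ge0 _)) ler_piMr ?expR_ge0//.
by rewrite ler_norml cos_le1 cos_geN1.
Qed.

(** Two points at each distance scale m Lam give a convergent Gaussian sum, and the
bound stays of order s^(-1/2) for small s. *)
Lemma heat_kernel_sum_le Lam s (r : nat -> R) M : 0 < Lam -> 0 < s ->
  (forall m, Lam * m%:R <= `|r m.*2.+1|) -> (forall m, Lam * m%:R <= `|r m.*2.+2|) ->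
  \sum_(p < M.*2.+1) heat_kernel s (r p) <= 3 / Num.sqrt s + 8 / Lam.
Proof.
move=> L0 s0 r1 r2; have q0 : 0 < Num.sqrt s by rewrite sqrtr_gt0.
have c0 : 0 < Num.sqrt (4 * pi * s) by rewrite sqrtr_gt0 !mulr_gt0// pi_gt0.
pose e m : R := expR (- (Lam * m%:R) ^+ 2 / (4 * s)).
pose c := (Num.sqrt (4 * pi * s))^-1.
have hle x m : Lam * m%:R <= `|x| -> heat_kernel s x <= c * e m.
  move=> h; rewrite /heat_kernel ler_wpM2l ?invr_ge0 ?sqrtr_ge0// ler_expR mulNr lerN2.
  rewrite ler_wpM2r ?invr_ge0 ?mulr_ge0 ?(ltW s0)//.
  by rewrite -[leRHS]real_normK ?num_real// lerXn2r ?nnegrE ?mulr_ge0 ?(ltW L0).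
have step : \sum_(p < M.*2.+1) heat_kernel s (r p) <= c * (1 + 2 * \sum_(m < M) e m).
  elim: M => [|M IH].
    rewrite big_ord_recl !big_ord0 mulr0 !addr0 mulr1 /heat_kernel.
    by rewrite ler_piMr ?invr_ge0 ?sqrtr_ge0// -expR0 ler_expR oppr_le0 divr_ge0 ?sqr_ge0// mulr_ge0// ltW.
  rewrite doubleS big_ord_recr big_ord_recr [\sum_(m < M.+1) _]big_ord_recr/=.
  have := hle _ _ (r1 M); have := hle _ _ (r2 M); move: IH.
  move: (\sum_(p < M.*2.+1) _) (\sum_(m < M) _) (heat_kernel s _) (heat_kernel s _) => a b x y; nra.
apply: le_trans step _.
have eb : \sum_(m < M) e m <= 1 + 4 * Num.sqrt s / Lam.
  case: M => [|M].
    by rewrite big_ord0 addr_ge0// divr_ge0 ?mulr_ge0 ?sqrtr_ge0// ltW.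
  rewrite big_ord_recl; apply: lerD.
    by rewrite /e mulr0 expr0n/= oppr0 mul0r expR0.
  pose h := Lam / (2 * Num.sqrt s).
  have h0 : 0 < h by rewrite divr_gt0// mulr_gt0.
  rewrite (eq_bigr (fun k : 'I_M => expR (- (h * k.+1%:R) ^+ 2))); last first.
    move=> k _; rewrite /e lift0; congr expR; rewrite mulNr; congr (- _).
    by rewrite /h -{1}(sqr_sqrtr (ltW s0)); field; rewrite gt_eqF.
  apply: le_trans (sum_gauss_le M h0) _; rewrite le_eqVlt; apply/orP; left; apply/eqP.
  by rewrite /h; field; rewrite !gt_eqF.
have cq : c <= (Num.sqrt s)^-1.
  rewrite lef_pV2 ?posrE// ler_wsqrtr// ler_peMl ?(ltW s0)//.
  by have := pi_ge2 R; lra.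
apply: le_trans (_ : (Num.sqrt s)^-1 * (1 + 2 * (1 + 4 * Num.sqrt s / Lam)) <= _).
  apply: ler_pM => //; first by rewrite invr_ge0 ltW.
    by rewrite addr_ge0// mulr_ge0// sumr_ge0// => m _; exact: expR_ge0.
  by rewrite lerD2l ler_wpM2l.
rewrite le_eqVlt; apply/orP; left; apply/eqP; field.
by rewrite !gt_eqF.
Qed.

End theta_functions.

(** * Heat kernels on an interval: modes and images *)
Section one_dimension.
Variable R : realType.
Implicit Types (bc : boundary_condition) (L s x y z : R) (K : nat).

Definition nmodes bc K : nat :=
  match bc with Dirichlet => K | Neumann => K.+1 | Periodic => K.*2.+1 end.

Definition mode bc K (p : nat) : int :=
  match bc with Dirichlet => p.+1%:Z | Neumann => p%:Z | Periodic => p%:Z - K%:Z end.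

Definition freq bc L (m : int) : R :=
  match bc with
  | Dirichlet | Neumann => (pi / L) ^+ 2 * m%:~R ^+ 2
  | Periodic => (2 * pi / L) ^+ 2 * m%:~R ^+ 2
  end.

(** The factor of w_k(x) conj(w_k(y)) that belongs to one coordinate. *)
Definition wave_factor bc L (m : int) x y : R[i] :=
  match bc with
  | Dirichlet => ((amplitude L m * sin (pi * m%:~R * x / L))
                  * (amplitude L m * sin (pi * m%:~R * y / L)))%:C%C
  | Neumann => ((amplitude L m * cos (pi * m%:~R * x / L))
                  * (amplitude L m * cos (pi * m%:~R * y / L)))%:C%C
  | Periodic => (L^-1)%:C%C * expi (2 * pi / L * (m%:~R * (x - y)))
  end.

(** Heat kernel of the interval, summed over finitely many modes. Dirichlet and
Neumann kernels are those of the doubled circle, made odd or even by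
reflection. *)
Definition spectral_kernel bc L s x y K : R :=
  match bc with
  | Dirichlet => spectral_sum (2 * L) s (x - y) K - spectral_sum (2 * L) s (x + y) K
  | Neumann => spectral_sum (2 * L) s (x - y) K + spectral_sum (2 * L) s (x + y) K
  | Periodic => spectral_sum L s (x - y) K
  end.

Lemma amplitude_sqr L (m : int) : 0 < L -> m != 0 -> amplitude L m * amplitude L m = 2 / L.
Proof. by move=> L0 /negbTE m0; rewrite /amplitude m0 -expr2 sqr_sqrtr// divr_ge0// ltW. Qed.

Lemma sum_symmetric (V : zmodType) (F : int -> V) K :
  \sum_(p < K.*2.+1) F (p%:Z - K%:Z) = F 0 + \sum_(k < K) (F k.+1%:Z + F (- k.+1%:Z)).
Proof.
elim: K => [|K IH]; first by rewrite big_ord_recl !big_ord0 addr0 addr0.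
rewrite doubleS big_ord_recr big_ord_recl/= [in RHS]big_ord_recr/= addrA -IH.
have -> : \sum_(i < K.*2.+1) F ((lift ord0 i)%:Z - K.+1%:Z) = \sum_(p < K.*2.+1) F (p%:Z - K%:Z).
  by apply: eq_bigr => i _; congr F; rewrite lift0; lia.
rewrite [F (0%:Z - _) + _]addrC -addrA; congr (_ + _); rewrite addrC.
by congr (F _ + F _); lia.
Qed.

(** Product formulas for sine and cosine turn the products of eigenfunctions into
cosines of the frequencies at x - y and x + y; on the circle, opposite
frequencies combine into a cosine. *)
Lemma mode_sum bc L s x y K : 0 < L ->
  \sum_(p < nmodes bc K) (expR (- (s * freq bc L (mode bc K p))))%:C%C * wave_factor bc L (mode bc K p) x y
  = (spectral_kernel bc L s x y K)%:C%C.
Proof.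
move=> L0; have L1 : L != 0 by rewrite gt_eqF.
have fE (k : nat) : (pi / L) ^+ 2 * (k%:Z)%:~R ^+ 2 = (2 * pi * k%:R / (2 * L)) ^+ 2 :> R.
  by rewrite -pmulrn; field.
have gE (k : nat) z : pi * (k%:Z)%:~R * z / L = 2 * pi * k%:R / (2 * L) * z :> R.
  by rewrite -pmulrn; field.
case: bc => /=.
- rewrite /wave_factor /freq /mode.
  under eq_bigr do rewrite -rmorphM.
  rewrite -rmorph_sum/=; congr (_%:C)%C.
  rewrite /spectral_sum -mulrBr opprD addrACA subrr add0r -mulrBr -sumrB mulrA mulr_sumr.
  apply: eq_bigr => k _ /=.
  rewrite [X in _ * X = _]mulrACA amplitude_sqr// fE !gE.
  by rewrite [_ * (x - y)]mulrBr [_ * (x + y)]mulrDr cosB cosD; field.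
- rewrite /wave_factor /freq /mode.
  under eq_bigr do rewrite -rmorphM.
  rewrite -rmorph_sum/=; congr (_%:C)%C.
  rewrite big_ord_recl/= /spectral_sum -mulrDr addrACA -mulrDr -big_split/= mulrDr mulrA mulr_sumr.
  congr +%R.
    rewrite !gE mulr0n expr0n/= !mulr0 oppr0 expR0 mul0r !mul0r cos0.
    rewrite /amplitude eqxx !mulr1 mul1r -expr2 sqr_sqrtr ?invr_ge0 ?(ltW L0)//.
    by field.
  rewrite mulr_sumr; apply: eq_bigr => k _ /=.
  rewrite /bump leq0n add1n.
  rewrite [X in _ * X = _]mulrACA amplitude_sqr// fE !gE.
  by rewrite [_ * (x - y)]mulrBr [_ * (x + y)]mulrDr cosB cosD; field.
- rewrite (sum_symmetric (fun m => (expR (- (s * freq Periodic L m)))%:C%C * wave_factor Periodic L m x y)).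
  rewrite /spectral_sum mulrDr mulr1 rmorphD/=; congr +%R.
    rewrite /freq /wave_factor mulr0z expr0n/= !mulr0 oppr0 expR0 mul0r mulr0 /expi cos0 sin0.
    by rewrite mul1r mulr1.
  rewrite mulrA mulr_sumr rmorph_sum/=; apply: eq_bigr => k _.
  rewrite /freq /wave_factor mulrNz sqrrN -mulrDr -mulrDr mulNr mulrN.
  have -> : expi (2 * pi / L * (k.+1%:~R * (x - y))) + expi (- (2 * pi / L * (k.+1%:~R * (x - y)))) =
     (2 * cos (2 * pi * k.+1%:R / L * (x - y)))%:C%C.
    rewrite /expi cosN sinN.
    have -> : 2 * pi / L * (k.+1%:~R * (x - y)) = 2 * pi * k.+1%:R / L * (x - y).
      by rewrite -pmulrn; field.
    by apply/eqP; rewrite eq_complex/=; apply/andP; split; apply/eqP; ring.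
  rewrite -!rmorphM/=; congr (_%:C)%C.
  have -> : (2 * pi / L) ^+ 2 * k.+1%:~R ^+ 2 = (2 * pi * k.+1%:R / L) ^+ 2 :> R.
    by rewrite -pmulrn; field.
  by ring.
Qed.

(** Offsets from x to the images of y, in pairs of increasing distance. Odd pairs
of a mirrored interval are translates of y by multiples of 2L; even pairs come
from reflections, whence x + y. On the circle every pair consists of
translates. *)
Definition image_pair bc L x y (m : nat) : R * R :=
  match bc with
  | Periodic => (x - y + m.+1%:R * L, x - y - m.+1%:R * L)
  | _ => if odd m then (x - y + m.+1%:R * L, x - y - m.+1%:R * L)
         else (x + y + m%:R * L, x + y - m.+2%:R * L)
  end.

Definition image_sign bc (m : nat) : R :=
  if bc is Dirichlet then (-1) ^+ m.+1 else 1.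

(** Within a pair the image nearer to x and the farther one are told apart, because
they satisfy different lower bounds. *)
Definition near_image bc L x y m : R :=
  let: (u, v) := image_pair bc L x y m in if `|u| <= `|v| then u else v.

Definition far_image bc L x y m : R :=
  let: (u, v) := image_pair bc L x y m in if `|u| <= `|v| then v else u.

(** The numbering is chosen so that half of the index, rounded down, counts the
guaranteed distance beyond delta in steps of ell. *)
Definition image_offset bc L x y (p : nat) : R :=
  if p is p'.+1 then if odd p' then far_image bc L x y p'./2 else near_image bc L x y p'./2
  else x - y.

Definition offset_sign bc (p : nat) : R := if p is p'.+1 then image_sign bc p'./2 else 1.

Lemma offset_sign_norm bc p : `|offset_sign bc p| = 1.
Proof.
case: p => [|p] /=; first by rewrite normr1.
by rewrite /image_sign; case: bc; rewrite ?normr1// normrX normrN1 expr1n.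
Qed.

Lemma image_odd bc L x y m : image_offset bc L x y m.*2.+1 = near_image bc L x y m.
Proof. by rewrite /image_offset/= odd_double doubleK. Qed.

Lemma image_even bc L x y m : image_offset bc L x y m.*2.+2 = far_image bc L x y m.
Proof. by rewrite /image_offset/= odd_double/= uphalf_double. Qed.

Lemma shifted_pair_ge (L delta z k : R) : 0 <= k -> 0 <= delta -> `|z| <= L - delta ->
  [/\ delta + k <= `|z + (k + L)|, delta + k <= `|z - (k + L)| &
      2 * (k + L) <= `|z + (k + L)| + `|z - (k + L)|].
Proof.
move=> k0 d0; rewrite ler_norml => /andP[z1 z2].
have h1 : 0 <= z + (k + L) by lra.
have h2 : z - (k + L) <= 0 by lra.
by rewrite (ger0_norm h1) (ler0_norm h2); split; lra.
Qed.

Lemma mirrored_pair_ge (L delta w k : R) : 0 <= k -> 0 <= delta ->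
  delta <= w <= 2 * L - delta ->
  [/\ delta + k <= `|w + k|, delta + k <= `|w - (k + 2 * L)| &
      2 * (k + L) <= `|w + k| + `|w - (k + 2 * L)|].
Proof.
move=> k0 d0 /andP[w1 w2].
have h1 : 0 <= w + k by lra.
have h2 : w - (k + 2 * L) <= 0 by lra.
by rewrite (ger0_norm h1) (ler0_norm h2); split; lra.
Qed.

Section image_bounds.
Variables (bc : boundary_condition) (L x y delta : R).
Hypotheses (d0 : 0 <= delta) (dL : delta <= L)
  (hx : delta / 2 <= x <= L - delta / 2) (hy : delta / 2 <= y <= L - delta / 2).

(** Both images of pair m are at least delta + L m away; as they lie on opposite
sides of x, their distances add up to at least 2 L (m+1). *)
Lemma image_pair_ge m (uv := image_pair bc L x y m) :
  [/\ delta + L * m%:R <= `|uv.1|, delta + L * m%:R <= `|uv.2| &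
      2 * (L * m.+1%:R) <= `|uv.1| + `|uv.2|].
Proof.
have /andP[x1 x2] := hx; have /andP[y1 y2] := hy.
have m0 : 0 <= L * m%:R by rewrite mulr_ge0//; exact: le_trans dL.
have zL : `|x - y| <= L - delta by rewrite ler_norml; apply/andP; split; lra.
have wL : delta <= x + y <= 2 * L - delta by apply/andP; split; lra.
have A := shifted_pair_ge m0 d0 zL; have B := mirrored_pair_ge m0 d0 wL.
have e1 : m.+1%:R * L = L * m%:R + L by rewrite -natr1; ring.
have e2 : m.+2%:R * L = L * m%:R + 2 * L by rewrite -!natr1; ring.
have e3 : L * m.+1%:R = L * m%:R + L by rewrite -natr1; ring.
rewrite /uv /image_pair e1 e2 e3 [m%:R * L]mulrC.
by case: bc => //; case: (odd m).
Qed.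

Lemma near_image_ge m : delta + L * m%:R <= `|near_image bc L x y m|.
Proof.
have [] := image_pair_ge m; rewrite /near_image.
by case: (image_pair _ _ _ _ _) => u v /= h1 h2 _; case: ifP.
Qed.

(** The larger of two distances is at least half of their sum. *)
Lemma far_image_ge m : L * m.+1%:R <= `|far_image bc L x y m|.
Proof.
have [] := image_pair_ge m; rewrite /far_image.
case: (image_pair _ _ _ _ _) => u v /= _ _; move: (L * m.+1%:R) => c h.
by case: (leP `|u| `|v|) => uv; lra.
Qed.

End image_bounds.

Lemma heat_kernel_pair bc L x y s m :
  heat_kernel s (near_image bc L x y m) + heat_kernel s (far_image bc L x y m) =
  heat_kernel s (image_pair bc L x y m).1 + heat_kernel s (image_pair bc L x y m).2.
Proof.
rewrite /near_image /far_image; case: (image_pair _ _ _ _ _) => u v /=.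
by case: ifP => // _; rewrite addrC.
Qed.

Lemma image_sum bc L x y s M :
  \sum_(p < M.*2.+1) offset_sign bc p * heat_kernel s (image_offset bc L x y p) =
  heat_kernel s (x - y) + \sum_(m < M) image_sign bc m *
     (heat_kernel s (image_pair bc L x y m).1 + heat_kernel s (image_pair bc L x y m).2).
Proof.
elim: M => [|M IH]; first by rewrite big_ord_recl !big_ord0/= mul1r.
rewrite doubleS big_ord_recr big_ord_recr [in RHS]big_ord_recr /= IH.
rewrite odd_double /= doubleK uphalf_double -heat_kernel_pair -!addrA mulrDr.
by [].
Qed.

(** One offset for y itself and two for each of 2K+1 pairs; on a mirrored interval
these are K pairs of translates and K+1 pairs of reflections. *)
Definition nimages K : nat := (K.*2.+1).*2.+1.

Lemma image_sum_periodic L x y s K :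
  \sum_(p < nimages K) offset_sign Periodic p * heat_kernel s (image_offset Periodic L x y p) =
  periodized_heat L s (x - y) (K.*2.+1).
Proof.
rewrite /nimages image_sum /periodized_heat; congr +%R; apply: eq_bigr => m _.
by rewrite /image_sign mul1r.
Qed.

(** Odd pairs are the windings of x - y and even pairs those of x + y around the
doubled circle; the last even pair is one step ahead, which leaves one extra
term. *)
Lemma image_sum_mirror bc (eps : R) L x y s K :
  bc = Dirichlet /\ eps = -1 \/ bc = Neumann /\ eps = 1 ->
  \sum_(p < nimages K) offset_sign bc p * heat_kernel s (image_offset bc L x y p) =
  periodized_heat (2 * L) s (x - y) K
  + eps * (periodized_heat (2 * L) s (x + y) K + heat_kernel s (x + y - K.+1%:R * (2 * L))).
Proof.
move=> bce; rewrite /nimages image_sum.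
have so m : odd m -> image_sign bc m = 1.
  case: bce => -[-> _] // mo; rewrite /image_sign.
  by rewrite -signr_odd/= mo expr0.
have se m : ~~ odd m -> image_sign bc m = eps.
  case: bce => -[-> ->] // mo; rewrite /image_sign.
  by rewrite -signr_odd/= mo expr1.
have po m : odd m -> image_pair bc L x y m = (x - y + m.+1%:R * L, x - y - m.+1%:R * L).
  by case: bce => -[-> _] mo; rewrite /image_pair mo.
have pe m : ~~ odd m -> image_pair bc L x y m = (x + y + m%:R * L, x + y - m.+2%:R * L).
  by case: bce => -[-> _] /negbTE mo; rewrite /image_pair mo.
elim: K => [|K IH].
  rewrite big_ord_recl big_ord0 /periodized_heat !big_ord0 !addr0 se// pe//= mul0r addr0.
  by congr (_ + _ * (_ + heat_kernel s (_ - _))); ring.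
rewrite doubleS big_ord_recr big_ord_recr/= addrA addrA IH.
rewrite so /= ?odd_double// po /= ?odd_double//.
rewrite se /= ?negbK ?odd_double// pe /= ?negbK ?odd_double//.
rewrite /periodized_heat [in RHS]big_ord_recr [in X in _ = _ + _ * X]big_ord_recr/=.
have e1 : (K.*2.+2)%:R * L = K.+1%:R * (2 * L) by rewrite -doubleS -muln2 natrM; ring.
have e2 : (K.*2.+4)%:R * L = K.+2%:R * (2 * L) by rewrite -!doubleS -muln2 natrM; ring.
rewrite e1 e2; ring.
Qed.

(** Jacobi's transformation on the circle, or on the doubled circle at x - y and
x + y. The extra term of image_sum_mirror tends to zero as a term of a
convergent series. *)
Lemma spec_image_cvg bc L s x y : 0 < L -> 0 < s -> 0 <= x <= L -> 0 <= y <= L ->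
  exists2 l : R, spectral_kernel bc L s x y @ \oo --> l &
  (fun K => \sum_(p < nimages K) offset_sign bc p * heat_kernel s (image_offset bc L x y p)) @ \oo --> l.
Proof.
move=> L0 s0 /andP[x0 xL] /andP[y0 yL].
have z1 : `|x - y| <= L by rewrite ler_norml; apply/andP; split; lra.
have L2 : 0 < 2 * L by rewrite mulr_gt0.
have z2 : `|x - y| <= 2 * L by apply: le_trans z1 _; lra.
have w2 : `|x + y| <= 2 * L by rewrite ler_norml; apply/andP; split; lra.
have [A1 A2] := theta_cvg L2 s0 z2; have [B1 B2] := theta_cvg L2 s0 w2.
have C : (fun K => heat_kernel s (x + y - K.+1%:R * (2 * L))) @ \oo --> 0.
  have cs : cvgn (series (fun m => heat_kernel s (x + y + m.+1%:R * (2 * L)) + heat_kernel s (x + y - m.+1%:R * (2 * L)))).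
    have : cvgn (fun K => periodized_heat (2 * L) s (x + y) K - heat_kernel s (x + y)).
      by apply: is_cvgB; [exact: cvgP B2|exact: is_cvg_cst].
    by congr (cvgn _); apply/funext => K; rewrite /periodized_heat addrAC subrr add0r /series/= big_mkord.
  have := cvg_series_cvg_0 cs; apply: squeeze_cvgr; last exact: cvg_cst.
  by near=> K; rewrite heat_kernel_ge0/= lerDr heat_kernel_ge0.
have M eps bc' : bc' = Dirichlet /\ eps = -1 \/ bc' = Neumann /\ eps = 1 ->
   (fun K => \sum_(p < nimages K) offset_sign bc' p * heat_kernel s (image_offset bc' L x y p)) @ \oo -->
     theta (2 * L) s (x - y) + eps * theta (2 * L) s (x + y).
  move=> h; under eq_cvg do rewrite (image_sum_mirror _ _ _ _ _ h).
  apply: cvgD => //; apply: cvgM; first exact: cvg_cst.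
  by rewrite -[X in _ --> X]addr0; apply: cvgD.
case: bc.
- exists (theta (2 * L) s (x - y) - theta (2 * L) s (x + y)); first exact: cvgB.
  by have := M (-1) Dirichlet (or_introl (conj erefl erefl)); rewrite mulN1r.
- exists (theta (2 * L) s (x - y) + theta (2 * L) s (x + y)); first exact: cvgD.
  by have := M 1 Neumann (or_intror (conj erefl erefl)); rewrite mul1r.
- have [D1 D2] := theta_cvg L0 s0 z1.
  exists (theta L s (x - y)) => //.
  under eq_cvg do rewrite image_sum_periodic.
  apply: (cvg_comp (fun K => K.*2.+1) (periodized_heat L s (x - y)) _ D2).
  apply/cvgnyPge => A; near=> K.
  have : (A <= K)%N by near: K; exact: nbhs_infty_ge.
  by move=> /leq_trans; apply; rewrite -addnn -addnS leq_addr.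
Unshelve. all: end_near. Qed.

Lemma spectral_kernel_le bc L s x y K : 0 < L -> 0 < s ->
  `|spectral_kernel bc L s x y K| <= L^-1 * (1 + 2 * (2 * L / Num.sqrt s)) * 2.
Proof.
move=> L0 s0; have L2 : 0 < 2 * L by rewrite mulr_gt0.
have q0 : 0 < Num.sqrt s by rewrite sqrtr_gt0.
have B z : `|spectral_sum (2 * L) s z K| <= L^-1 * (1 + 2 * (2 * L / Num.sqrt s)).
  apply: le_trans (spectral_sum_le z K L2 s0) _; rewrite ler_wpM2r//.
    by rewrite addr_ge0// mulr_ge0// divr_ge0 ?(ltW L2) ?(ltW q0).
  by rewrite lef_pV2 ?posrE//; lra.
case: bc => /=.
- by apply: le_trans (ler_normB _ _) _; have := B (x - y); have := B (x + y); lra.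
- by apply: le_trans (ler_normD _ _) _; have := B (x - y); have := B (x + y); lra.
- apply: le_trans (spectral_sum_le _ K L0 s0) _.
  rewrite -mulrA ler_wpM2l ?invr_ge0 ?(ltW L0)//.
  have : 0 <= L / Num.sqrt s by rewrite divr_ge0 ?(ltW L0) ?(ltW q0).
  rewrite -[2 * L / _]mulrA; lra.
Qed.

Lemma image_sum_le bc L x y s delta K : 0 < L -> 0 < s ->
  0 <= delta -> delta <= L ->
  delta / 2 <= x <= L - delta / 2 -> delta / 2 <= y <= L - delta / 2 ->
  \sum_(p < nimages K) heat_kernel s (image_offset bc L x y p) <= 3 / Num.sqrt s + 8 / L.
Proof.
move=> L0 s0 d0 dL hx hy; apply: heat_kernel_sum_le => // m.
  rewrite image_odd; apply: le_trans (near_image_ge bc d0 dL hx hy m).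
  by rewrite lerDr.
rewrite image_even; apply: le_trans (far_image_ge bc d0 dL hx hy m).
by rewrite ler_pM2l// ler_nat.
Qed.

Lemma mode_sum_le bc L s K : 0 < L -> 0 < s ->
  \sum_(p < nmodes bc K) expR (- (s * freq bc L (mode bc K p))) <= 1 + 2 * (2 * L / Num.sqrt s).
Proof.
move=> L0 s0; have q0 : 0 < Num.sqrt s by rewrite sqrtr_gt0.
have L2 : 0 < 2 * L by rewrite mulr_gt0.
have fE (k : nat) : (pi / L) ^+ 2 * (k%:Z)%:~R ^+ 2 = (2 * pi * k%:R / (2 * L)) ^+ 2 :> R.
  by rewrite -pmulrn; field; rewrite gt_eqF.
have a0 : 0 <= L / Num.sqrt s by rewrite divr_ge0 ?(ltW L0) ?(ltW q0).
have b0 : 0 <= 2 * L / Num.sqrt s by rewrite divr_ge0 ?(ltW L2) ?(ltW q0).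
case: bc => /=.
- have := gauss_freq_sum_le K L2 s0.
  under [X in _ -> X <= _]eq_bigr do rewrite fE.
  by lra.
- rewrite big_ord_recl/= mulr0z expr0n/= !mulr0 oppr0 expR0.
  have := gauss_freq_sum_le K L2 s0.
  under [X in _ -> _ + X <= _]eq_bigr do rewrite /bump leq0n add1n fE.
  by lra.
- rewrite (sum_symmetric (fun m => expR (- (s * freq Periodic L m)))).
  rewrite /freq mulr0z expr0n/= !mulr0 oppr0 expR0.
  have := gauss_freq_sum_le K L0 s0.
  have -> : \sum_(k < K) (expR (- (s * ((2 * pi / L) ^+ 2 * k.+1%:~R ^+ 2))) +
      expR (- (s * ((2 * pi / L) ^+ 2 * (- k.+1%:Z)%:~R ^+ 2)))) =
      2 * \sum_(k < K) expR (- (s * (2 * pi * k.+1%:R / L) ^+ 2)).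
    rewrite mulr_sumr; apply: eq_bigr => k _; rewrite mulrNz sqrrN.
    have -> : (2 * pi / L) ^+ 2 * k.+1%:~R ^+ 2 = (2 * pi * k.+1%:R / L) ^+ 2 :> R.
      by rewrite -pmulrn; field; rewrite gt_eqF.
    by ring.
  by rewrite -mulrA; lra.
Qed.

End one_dimension.

(** * Summation along an exhaustion *)
Section exhaustion.
Variables (R : realType) (T : choiceType).
Implicit Types (S : set T) (B : nat -> seq T) (u : T -> R).

(** The finite subsets are given as lists, so that sums over them are big
operators. *)
Definition exhausts B S := [/\ forall n, uniq (B n), forall n t, t \in B n -> S t,
  forall n t, t \in B n -> t \in B n.+1 & forall t, S t -> exists n, t \in B n].

Lemma exhausts_mono B S m n : exhausts B S -> (m <= n)%N -> {subset B m <= B n}.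
Proof.
move=> [_ _ h _] /subnK <-; elim: (n - m)%N => [//|k IH] t /IH; exact: h.
Qed.

Lemma exhausts_cover B S (s : seq T) : exhausts B S -> (forall t, t \in s -> S t) ->
  exists n, {subset s <= B n}.
Proof.
move=> hB; elim: s => [|t s IH] hs; first by exists 0%N.
have [n hn] := IH (fun v vs => hs v (@mem_behead _ (t :: s) v vs)).
have [_ _ _ /(_ t (hs t (mem_head _ _)))[m tm]] := hB.
exists (maxn m n) => v; rewrite inE => /predU1P[->|/hn].
  by apply: (exhausts_mono hB _ tm); rewrite leq_maxl.
by apply: (exhausts_mono hB); rewrite leq_maxr.
Qed.

Lemma ler_sum_subseq (a : T -> R) (s s' : seq T) : (forall t, 0 <= a t) ->
  uniq s -> uniq s' -> {subset s <= s'} -> \sum_(t <- s) a t <= \sum_(t <- s') a t.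
Proof.
move=> a0 us us' ss'.
rewrite [leRHS](bigID (mem s))/=.
have -> : \sum_(t <- s' | t \in s) a t = \sum_(t <- s) a t.
  rewrite -big_filter; apply: perm_big; apply: uniq_perm => //; first exact: filter_uniq.
  by move=> t; rewrite mem_filter; case ts: (t \in s) => //=; exact: ss'.
by rewrite lerDl sumr_ge0.
Qed.

(** Every finite subset is contained in some B n, so the supremum over finite
subsets is the limit along the exhaustion. *)
Lemma esum_exhaust (a : T -> R) B S M : exhausts B S -> (forall t, 0 <= a t) ->
  (forall n, \sum_(t <- B n) a t <= M) ->
  exists2 l, esum S (EFin \o a) = l%:E & (fun n => \sum_(t <- B n) a t) @ \oo --> l.
Proof.
move=> hB a0 hM; have [uB sB _ _] := hB.
pose s n := \sum_(t <- B n) a t.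
have ns : nondecreasing_seq s.
  by move=> m n mn; exact: (ler_sum_subseq a0 (uB _) (uB _) (exhausts_mono hB mn)).
have ubs : has_ubound (range s) by exists M => _ [n _ <-]; exact: hM.
have cs := nondecreasing_cvgn ns ubs.
exists (sup (range s)) => //.
apply/eqP; rewrite eq_le; apply/andP; split.
  apply: ge_ereal_sup => _ [F [fF FS] <-].
  rewrite fsbig_finite//= sumEFin lee_fin.
  have hF t : t \in finmap.enum_fset (fset_set F) -> S t.
    by move=> tF; apply: FS; apply/set_mem; rewrite -in_fset_set.
  have [n hn] := exhausts_cover hB hF.
  apply: le_trans (_ : s n <= _).
    by apply: ler_sum_subseq => //; exact: fset_uniq.
  by apply: ub_le_sup => //; exists n.
have -> : (sup (range s))%:E = ereal_sup (EFin @` range s).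
  by rewrite ereal_sup_EFin//; exists (s 0%N), 0%N.
apply: ge_ereal_sup => _ [_ [n _ <-] <-].
apply: esum_ge; exists [set` B n]; first by split => // t /= /sB.
by rewrite -fsbig_seq// sumEFin.
Qed.

(** Positive and negative parts are summed separately, as in the definition of rsum. *)
Lemma cvg_rsum B S u M : exhausts B S -> (forall n, \sum_(t <- B n) `|u t| <= M) ->
  (fun n => \sum_(t <- B n) u t) @ \oo --> rsum S u.
Proof.
move=> hB hM.
have hp n : \sum_(t <- B n) Num.max (u t) 0 <= M.
  by apply: le_trans (hM n); apply: ler_sum => t _; rewrite ge_max ler_norm normr_ge0.
have hn n : \sum_(t <- B n) Num.max (- u t) 0 <= M.
  by apply: le_trans (hM n); apply: ler_sum => t _; rewrite ge_max -normrN ler_norm normr_ge0.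
have p0 t : 0 <= Num.max (u t) 0 by rewrite le_max lexx orbT.
have n0 t : 0 <= Num.max (- u t) 0 by rewrite le_max lexx orbT.
have [l1 e1 c1] := esum_exhaust hB p0 hp.
have [l2 e2 c2] := esum_exhaust hB n0 hn.
have -> : rsum S u = l1 - l2.
  rewrite /rsum/=.
  have -> : ((EFin \o u)^\+)%E = EFin \o (fun t => Num.max (u t) 0).
    by apply/funext => t; rewrite funeposE/= EFin_max.
  have -> : ((EFin \o u)^\-)%E = EFin \o (fun t => Num.max (- u t) 0).
    by apply/funext => t; rewrite funenegE/= EFin_max.
  by rewrite e1 e2.
have -> : (fun n => \sum_(t <- B n) u t) =
  (fun n => \sum_(t <- B n) Num.max (u t) 0 - \sum_(t <- B n) Num.max (- u t) 0).
  apply/funext => n; rewrite -sumrB; apply: eq_bigr => t _.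
  by case: (leP (u t) 0) => h; case: (leP (- u t) 0) => h'; lra.
exact: cvgB.
Qed.

End exhaustion.

(** * Finite combinations of densities *)
Section linear_combinations.
Variable R : realType.
Local Notation mu := (@lebesgue_measure R).
Variables (I : Type) (r : seq I) (nu : I -> R) (A B c : I -> R).
Hypothesis ok : forall i, gig_ok (nu i) (A i) (B i).

Lemma integrable_lincomb :
  mu.-integrable setT (EFin \o (fun u => \sum_(i <- r) c i * gig (nu i) (A i) (B i) u)).
Proof.
elim: r => [|i s IH].
  by under eq_fun do rewrite big_nil; exact: integrable0.
have -> : (EFin \o (fun u => \sum_(i <- (i :: s)) c i * gig (nu i) (A i) (B i) u)) =
  (fun u => (c i)%:E * (gig (nu i) (A i) (B i) u)%:E + (\sum_(i <- s) c i * gig (nu i) (A i) (B i) u)%:E)%E.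
  by apply/funext => u; rewrite /= big_cons.
by apply: integrableD => //; apply: integrableZl => //; exact: integrable_gig.
Qed.

End linear_combinations.

Lemma gig_mass_lincomb (R : realType) (I : Type) (r : seq I) (nu : I -> R) (A B c : I -> R) :
  (forall i, gig_ok (nu i) (A i) (B i)) ->
  \int[lebesgue_measure]_(u in setT) (\sum_(i <- r) c i * gig (nu i) (A i) (B i) u) =
  \sum_(i <- r) c i * gig_mass (nu i) (A i) (B i).
Proof.
move=> ok; elim: r => [|i s IH].
  rewrite big_nil; under eq_Rintegral do rewrite big_nil.
  by rewrite Rintegral_cst// mul0r.
rewrite big_cons -IH.
under eq_Rintegral do rewrite big_cons.
rewrite RintegralD//; last exact: integrable_lincomb.
  by rewrite RintegralZl//; exact: integrable_gig.
have -> : (EFin \o (fun u => c i * gig (nu i) (A i) (B i) u)) =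
  (fun u => (c i)%:E * (gig (nu i) (A i) (B i) u)%:E)%E by [].
by apply: integrableZl => //; exact: integrable_gig.
Qed.

(** * Boxes of modes *)
(** Range of the modes of index K as an interval, so that boxes of different index
can be compared. *)
Definition mode_le bc K (m : int) : Prop :=
  match bc with
  | Dirichlet => 1 <= m <= K%:Z
  | Neumann => 0 <= m <= K%:Z
  | Periodic => - K%:Z <= m <= K%:Z
  end.

Section mode_boxes.
Variables (R : realType) (d : nat) (bc : boundary_condition).
Implicit Types (k : 'rV[int]_d) (K : nat).

Lemma mode_leP K m : (exists p : 'I_(nmodes bc K), mode bc K p = m) <-> mode_le bc K m.
Proof.
split => [[[p /= hp] <-]|].
  by rewrite /mode_le /mode; case: bc hp; rewrite /nmodes => hp; lia.
have mk (q : nat) : (q < nmodes bc K)%N -> mode bc K q = m ->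
    exists p : 'I_(nmodes bc K), mode bc K p = m.
  by move=> hq e; exists (Ordinal hq).
rewrite /mode_le; case: bc mk => /= mk /andP[h1 h2].
- by apply: (mk (absz (m - 1))); lia.
- by apply: (mk (absz m)); lia.
- by apply: (mk (absz (m + K%:Z))); lia.
Qed.

Lemma mode_inj K : injective (mode bc K).
Proof. by move=> p q; rewrite /mode; case: bc => h; lia. Qed.

Definition box_mode K (f : {ffun 'I_d -> 'I_(nmodes bc K)}) : 'rV[int]_d :=
  \row_i mode bc K (f i).

Definition mode_box K : seq 'rV[int]_d :=
  [seq box_mode f | f in {: {ffun 'I_d -> 'I_(nmodes bc K)}}].

Lemma mem_mode_box K k : k \in mode_box K <-> forall i, mode_le bc K (k 0 i).
Proof.
split => [kb i|h].
  have /mapP[f _ ->] := kb.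
  by rewrite mxE; apply/mode_leP; exists (f i).
have {}h i : {p : 'I_(nmodes bc K) | mode bc K p = k 0 i}.
  by apply: cid; apply/mode_leP.
apply/mapP; exists [ffun i => sval (h i)]; first by rewrite mem_enum.
by apply/rowP => i; rewrite mxE ffunE; rewrite (svalP (h i)).
Qed.

Lemma mode_box_exhausts : exhausts mode_box (modes bc).
Proof.
split.
- move=> K; rewrite map_inj_uniq ?enum_uniq// => f g /rowP e.
  by apply/ffunP => i; have := e i; rewrite !mxE => /mode_inj /val_inj.
- move=> K k /mem_mode_box; rewrite /modes /mode_le.
  by case: bc => //= h i; have /andP[] := h i.
- move=> K k /mem_mode_box h; apply/mem_mode_box => i; move: (h i).
  by rewrite /mode_le; case: bc => /andP[h1 h2]; apply/andP; split; lia.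
- move=> k hk; exists (\max_(i < d) absz (k 0%R i))%N; apply/mem_mode_box => i.
  have : (absz (k 0%R i) <= \max_(i < d) absz (k 0%R i))%N by apply: (leq_bigmax i).
  move: hk; rewrite /modes /mode_le; case: bc => /= hk; try (have := hk i);
    by move=> *; apply/andP; split; lia.
Qed.

Lemma big_mode_box (V : nmodType) K (F : 'rV[int]_d -> V) :
  \sum_(k <- mode_box K) F k = \sum_(f : {ffun 'I_d -> 'I_(nmodes bc K)}) F (box_mode f).
Proof. by rewrite big_image. Qed.

End mode_boxes.

(** * Eigenvalues and eigenfunctions *)
Section spectral_terms.
Variables (R : realType) (d : nat) (bc : boundary_condition) (kappa L : R).
Hypotheses (kappa0 : 0 < kappa) (L0 : 0 < L).
Implicit Types (k : 'rV[int]_d) (x y : 'rV[R]_d).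

Lemma expiD (a b : R) : expi (a + b) = expi a * expi b.
Proof. by rewrite /expi cosD sinD; apply/eqP; rewrite eq_complex/= eqxx addrC eqxx. Qed.

Lemma expi0 : expi (0 : R) = 1.
Proof. by rewrite /expi cos0 sin0. Qed.

Lemma expiJ (a : R) : ((expi a)^*)%C = expi (- a).
Proof. by rewrite /expi cosN sinN. Qed.

(** The eigenvalue is additive in the coordinates, so its exponential factorizes. *)
Lemma eigenvalueE k :
  Defs.eigenvalue bc kappa L k = 1 + (kappa ^+ 2)^-1 * \sum_(i < d) freq bc L (k 0 i).
Proof.
have k1 : kappa != 0 by rewrite gt_eqF.
have L1 : L != 0 by rewrite gt_eqF.
by rewrite /Defs.eigenvalue /freq; case: bc; rewrite -mulr_sumr mulrA; congr (_ + _ * _); field; rewrite k1 L1.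
Qed.

Lemma eigenvalue_gt0 k : 0 < Defs.eigenvalue bc kappa L k.
Proof.
rewrite eigenvalueE ltr_pwDl// mulr_ge0 ?invr_ge0 ?sqr_ge0// sumr_ge0// => i _.
by rewrite /freq; case: bc; rewrite mulr_ge0 ?sqr_ge0.
Qed.

(** In the periodic case the normalization L^(-d/2) is squared into one factor L^-1
per coordinate. *)
Lemma eigenfunction_mul k x y :
  eigenfunction bc L k x * ((eigenfunction bc L k y)^*)%C =
  \prod_(i < d) wave_factor bc L (k 0 i) (x 0 i) (y 0 i).
Proof.
rewrite /eigenfunction /wave_factor; case: bc.
- by rewrite conjc_real -rmorphM/= -big_split/= rmorph_prod.
- by rewrite conjc_real -rmorphM/= -big_split/= rmorph_prod.
- have conjM (u v : R[i]) : conjc (u * v) = conjc u * conjc v by exact: rmorphM.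
  rewrite conjM conjc_real expiJ mulrACA -rmorphM -expiD big_split/= -rmorph_prod.
  congr ((_)%:C%C * _).
    rewrite prodr_const card_ord -powRD; last by apply/implyP => _; rewrite gt_eqF.
    have -> : - (d%:R / 2) + - (d%:R / 2) = - d%:R :> R by field.
    by rewrite powRN powR_mulrn ?(ltW L0)// exprVn.
  rewrite -(big_morph (@expi R) expiD expi0) -mulr_sumr -mulrBr -sumrB; congr (expi (_ * _)).
  by apply: eq_bigr => i _; rewrite mulrBr.
Qed.

Lemma normc_real (a : R) : Normc.normc (a%:C)%C = `|a|.
Proof. by rewrite /= expr0n addr0 sqrtr_sqr. Qed.

Lemma normc_expi (a : R) : Normc.normc (expi a) = 1.
Proof. by rewrite /= cos2Dsin2 sqrtr1. Qed.

Lemma normc_wave_factor_le m (a b : R) : Normc.normc (wave_factor bc L m a b) <= 2 / L.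
Proof.
have L2 : 0 <= 2 / L by rewrite divr_ge0// ltW.
have amp : amplitude L m * amplitude L m <= 2 / L.
  rewrite /amplitude; case: ifP => _; rewrite -expr2 sqr_sqrtr ?divr_ge0 ?(ltW L0)//.
  by rewrite ler_pM2r ?invr_gt0// ler1n.
have B (u v : R) : `|u| <= 1 -> `|v| <= 1 ->
    `|amplitude L m * u * (amplitude L m * v)| <= 2 / L.
  move=> u1 v1; rewrite mulrACA normrM ger0_norm -?expr2 ?sqr_ge0//.
  rewrite -[2 / L]mulr1 ler_pM ?normr_ge0 ?sqr_ge0 ?expr2// normrM.
  by rewrite -[1]mulr1 ler_pM.
have C1 c : `|cos c| <= 1 :> R by rewrite ler_norml cos_le1 cos_geN1.
have S1 c : `|sin c| <= 1 :> R by rewrite ler_norml sin_le1 sin_geN1.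
rewrite /wave_factor; case: bc; [rewrite normc_real|rewrite normc_real|].
- exact: B.
- exact: B.
- rewrite Normc.normcM normc_real normc_expi mulr1 ger0_norm ?invr_ge0 ?(ltW L0)//.
  by rewrite ler_peMl ?invr_ge0 ?(ltW L0)// ler1n.
Qed.

Lemma normc_prod (I : Type) (r : seq I) (F : I -> R[i]) :
  Normc.normc (\prod_(i <- r) F i) = \prod_(i <- r) Normc.normc (F i).
Proof. by apply: (big_morph (@Normc.normc R)); [exact: Normc.normcM|exact: Normc.normc1]. Qed.

Lemma normc_Re (z : R[i]) : `|complex.Re z| <= Normc.normc z.
Proof. by case: z => a b /=; rewrite -sqrtr_sqr ler_wsqrtr// lerDl sqr_ge0. Qed.

Lemma normc_Im (z : R[i]) : `|complex.Im z| <= Normc.normc z.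
Proof. by case: z => a b /=; rewrite -sqrtr_sqr ler_wsqrtr// lerDr sqr_ge0. Qed.

End spectral_terms.

(** * Subordination and the method of images *)
Section subordination.
Variables (R : realType) (d : nat) (bc : boundary_condition) (nu kappa L : R).
Variables (x y : 'rV[R]_d).
Hypotheses (nu0 : 0 < nu) (kappa0 : 0 < kappa) (L0 : 0 < L).
Local Notation mu := (@lebesgue_measure R).
Let alpha : R := nu + d%:R / 2.
Let alpha0 : 0 < alpha. Proof. by rewrite ltr_pwDl// divr_ge0. Qed.

(** Time of the heat flow generated by the Laplacian when the subordination
variable is t = e^u: the operator is rescaled by kappa^-2. *)
Definition clock (u : R) : R := expR u / kappa ^+ 2.

Lemma clock_gt0 u : 0 < clock u.
Proof. by rewrite divr_gt0 ?expR_gt0// exprn_gt0. Qed.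

Lemma sqrt_clock u : (Num.sqrt (clock u))^-1 = kappa * expR (- (u / 2)).
Proof.
rewrite /clock -exprVn sqrtrM ?expR_ge0// sqrtr_sqr ger0_norm ?invr_ge0 ?(ltW kappa0)//.
have -> : expR u = expR (u / 2) ^+ 2 by rewrite -expRM_natl; congr expR; field.
by rewrite sqrtr_sqr ger0_norm ?expR_ge0// invfM invrK expRN mulrC.
Qed.

(** A factor t^(-1/2) per coordinate lowers the order from alpha to nu = alpha - d/2. *)
Lemma gig_half u : gig alpha 1 0 u * expR (- (u / 2)) ^+ d = gig nu 1 0 u.
Proof.
rewrite -expRM_natl /gig -expRD; congr expR; rewrite /alpha; by field.
Qed.

Definition spec_integrand K u : R :=
  gig alpha 1 0 u * \prod_(i < d) spectral_kernel bc L (clock u) (x 0 i) (y 0 i) K.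

Definition image_factor K i u : R :=
  \sum_(p < nimages K) offset_sign R bc p * heat_kernel (clock u) (image_offset bc L (x 0 i) (y 0 i) p).

Definition image_integrand K u : R := gig alpha 1 0 u * \prod_(i < d) image_factor K i u.

Definition mode_wave (k : 'rV[int]_d) : R[i] :=
  \prod_(i < d) wave_factor bc L (k 0 i) (x 0 i) (y 0 i).

Let gig_eigen k u : gig alpha (Defs.eigenvalue bc kappa L k) 0 u =
  gig alpha 1 0 u * \prod_(i < d) expR (- (clock u * freq bc L (k 0 i))).
Proof.
rewrite -expR_sum /gig -expRD eigenvalueE//; congr expR.
by rewrite sumrN -mulr_sumr /clock; field; rewrite gt_eqF.
Qed.

Let ok_eigen (k : 'rV[int]_d) : gig_ok alpha (Defs.eigenvalue bc kappa L k) 0.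
Proof. by split => //; [exact: eigenvalue_gt0|left]. Qed.

Section real_linear_part.
Variable g : R[i] -> R.
Hypotheses (gD : {morph g : z w / z + w}) (gZ : forall a z, g (a%:C%C * z) = a * g z).

Let g0 : g 0 = 0.
Proof. by rewrite -[0](mul0r 0) -[X in X * _](rmorph0 (real_complex R)) gZ mul0r. Qed.

(** Distributivity: a product of sums over modes is a sum over boxes of modes, and
the exponential of the eigenvalue is absorbed by the first parameter of gig.
The real-linear map g stands for the real and the imaginary part. *)
Lemma spec_integrand_part K u :
  gig alpha 1 0 u * g ((\prod_(i < d) spectral_kernel bc L (clock u) (x 0 i) (y 0 i) K)%:C)%C =
  \sum_(f : {ffun 'I_d -> 'I_(nmodes bc K)})
    g (mode_wave (box_mode f)) * gig alpha (Defs.eigenvalue bc kappa L (box_mode f)) 0 u.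
Proof.
rewrite rmorph_prod/=.
under eq_bigr do rewrite -mode_sum//.
rewrite bigA_distr_bigA (big_morph g gD g0) mulr_sumr; apply: eq_bigr => f _.
rewrite gig_eigen [RHS]mulrC -mulrA; congr (_ * _).
rewrite -gZ big_split/= rmorph_prod; congr (g (_ * _)).
  by apply: eq_bigr => i _; rewrite mxE.
by apply: eq_bigr => i _; rewrite mxE.
Qed.

Lemma integral_spec_part K :
  \int[mu]_(u in setT) (gig alpha 1 0 u * g ((\prod_(i < d) spectral_kernel bc L (clock u) (x 0 i) (y 0 i) K)%:C)%C) =
  Gamma alpha * \sum_(k <- mode_box d bc K)
     g ((Defs.eigenvalue bc kappa L k `^ (- alpha))%:C%C * mode_wave k).
Proof.
under eq_Rintegral do rewrite spec_integrand_part.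
rewrite gig_mass_lincomb// big_mode_box mulr_sumr; apply: eq_bigr => f _.
rewrite gig_mass_powR ?eigenvalue_gt0// gZ; ring.
Qed.

End real_linear_part.

Lemma measurable_spec_integrand K : measurable_fun setT (EFin \o spec_integrand K).
Proof.
have -> : spec_integrand K = fun u => \sum_(f : {ffun 'I_d -> 'I_(nmodes bc K)})
    complex.Re (mode_wave (box_mode f)) * gig alpha (Defs.eigenvalue bc kappa L (box_mode f)) 0 u.
  apply/funext => u; rewrite -spec_integrand_part//.
    by move=> [a b] [a' b'].
  by move=> a [z w] /=; rewrite mul0r subr0.
exact: measurable_int (integrable_lincomb _ _ _).
Qed.

Lemma heat_kernel_clock u r : heat_kernel (clock u) r =
  kappa / Num.sqrt (4 * pi) * expR (- (u / 2)) * expR (- (kappa ^+ 2 * r ^+ 2 / 4 * expR (- u))).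
Proof.
rewrite /heat_kernel sqrtrM ?mulr_ge0 ?pi_ge0// invfM sqrt_clock; congr (_ * _).
  by rewrite mulrA [_^-1 * _]mulrC.
congr (expR (- _)); rewrite expRN /clock; field.
by rewrite !gt_eqF ?expR_gt0.
Qed.

Definition offset_row K (f : {ffun 'I_d -> 'I_(nimages K)}) : 'rV[R]_d :=
  \row_i image_offset bc L (x 0 i) (y 0 i) (f i).

(** Distributivity on the image side. The Gaussians of the d coordinates multiply
to exp (- kappa^2 r^2 / (4 t)), r being the Euclidean distance to the image,
and their normalizations lower the order to nu. *)
Lemma image_integrandE K u : image_integrand K u =
  \sum_(f : {ffun 'I_d -> 'I_(nimages K)})
   ((kappa / Num.sqrt (4 * pi)) ^+ d * \prod_i offset_sign R bc (f i)) *
   gig nu 1 (kappa ^+ 2 * (\sum_i offset_row f 0 i ^+ 2) / 4) u.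
Proof.
rewrite /image_integrand /image_factor bigA_distr_bigA mulr_sumr; apply: eq_bigr => f _.
under eq_bigr do rewrite heat_kernel_clock.
rewrite big_split/= big_split/= prodr_const card_ord exprMn -expR_sum sumrN.
have -> : gig nu 1 (kappa ^+ 2 * (\sum_i offset_row f 0 i ^+ 2) / 4) u = gig nu 1 0 u *
   expR (- (\sum_(i < d) kappa ^+ 2 * image_offset bc L (x 0 i) (y 0 i) (f i) ^+ 2 / 4 * expR (- u))).
  rewrite /gig -expRD; congr expR; rewrite -!mulr_suml -mulr_sumr.
  under [in LHS]eq_bigr do rewrite mxE.
  ring.
rewrite -gig_half; ring.
Qed.

Lemma measurable_image_integrand K : measurable_fun setT (EFin \o image_integrand K).
Proof.
rewrite (funext (image_integrandE K)).
apply: (measurable_int mu).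
apply: (@integrable_lincomb _ _ _ (fun=> nu) (fun=> 1)
  (fun f => kappa ^+ 2 * (\sum_i offset_row f 0 i ^+ 2) / 4)) => f.
split => //; last by left.
by rewrite divr_ge0// mulr_ge0 ?sqr_ge0// sumr_ge0// => i _; exact: sqr_ge0.
Qed.

(** The representation matern_gig_mass identifies each integral with a Matern
function of order nu at the distance of the image. *)
Lemma integral_image K : \int[mu]_(u in setT) image_integrand K u =
  (kappa / Num.sqrt (4 * pi)) ^+ d * Gamma nu *
  \sum_(f : {ffun 'I_d -> 'I_(nimages K)})
     (\prod_i offset_sign R bc (f i)) * matern nu (kappa * norm2 (offset_row f)).
Proof.
under eq_Rintegral do rewrite image_integrandE.
have s0 K' (f : {ffun 'I_d -> 'I_(nimages K')}) : 0 <= \sum_i offset_row f 0 i ^+ 2.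
  by rewrite sumr_ge0// => i _; exact: sqr_ge0.
rewrite gig_mass_lincomb; last first.
  by move=> f; split => //; [rewrite divr_ge0// mulr_ge0 ?sqr_ge0|left].
rewrite mulr_sumr; apply: eq_bigr => f _.
rewrite matern_gig_mass//; last by rewrite mulr_ge0 ?(ltW kappa0)// sqrtr_ge0.
rewrite /norm2 [(kappa * _) ^+ 2]exprMn sqr_sqrtr// -!mulrA; congr (_ * _); rewrite [RHS]mulrCA; congr (_ * _).
by rewrite [RHS]mulrC mulfVK// gt_eqF// Gamma_gt0.
Qed.

(** Integrable majorant of the integrands, independent of the truncation K. *)
Definition envelope (C u : R) : R := (2 * C) ^+ d * (gig alpha 1 0 u + gig nu 1 0 u).

Lemma integrable_envelope C : mu.-integrable setT (EFin \o envelope C).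
Proof.
have -> : EFin \o envelope C =
   (fun u => ((2 * C) ^+ d)%:E * ((EFin \o gig alpha 1 0) u + (EFin \o gig nu 1 0) u))%E.
  by apply/funext => u.
by apply: integrableZl => //; apply: integrableD => //; apply: integrable_gig; split => //; left.
Qed.

(** Uses (1 + e)^d <= 2^d (1 + e^d) with e = t^(-1/2), and gig_half. *)
Lemma prod_le_envelope (F : 'I_d -> R) C u : 0 <= C ->
  (forall i, `|F i| <= C * (1 + expR (- (u / 2)))) ->
  `|gig alpha 1 0 u * \prod_i F i| <= envelope C u.
Proof.
move=> C0 hF; set e := expR _ in hF; have e0 : 0 <= e by exact: expR_ge0.
rewrite normrM ger0_norm ?gig_ge0// normr_prod.
apply: le_trans (_ : gig alpha 1 0 u * (C * (1 + e)) ^+ d <= _).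
  rewrite ler_wpM2l ?gig_ge0//.
  rewrite -[X in _ ^+ X]card_ord -prodr_const; apply: ler_prod => i _.
  by rewrite normr_ge0/=.
rewrite /envelope -gig_half -/e -{2}[gig alpha 1 0 u]mulr1 -mulrDr mulrCA ler_wpM2l ?gig_ge0//.
rewrite !exprMn -mulrA mulrCA ler_wpM2l ?exprn_ge0//.
case: (leP e 1) => e1.
  apply: le_trans (_ : 2 ^+ d <= _).
    by rewrite lerXn2r ?nnegrE ?addr_ge0//; lra.
  by rewrite ler_peMr ?exprn_ge0// lerDl exprn_ge0.
apply: le_trans (_ : (2 * e) ^+ d <= _).
  by rewrite lerXn2r ?nnegrE ?addr_ge0 ?mulr_ge0//; lra.
by rewrite exprMn ler_wpM2l ?exprn_ge0// lerDr.
Qed.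

Let affine_le (a b e : R) : 0 <= a -> 0 <= b -> 0 <= e -> a + b * e <= (a + b) * (1 + e).
Proof. by move=> a0 b0 e0; have := mulr_ge0 a0 e0; nra. Qed.

Lemma mode_factor_le K u :
  `|\sum_(p < nmodes bc K) expR (- (clock u * freq bc L (mode bc K p)))| <=
  (1 + 4 * L * kappa) * (1 + expR (- (u / 2))).
Proof.
rewrite ger0_norm; last by rewrite sumr_ge0// => p _; exact: expR_ge0.
apply: le_trans (mode_sum_le bc K L0 (clock_gt0 u)) _.
rewrite sqrt_clock; apply: le_trans (affine_le _ _ (expR_ge0 _)) => //.
  rewrite lerD2l; lra.
by rewrite !mulr_ge0// ltW.
Qed.

Lemma spec_factor_le K u i :
  `|spectral_kernel bc L (clock u) (x 0 i) (y 0 i) K| <= (8 / L + 8 * kappa) * (1 + expR (- (u / 2))).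
Proof.
apply: le_trans (spectral_kernel_le bc _ _ K L0 (clock_gt0 u)) _.
rewrite sqrt_clock; apply: le_trans (affine_le _ _ (expR_ge0 _)).
- have l0 : 0 < L^-1 by rewrite invr_gt0.
  have -> : L^-1 * (1 + 2 * (2 * L * (kappa * expR (- (u / 2))))) * 2 =
     2 * L^-1 + 8 * kappa * expR (- (u / 2)) by field; rewrite gt_eqF.
  by rewrite lerD2r ler_pM2r// ler_nat.
- by rewrite divr_ge0// ltW.
- by rewrite mulr_ge0// ltW.
Qed.

(** The absolute sums are integrals of the heat trace, which satisfies the same
kind of bound as the heat kernel; this gives absolute summability of the
spectral series. *)
Lemma spec_abs_sum_le K :
  \sum_(k <- mode_box d bc K) Normc.normc ((Defs.eigenvalue bc kappa L k `^ (- alpha))%:C%C * mode_wave k)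
  <= (2 / L) ^+ d / Gamma alpha * \int[mu]_(u in setT) envelope (1 + 4 * L * kappa) u.
Proof.
have G0 : 0 < Gamma alpha by exact: Gamma_gt0.
rewrite mulrAC ler_pdivlMr// big_mode_box mulr_suml.
apply: le_trans (_ : \sum_(f : {ffun 'I_d -> 'I_(nmodes bc K)})
    (2 / L) ^+ d * gig_mass alpha (Defs.eigenvalue bc kappa L (box_mode f)) 0 <= _).
  apply: ler_sum => f _; rewrite Normc.normcM normc_real ger0_norm ?powR_ge0// gig_mass_powR ?eigenvalue_gt0//.
  rewrite mulrAC mulrC ler_wpM2r ?mulr_ge0 ?powR_ge0 ?(ltW G0)//.
  rewrite normc_prod -[X in _ ^+ X]card_ord -prodr_const; apply: ler_prod => i _.
  by rewrite normc_wave_factor_le// andbT; case: wave_factor => a b; exact: sqrtr_ge0.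
rewrite -mulr_sumr ler_wpM2l ?exprn_ge0 ?divr_ge0 ?(ltW L0)//.
have -> : \sum_(f : {ffun 'I_d -> 'I_(nmodes bc K)}) gig_mass alpha (Defs.eigenvalue bc kappa L (box_mode f)) 0
  = \sum_(f : {ffun 'I_d -> 'I_(nmodes bc K)}) 1 * gig_mass alpha (Defs.eigenvalue bc kappa L (box_mode f)) 0.
  by apply: eq_bigr => f _; rewrite mul1r.
rewrite -gig_mass_lincomb//; apply: le_Rintegral => //.
- exact: integrable_lincomb.
- exact: integrable_envelope.
move=> u _.
apply: le_trans (ler_norm _) _.
have -> : \sum_(f : {ffun 'I_d -> 'I_(nmodes bc K)}) 1 * gig alpha (Defs.eigenvalue bc kappa L (box_mode f)) 0 u
  = gig alpha 1 0 u * \prod_(i < d) \sum_(p < nmodes bc K) expR (- (clock u * freq bc L (mode bc K p))).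
  rewrite bigA_distr_bigA mulr_sumr; apply: eq_bigr => f _; rewrite mul1r gig_eigen; congr (_ * _).
  by apply: eq_bigr => i _; rewrite mxE.
apply: prod_le_envelope => [|i]; last exact: mode_factor_le.
by rewrite addr_ge0// !mulr_ge0// ltW.
Qed.

Lemma cvg_spec_box (g : R[i] -> R) : (forall z, `|g z| <= Normc.normc z) ->
  (fun K => \sum_(k <- mode_box d bc K)
     g ((Defs.eigenvalue bc kappa L k `^ (- alpha))%:C%C * mode_wave k)) @ \oo -->
  rsum (modes bc) (fun k : 'rV[int]_d => g ((Defs.eigenvalue bc kappa L k `^ (- alpha))%:C%C * mode_wave k)).
Proof.
move=> hg; apply: (cvg_rsum (mode_box_exhausts d bc)) => K.
by apply: le_trans (spec_abs_sum_le K); apply: ler_sum.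
Qed.

Section inside.
Variable delta : R.
Hypotheses (delta0 : 0 <= delta) (deltaL : delta <= L).
Hypotheses (hx : forall i, delta / 2 <= x 0 i <= L - delta / 2)
  (hy : forall i, delta / 2 <= y 0 i <= L - delta / 2).

Lemma image_factor_le K u i :
  `|image_factor K i u| <= (8 / L + 8 * kappa) * (1 + expR (- (u / 2))).
Proof.
apply: le_trans (ler_norm_sum _ _ _) _.
under eq_bigr do rewrite normrM offset_sign_norm mul1r (ger0_norm (heat_kernel_ge0 _ _)).
apply: le_trans (image_sum_le bc K L0 (clock_gt0 u) delta0 deltaL (hx i) (hy i)) _.
rewrite sqrt_clock; apply: le_trans (affine_le _ _ (expR_ge0 _)).
- rewrite addrC lerD2l mulrA; apply: ler_wpM2r; first exact: expR_ge0.
  by rewrite ler_pM2r// ler_nat.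
- by rewrite divr_ge0// ltW.
- by rewrite mulr_ge0// ltW.
Qed.

Lemma cvg_integrand_diff u : (fun K => spec_integrand K u - image_integrand K u) @ \oo --> 0.
Proof.
have /choice[l hl] : forall i, exists l : R, spectral_kernel bc L (clock u) (x 0 i) (y 0 i) @ \oo --> l /\
    (fun K => image_factor K i u) @ \oo --> l.
  have in0 (z : R) : delta / 2 <= z <= L - delta / 2 -> 0 <= z <= L.
    by move=> /andP[z1 z2]; have := delta0; move=> ?; apply/andP; split; lra.
  move=> i; have [l l1 l2] := spec_image_cvg bc L0 (clock_gt0 u) (in0 _ (hx i)) (in0 _ (hy i)).
  by exists l.
rewrite -[0](subrr (gig alpha 1 0 u * \prod_(i < d) l i)).
apply: cvgB; apply: cvgM; try exact: cvg_cst.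
  by apply: cvg_big => [|i _]; [exact: mul_continuous|exact: (hl i).1].
by apply: cvg_big => [|i _]; [exact: mul_continuous|exact: (hl i).2].
Qed.

(** The method of images in integrated form. On finite boxes the two sides differ,
but their integrands have the same limit and a common majorant, so the
difference of the integrals vanishes in the limit. *)
Lemma spec_minus_image_cvg0 :
  (fun K => \int[mu]_(u in setT) spec_integrand K u - \int[mu]_(u in setT) image_integrand K u)
  @ \oo --> 0.
Proof.
pose C := 8 / L + 8 * kappa.
have C0 : 0 <= C by rewrite addr_ge0// ?divr_ge0 ?mulr_ge0// ltW.
have b1 K u : `|spec_integrand K u| <= envelope C u.
  by apply: prod_le_envelope => // i; exact: spec_factor_le.
have b2 K u : `|image_integrand K u| <= envelope C u.
  by apply: prod_le_envelope => // i; exact: image_factor_le.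
have iE := integrable_envelope C.
have i1 K : mu.-integrable setT (EFin \o spec_integrand K).
  by apply: le_integrable iE => //; [exact: measurable_spec_integrand|
    move=> u _; rewrite /= lee_fin (le_trans (b1 K u))// ler_norm].
have i2 K : mu.-integrable setT (EFin \o image_integrand K).
  by apply: le_integrable iE => //; [exact: measurable_image_integrand|
    move=> u _; rewrite /= lee_fin (le_trans (b2 K u))// ler_norm].
have iD K : mu.-integrable setT (EFin \o (fun u => spec_integrand K u - image_integrand K u)).
  have -> : EFin \o (fun u => spec_integrand K u - image_integrand K u) =
    ((EFin \o spec_integrand K) \- (EFin \o image_integrand K))%E by [].
  exact: integrableB.
suff D : (\int[mu]_u (spec_integrand K u - image_integrand K u)%:E)%E @[K --> \oo] -->
    (\int[mu]_u (cst 0 u : \bar R))%E.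
  move: D; rewrite integral0 => /fine_cvg D.
  by apply: cvg_trans D; apply: near_eq_cvg; near=> K; rewrite -RintegralB.
apply: (@dominated_cvg _ _ R mu setT measurableT
  (fun K u => (spec_integrand K u - image_integrand K u)%:E) (cst 0%E)
  (fun u => (envelope C u)%:E + (envelope C u)%:E)%E).
- by move=> K; exact: (measurable_int mu (iD K)).
- by move=> u _; apply: cvg_EFin; [exact: nearW|exact: cvg_integrand_diff].
- by move=> u _.
- exact: integrableD.
- move=> K u _; rewrite /= -EFinD lee_fin; apply: le_trans (ler_normB _ _) _.
  exact: lerD.
Unshelve. all: end_near. Qed.

End inside.
End subordination.

(** * The sum over the images *)
Section truncation_error.
Variables (R : realType) (d : nat) (bc : boundary_condition) (nu kappa L delta ell : R).
Variables (x y : 'rV[R]_d).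
Hypotheses (d_gt0 : (0 < d)%N) (nu0 : 0 < nu) (kappa0 : 0 < kappa).
Hypotheses (delta0 : 0 < delta) (ell0 : 0 < ell) (LE : L = delta + ell).
Hypotheses (hx : forall i, delta / 2 <= x 0 i <= L - delta / 2)
  (hy : forall i, delta / 2 <= y 0 i <= L - delta / 2).

Let L0 : 0 < L. Proof. by rewrite LE addr_gt0. Qed.
Let deltaL : delta <= L. Proof. by rewrite LE lerDl ltW. Qed.

Let fl := decay nu kappa ell.
Let numax0 : 0 < nu_max nu. Proof. by rewrite /nu_max lt_max nu0. Qed.
Let fl_ge0 : 0 <= fl. Proof. by apply: matern_ge0 => //; rewrite mulr_ge0// ltW. Qed.
Let fl_lt1 : fl < 1. Proof. by apply: matern_lt1 => //; rewrite mulr_gt0. Qed.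

(** Submultiplicativity applied m times, with steps of length ell. *)
Lemma matern_decay r m : 0 < r ->
  matern nu (kappa * (r + ell * m%:R)) <= matern nu (kappa * r) * fl ^+ m.
Proof.
move=> r0; elim: m => [|m IH]; first by rewrite mulr0 addr0 mulr1 lexx.
have -> : kappa * (r + ell * m.+1%:R) = kappa * (r + ell * m%:R) + kappa * ell.
  by rewrite -[m.+1%:R]natr1; ring.
have p0 : 0 < r + ell * m%:R by rewrite ltr_pwDl// mulr_ge0// ltW.
apply: le_trans (matern_submul nu0 _ _) _; rewrite ?mulr_gt0//.
rewrite exprSr mulrA; exact: ler_wpM2r.
Qed.

Lemma coord_le_norm2 (z : 'rV[R]_d) i : `|z 0 i| <= norm2 z.
Proof.
rewrite /norm2 -sqrtr_sqr ler_wsqrtr// (bigD1 i)//= lerDl sumr_ge0// => j _.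
exact: sqr_ge0.
Qed.

(** The near image of pair m has p = 2m+1, p/2 = m, and is at distance at least
delta + L m; the far image has p = 2m+2, p/2 = m+1, and is at distance at least
L (m+1) = delta + ell + L m. In both cases L >= ell gives delta + ell (p/2). *)
Lemma image_offset_decay i p : (0 < p)%N ->
  matern nu (kappa * `|image_offset bc L (x 0 i) (y 0 i) p|) <=
  matern nu (kappa * delta) * fl ^+ p./2.
Proof.
case: p => // p _.
suff : delta + ell * (p.+1./2)%:R <= `|image_offset bc L (x 0 i) (y 0 i) p.+1|.
  move=> h; apply: le_trans (matern_decay _ delta0).
  apply: matern_le => //; last by rewrite ler_pM2l.
  by rewrite mulr_ge0 ?(ltW kappa0)// addr_ge0 ?(ltW delta0)// mulr_ge0// ltW.
have eL : ell <= L by rewrite LE lerDr ltW.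
have [m [-> | ->]] : exists m, p = m.*2 \/ p = m.*2.+1.
  exists p./2; rewrite -{1 3}[p]odd_double_half.
  by case: (odd p); [right|left].
- rewrite image_odd /= uphalf_double.
  apply: le_trans (near_image_ge bc (ltW delta0) deltaL (hx i) (hy i) m).
  by rewrite lerD2l ler_wpM2r.
- rewrite image_even /= doubleK.
  apply: le_trans (far_image_ge bc (ltW delta0) deltaL (hx i) (hy i) m).
  have -> : L * m.+1%:R = delta + (ell + L * m%:R) by rewrite -[m.+1%:R]natr1 LE; ring.
  have -> : ell * m.+1%:R = ell + ell * m%:R by rewrite -[m.+1%:R]natr1; ring.
  by rewrite !lerD2l ler_wpM2r.
Qed.

(** The Euclidean norm of an image offset dominates the coordinate that realizes the height. *)
Lemma offset_row_decay K (f : {ffun 'I_d -> 'I_(nimages K)}) : height f != 0%N ->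
  matern nu (kappa * norm2 (offset_row bc L x y f)) <=
  matern nu (kappa * delta) * fl ^+ (height f)./2.
Proof.
move=> h0.
have [i hi] : exists i : 'I_d, height f = f i.
  have [|i hi] := @bigop.eq_bigmax 'I_d (fun i => f i : nat); first by rewrite card_ord.
  by exists i; rewrite /height hi.
rewrite hi; apply: le_trans (image_offset_decay i _); last by rewrite -hi lt0n.
apply: matern_le => //; first by rewrite mulr_ge0// ltW.
by rewrite ler_pM2l//; have := coord_le_norm2 (offset_row bc L x y f) i; rewrite mxE.
Qed.

(** The only offset of height 0 is x - y; all others are errors, controlled by shell_sum_le. *)
Lemma image_sum_error K :
  `|\sum_(f : {ffun 'I_d -> 'I_(nimages K)})
      (\prod_i offset_sign R bc (f i)) * matern nu (kappa * norm2 (offset_row bc L x y f))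
    - matern nu (kappa * norm2 (x - y))| <=
  error_const d nu kappa ell * matern nu (kappa * delta).
Proof.
pose f0 : {ffun 'I_d -> 'I_(nimages K)} := [ffun=> ord0].
have hf0 f : (height f == 0%N) = (f == f0).
  rewrite -leqn0; apply/height_leP/eqP => [h|-> i].
    by apply/ffunP => i; apply/val_inj/eqP; rewrite ffunE -leqn0; exact: h.
  by rewrite ffunE.
rewrite (bigD1 f0)//=.
have -> : (\prod_i offset_sign R bc (f0 i)) * matern nu (kappa * norm2 (offset_row bc L x y f0)) =
    matern nu (kappa * norm2 (x - y)).
  rewrite big1 ?mul1r; last by move=> i _; rewrite ffunE.
  by congr (matern _ (_ * norm2 _)); apply/rowP => i; rewrite !mxE ffunE.
rewrite addrAC subrr add0r; apply: le_trans (ler_norm_sum _ _ _) _.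
apply: le_trans (_ : \sum_(f : {ffun 'I_d -> 'I_(nimages K)} | height f != 0%N)
   matern nu (kappa * delta) * fl ^+ (height f)./2 <= _).
  rewrite (eq_bigl (fun f => height f != 0%N)); last by move=> f; rewrite hf0.
  apply: ler_sum => f hf; rewrite normrM normr_prod big1 ?mul1r; last first.
    by move=> i _; exact: offset_sign_norm.
  rewrite ger0_norm; first exact: offset_row_decay.
  by apply: matern_ge0 => //; rewrite mulr_ge0 ?(ltW kappa0)// sqrtr_ge0.
rewrite -mulr_sumr mulrC; apply: ler_wpM2r; last exact: shell_sum_le.
by apply: matern_ge0 => //; rewrite mulr_ge0// ltW.
Qed.

(** The image sums are within the error bound of the Matern covariance for every
truncation, and they converge to the spectral covariance: the constant eta is
the one that normalizes the Gamma factors of the two integral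
representations. The imaginary part vanishes because the integrand is real. *)
Lemma spectral_cov_error (sigma eta : R) :
  eta ^+ 2 = sigma ^+ 2 * ((4 * pi) `^ (d%:R / 2) * Gamma (nu + d%:R / 2) / (kappa ^+ d * Gamma nu)) ->
  Normc.normc (spectral_cov bc eta (nu + d%:R / 2) kappa L x y - (matern_cov sigma nu kappa x y)%:C%C)
  <= error_const d nu kappa ell * (sigma ^+ 2 * matern nu (kappa * delta)).
Proof.
move=> etaE; set alpha := nu + d%:R / 2.
have alpha0 : 0 < alpha by rewrite ltr_pwDl// divr_ge0.
have Ga : 0 < Gamma alpha by exact: Gamma_gt0.
pose term (k : 'rV[int]_d) := (Defs.eigenvalue bc kappa L k `^ (- alpha))%:C%C * mode_wave bc L x y k.
have -> : spectral_cov bc eta alpha kappa L x y = (eta ^+ 2)%:C%C * csum (modes bc) term.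
  rewrite /spectral_cov; congr (_ * csum _ _); apply/funext => k.
  by rewrite -mulrA eigenfunction_mul.
have alphaE : nu + d%:R / 2 = alpha by [].
pose box (g : R[i] -> R) K := \sum_(k <- mode_box d bc K) g (term k).
pose T K := \sum_(f : {ffun 'I_d -> 'I_(nimages K)})
  (\prod_i offset_sign R bc (f i)) * matern nu (kappa * norm2 (offset_row bc L x y f)).
pose c := (kappa / Num.sqrt (4 * pi)) ^+ d * Gamma nu.
pose M := matern nu (kappa * norm2 (x - y)).
have ReD : {morph @complex.Re R : z w / z + w} by move=> [? ?] [? ?].
have ImD : {morph @complex.Im R : z w / z + w} by move=> [? ?] [? ?].
have ReZ a (z : R[i]) : complex.Re (a%:C%C * z) = a * complex.Re z.
  by case: z => z w /=; rewrite mul0r subr0.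
have ImZ a (z : R[i]) : complex.Im (a%:C%C * z) = a * complex.Im z.
  by case: z => z w /=; rewrite mul0r addr0.
have Re_cvg : box (@complex.Re R) @ \oo --> rsum (modes bc) (fun k => complex.Re (term k)).
  exact: (@cvg_spec_box R d bc nu kappa L x y nu0 kappa0 L0 (@complex.Re R) (@normc_Re R)).
have Im_cvg : box (@complex.Im R) @ \oo --> rsum (modes bc) (fun k => complex.Im (term k)).
  exact: (@cvg_spec_box R d bc nu kappa L x y nu0 kappa0 L0 (@complex.Im R) (@normc_Im R)).
(* every truncated sum has imaginary part 0 *)
have Im0 : rsum (modes bc) (fun k => complex.Im (term k)) = 0.
  apply: (cvg_unique _ Im_cvg) => //.
  rewrite (_ : box _ = cst 0); first exact: cvg_cst.
  apply/funext => K; apply: (mulfI (lt0r_neq0 Ga)).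
  rewrite -(@integral_spec_part R d bc nu kappa L x y nu0 kappa0 L0 _ ImD ImZ K) mulr0.
  under eq_Rintegral do rewrite /= mulr0.
  by rewrite Rintegral_cst// mul0r.
have boxT : (fun K => Gamma alpha * box (@complex.Re R) K - c * T K) @ \oo --> 0.
  have := spec_minus_image_cvg0 bc nu0 kappa0 L0 (ltW delta0) deltaL hx hy.
  apply: cvg_trans; apply: near_eq_cvg; near=> K; rewrite integral_image//.
  congr (_ - _).
  exact: (@integral_spec_part R d bc nu kappa L x y nu0 kappa0 L0 _ ReD ReZ K).
set r := rsum _ _ in Re_cvg.
(* eta is defined so that this ratio of normalizations is the variance *)
have cE : eta ^+ 2 / Gamma alpha * c = sigma ^+ 2.
  rewrite etaE alphaE /c expr_div_n.
  have p4 : 0 < 4 * pi :> R by rewrite mulr_gt0// pi_gt0.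
  have -> : (4 * pi) `^ (d%:R / 2) = Num.sqrt (4 * pi) ^+ d :> R.
    by rewrite [d%:R / 2]mulrC powRrM powR12_sqrt ?(ltW p4)// powR_mulrn ?sqrtr_ge0.
  have q0 : Num.sqrt (4 * pi) ^+ d != 0 :> R by rewrite expf_neq0// gt_eqF// sqrtr_gt0.
  have k0 : kappa ^+ d != 0 by rewrite expf_neq0// gt_eqF.
  have gn := lt0r_neq0 (Gamma_gt0 nu0); have ga := lt0r_neq0 Ga.
  move: (Num.sqrt _ ^+ d) (kappa ^+ d) (Gamma nu) (Gamma alpha) q0 k0 gn ga => q k gn' ga' q0 k0 gn ga.
  by field; rewrite q0 k0 gn ga.
have T_cvg : (fun K => sigma ^+ 2 * T K) @ \oo --> eta ^+ 2 * r.
  have -> : eta ^+ 2 * r = eta ^+ 2 / Gamma alpha * (Gamma alpha * r - 0).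
    by rewrite subr0 mulrA divfK// gt_eqF.
  have -> : (fun K => sigma ^+ 2 * T K) = (fun K => eta ^+ 2 / Gamma alpha *
      (Gamma alpha * box (@complex.Re R) K - (Gamma alpha * box (@complex.Re R) K - c * T K))).
    by apply/funext => K; rewrite -cE; ring.
  apply: cvgM; first exact: cvg_cst.
  by apply: cvgB boxT; apply: cvgM => //; exact: cvg_cst.
have -> : csum (modes bc) term = r%:C%C by rewrite /csum Im0.
have -> : matern_cov sigma nu kappa x y = sigma ^+ 2 * M by [].
rewrite -rmorphM -rmorphB normc_real.
have E_cvg : (fun K => `|sigma ^+ 2 * T K - sigma ^+ 2 * M|) @ \oo -->
    `|eta ^+ 2 * r - sigma ^+ 2 * M|.
  by apply: cvg_norm; apply: cvgB => //; exact: cvg_cst.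
rewrite -(cvg_lim _ E_cvg)//; apply: limr_le; first exact: cvgP E_cvg.
apply: nearW => K; rewrite -mulrBr normrM ger0_norm ?sqr_ge0// mulrCA ler_wpM2l ?sqr_ge0//.
exact: image_sum_error.
Unshelve. all: end_near. Qed.

End truncation_error.

(** * Coordinates of the domain *)
Section bounding_box.
Variables (R : realType) (d : nat) (delta ell L : R) (D : set 'rV[R]_d).
Hypotheses (Dbnd : bounded_set D) (ellE : ell = sup [set `|x - y| | x in D & y in D]).

Lemma coord_le_norm (x : 'rV[R]_d) i : `|x 0 i| <= `|x|.
Proof.
rewrite [leRHS]/Num.norm/= mx_normrE.
exact: (le_bigmax _ (fun ij : 'I_1 * 'I_d => `|x ij.1 ij.2|) (0, i)).
Qed.

Lemma bounded_set_le : exists M : R, forall x, D x -> `|x| <= M.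
Proof. by have [M [_ hM]] := Dbnd; exists (M + 1) => x Dx; apply: hM => //; rewrite ltrDl. Qed.

Lemma dist_le_ell x y : D x -> D y -> `|x - y| <= ell.
Proof.
move=> Dx Dy; rewrite ellE; apply: ub_le_sup; last by exists x => //; exists y.
have [M hM] := bounded_set_le; exists (M + M) => _ [u Du [v Dv <-]].
by apply: le_trans (ler_normB _ _) _; apply: lerD; exact: hM.
Qed.

(** An open set contains two points that differ by a small diagonal vector. *)
Lemma open_ell_gt0 : open D -> D !=set0 -> (0 < d)%N -> 0 < ell.
Proof.
move=> oD [x Dx] d0; pose i := Ordinal d0.
have /nbhs_ballP[e /= e0 xe] : nbhs x D by exact: open_nbhs_nbhs.
have e2 : 0 < e / 2 by rewrite divr_gt0.
pose y : 'rV[R]_d := \row_j (x 0 j + e / 2).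
have Dy : D y.
  apply: xe; split => // k j; rewrite ord1 mxE /ball/= opprD addNKr normrN gtr0_norm//.
  by rewrite ltr_pdivrMr// mulr_natr mulr2n ltrDl.
apply: lt_le_trans (dist_le_ell Dx Dy); apply: lt_le_trans (coord_le_norm (x - y) i).
by rewrite !mxE opprD addNKr normrN gtr0_norm.
Qed.

Hypotheses (LE : L = delta + ell)
  (Dinf : forall i : 'I_d, inf [set x 0 i | x in D] = delta / 2).

(** Each coordinate is at least its infimum, and exceeds it by at most the
diameter ell. *)
Lemma in_box x i : D x -> delta / 2 <= x 0 i <= L - delta / 2.
Proof.
move=> Dx; have [M hM] := bounded_set_le.
have lb : has_lbound [set x 0 i | x in D].
  exists (- M) => _ [u Du <-]; rewrite lerNl.
  by apply: le_trans (hM _ Du); apply: le_trans (coord_le_norm u i); rewrite -normrN ler_norm.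
apply/andP; split.
  by rewrite -(Dinf i); apply: ge_inf => //; exists x.
suff : x 0 i - ell <= delta / 2 by rewrite LE; lra.
rewrite -(Dinf i); apply: lb_le_inf; first by exists (x 0 i), x.
move=> _ [u Du <-]; rewrite lerBlDr addrC -lerBlDr.
apply: le_trans (dist_le_ell Dx Du); apply: le_trans (coord_le_norm (x - u) i).
by rewrite !mxE ler_norm.
Qed.

End bounding_box.

Unset Implicit Arguments.

Theorem theorem3p2 (R : realType) (d : nat) (bc : boundary_condition)
  (sigma nu rho kappa alpha eta delta ell L : R) (D : set 'rV[R]_d)
  (hd : (1 <= d <= 3)%N)
  (hsigma : 0 < sigma ^+ 2) (hnu : 0 < nu) (hrho : 0 < rho)
  (hkappa : kappa = Num.sqrt (2 * nu) / rho)
  (halpha : alpha = nu + d%:R / 2)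
  (heta0 : 0 < eta)
  (heta : eta ^+ 2 =
    sigma ^+ 2 * ((4 * pi) `^ (d%:R / 2) * Gamma (nu + d%:R / 2)
                  / (kappa ^+ d * Gamma nu)))
  (hDne : D !=set0) (hDopen : open D) (hDsc : simply_connected D)
  (hDbnd : bounded_set D)
  (hdelta : 0 < delta)
  (hDinf : forall i : 'I_d, inf [set x 0 i | x in D] = delta / 2)
  (hell : ell = sup [set `|x - y| | x in D & y in D])
  (hL : L = delta + ell) :
  (cov_error D (spectral_cov bc eta alpha kappa L) (matern_cov sigma nu kappa)
   <= (error_const d nu kappa ell
       * (sigma ^+ 2 * matern nu (kappa * delta)))%:E)%E.
Proof.
have /andP[d0 _] := hd.
have kappa0 : 0 < kappa by rewrite hkappa divr_gt0// sqrtr_gt0 mulr_gt0.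
have ell0 : 0 < ell := open_ell_gt0 hDbnd hell hDopen hDne d0.
rewrite halpha; apply: ge_ereal_sup => _ [x Dx [y Dy <-]].
rewrite lee_fin; apply: spectral_cov_error heta => // i; exact: (in_box hDbnd hell).
Qed.
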